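(* Let $T$ be a hyperbolic matrix, that is, $T\in SL_2(\mathbb{Z})$ with trace greater than $2$ (so $T$ has two irrational eigenvalues), and let $SOL=\mathbb{Z}^2\rtimes_T\mathbb{Z}$. Let $H$ be the derived subgroup of $SOL$, which is isomorphic to $\mathbb{Z}^2$, and let $t$ be the element of $\mathbb{Z}$ acting on $H$ as $T$. Then: (1) There are two types of left-orderings on $SOL$: those which are Conradian, and those which are induced by affine actions (affine orderings), meaning orderings induced from a faithful order-preserving affine action of $SOL$ on $\mathbb{R}$ in which $t$ acts by multiplication by one of the two eigenvalues of $T$. (2) The Conradian orderings form a closed subset of $\mathcal{LO}(SOL)$, and they are exactly the left-orderings for which the normal subgroup $H\simeq\mathbb{Z}^2$ is convex. Therefore they form two copies of the Cantor set $\mathcal{LO}(\mathbb{Z}^2)$, each corresponding to a choice of sign for $t$. Here $\mathcal{LO}(\mathbb{Z}^2)$ is described as follows. Each oriented line through the origin in $\mathbb{R}^2$ delimits a half-plane (the one on its right), which defines the positive cone of a pseudo-ordering on $\mathbb{Z}^2$; the elements of $\mathbb{Z}^2$ on the line form a cyclic convex subgroup, trivial precisely when the slope is irrational, in which case the pseudo-ordering is an ordering. When the slope is rational, one specifies in addition an ordering of this cyclic convex subgroup, determined by a sign. Thus $\mathcal{LO}(\mathbb{Z}^2)$ is parametrized by the Cantor set obtained by doubling each rational point of the circle. (3) Among these orderings on $\mathbb{Z}^2$, those invariant under conjugation by $t$ are precisely those corresponding to lines which are eigendirections of $T$. The corresponding orderings of $SOL$ are those which are bi-invariant. Taking into account the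 choices of orientations, this gives precisely eight bi-orderings of $SOL$. (4) The complement of the set of Conradian orderings, namely the set of orderings induced by affine actions, is an open subset of $\mathcal{LO}(SOL)$ with eight accumulation points, namely the bi-orderings of $SOL$. The affine orderings are represented by four copies of $\mathbb{R}$, compactified at $\pm\infty$ by pairs of bi-orderings corresponding to two different eigendirections; these four intervals are to be thought of as Cantor sets, in the following sense. The pseudo-orderings $\preceq_x^{(i)}$, $i=1,\dots,4$, induced by the orbit of one point $x$ under an affine action of $SOL$ on the line, are determined by the choice of an orientation of the line and of the action of $t$ by multiplication by one of the two eigenvalues of $T$, and hence are naturally parametrized by four copies of the real line. The pseudo-ordering $\preceq_x^{(i)}$ is an ordering precisely when the stabilizer of $x$ is trivial, which happens on the complement of some dense countable subset $D\subset\mathbb{R}$ (corresponding to the possible values of translations of elements of $\mathbb{Z}^2$). Otherwise, to define an ordering on $SOL$ one needs to specify an orientation on the convex cyclic subgroup of homotheties fixing $x$. Therefore the subset of affine orderings is locally a Cantor set, obtained by doubling the points belonging to $D$ in each of the four copies of $\mathbb{R}$. Moreover, for one of these intervals corresponding to an action where $t$ acts by dilation (i.e. $t^{-1}$ acts by contraction), with associated pseudo-orderings $\preceq_x^{(1)}$, when $x$ goes to $\infty$, $\preceq_x^{(1)}$ converges to an ordering in which translations form a convex subgroup, and this limiting ordering is one of the eight bi-orderings. (5) $SOL$ has no isolated left-orderings, and $\mathcal{LO}(SOL)$ is a Cantor set.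
   Context: A left-ordering on a group $G$ is a total order $\preceq$ on $G$ such that $f\preceq g$ implies $hf\preceq hg$. The space $\mathcal{LO}(G)$ is the set of all left-orderings of $G$, with the topology having as a basis the sets $\{\preceq\;\mid\; id\preceq f_1,\dots,id\preceq f_k\}$ for finite subsets $\{f_1,\dots,f_k\}\subset G$. The positive cone of $\preceq$ is $\{g: g\succ id\}$. A bi-ordering (bi-invariant ordering) is a left-ordering whose positive cone is preserved under conjugation. A left-ordering is Conradian if $f\succ id$ and $g\succ id$ imply $fg^2\succ g$. A subgroup $C$ of $(G,\preceq)$ is convex if $h_1\preceq g\preceq h_2$ with $h_1,h_2\in C$ implies $g\in C$. A pseudo-ordering on $G$ is a left-invariant partial ordering on $G$ induced from a $G$-invariant total ordering $\preceq^*$ on a quotient $G/K$, $K$ a (not necessarily normal) subgroup: $id\prec g$ if and only if $K\prec^* gK$; a convex subgroup of a pseudo-ordered group is defined as for orderings, with the additional requirement that it contain $K$. The pseudo-ordering induced by the orbit of a point $x$ under an action of $G$ on $\mathbb{R}$ is given by $id\prec g$ if and only if $g(x)>x$. Given a faithful action of $G$ on $\mathbb{R}$ by order-preserving homeomorphisms and a dense sequence $(x_1,x_2,\dots)$ in $\mathbb{R}$, the induced ordering is defined by: $g\succ id$ if and only if $g(x_i)>x_i$, where $i$ is the first index such that $g(x_i)\neq x_i$, so that $g(x_j)=x_j$ for every $j<i$. (For an affine action two distinct points $x_1,x_2$ suffice.)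
   Formalization: H is the Z² factor, not the derived subgroup, which has finite index and is never convex when tr T > 3; the two ends of each interval share one oriented eigendirection with opposite signs of t; accumulation points are those outside the affine set. *)

(* Defs.v *)
From HB Require Import structures.
From mathcomp Require Import all_boot all_order all_algebra.
From mathcomp Require Import all_classical all_reals all_analysis.

Set Implicit Arguments.
Unset Strict Implicit.
Unset Printing Implicit Defensive.

Import Order.TTheory GRing.Theory Num.Theory.
Import numFieldNormedType.Exports.

Local Open Scope classical_set_scope.
Local Open Scope ring_scope.

Definition derived_subgroup (G : groupType) : set G :=
  \bigcap_(K in [set K : set G | group_closed [in K] /\
                                 forall x y, K [~ x, y]%g]) K.
Arguments derived_subgroup G : clear implicits.

Definition cyclic_subgroup (G : groupType) (g : G) : set G :=
  [set h | exists n : nat, h = (g ^+ n)%g \/ h = (g ^- n)%g].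

Definition lcoset (G : groupType) (K : set G) (g : G) : set G :=
  [set (g * k)%g | k in K].

Definition left_ordering (G : groupType) (le : rel G) :=
  [/\ reflexive le, antisymmetric le, transitive le, total le &
      forall f g h : G, le f g -> le (h * f)%g (h * g)%g].

Record LO (G : groupType) := MkLO { lo_le :> rel G; loP : left_ordering lo_le }.

Definition lo_lt (G : groupType) (o : LO G) (f g : G) : bool :=
  (f != g) && o f g.

HB.instance Definition _ (G : groupType) := gen_eqMixin (LO G).
HB.instance Definition _ (G : groupType) := gen_choiceMixin (LO G).

Definition lo_base (G : groupType) (s : seq G) : set (LO G) :=
  [set o | all (o 1%g) s].

HB.instance Definition _ (G : groupType) := isPointed.Build (seq G) [::].

Lemma lo_base_cover (G : groupType) :
  \bigcup_(s in [set: seq G]) lo_base s = setT.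
Proof. by apply/seteqP; split=> // o _; exists [::]. Qed.

Lemma lo_base_join (G : groupType) (s s' : seq G) (o : LO G) :
  setT s -> setT s' -> lo_base s o -> lo_base s' o ->
  exists k, [/\ setT k, lo_base k o & lo_base k `<=` lo_base s `&` lo_base s'].
Proof.
move=> _ _ os os'; exists (s ++ s'); split=> //; first last.
  by move=> o'; rewrite /lo_base /= all_cat => /andP[].
by rewrite /lo_base /= all_cat; apply/andP.
Qed.

HB.instance Definition _ (G : groupType) :=
  isBaseTopological.Build (LO G) (@lo_base_cover G) (@lo_base_join G).

Definition bi_ordering (G : groupType) (o : LO G) :=
  forall f g : G, lo_lt o 1%g f -> lo_lt o 1%g (f ^ g)%g.

Definition conradian (G : groupType) (o : LO G) :=
  forall f g : G, lo_lt o 1%g f -> lo_lt o 1%g g -> lo_lt o g (f * g ^+ 2)%g.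

Definition convex_subgroup (G : groupType) (o : LO G) (C : set G) :=
  group_closed [in C] /\
  forall h1 h2 g, C h1 -> C h2 -> o h1 g -> o g h2 -> C g.

(* A pseudo-ordering is given by its strict part [lt];
   [le] is the total ordering of the set [range (lcoset K)] of left cosets. *)
Definition pseudo_ordering (G : groupType) (lt : G -> G -> Prop) (K : set G) :=
  group_closed [in K] /\
  exists le : set G -> set G -> Prop,
    [/\ forall f, le (lcoset K f) (lcoset K f),
        forall f g, le (lcoset K f) (lcoset K g) ->
          le (lcoset K g) (lcoset K f) -> lcoset K f = lcoset K g,
        forall f g h, le (lcoset K f) (lcoset K g) ->
          le (lcoset K g) (lcoset K h) -> le (lcoset K f) (lcoset K h),
        forall f g, le (lcoset K f) (lcoset K g) \/
                    le (lcoset K g) (lcoset K f) &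
        (forall f g h, le (lcoset K f) (lcoset K g) ->
          le (lcoset K (h * f)%g) (lcoset K (h * g)%g)) /\
        (forall f g, lt f g <->
          le (lcoset K f) (lcoset K g) /\ lcoset K f <> lcoset K g)].

Definition pseudo_convex (G : groupType) (lt : G -> G -> Prop) (K C : set G) :=
  [/\ group_closed [in C], K `<=` C &
      forall h1 h2 g, C h1 -> C h2 ->
        h1 = g \/ lt h1 g -> g = h2 \/ lt g h2 -> C g].

Definition is_ordering (G : groupType) (lt : G -> G -> Prop) :=
  exists o : LO G, forall f g, lt f g <-> lo_lt o f g.

Definition extends (G : groupType) (o : LO G) (lt : G -> G -> Prop) :=
  forall f g, lt f g -> lo_lt o f g.

Definition homeo (X Y : topologicalType) (A : set X) (B : set Y) (f : X -> Y) :=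
  exists g : Y -> X,
    [/\ forall x, A x -> B (f x) /\ g (f x) = x,
        forall y, B y -> A (g y) /\ f (g y) = y,
        {within A, continuous f} & {within B, continuous g}].

Definition is_cantor (X : topologicalType) (A : set X) :=
  exists f : X -> cantor_space, homeo A [set: cantor_space] f.

(* The real line with the points of D doubled: a point x of D is replaced by
   (x, false) < (x, true), and a point x outside of D is represented by
   (x, false). The topology is that of [order_topology (dline D)]. *)
Definition dline_pred (R : realType) (D : set R) : pred (R *l bool) :=
  fun p => (p.1 \in D) || ~~ p.2.

Definition dline (R : realType) (D : set R) : Type :=
  {p : R *l bool | dline_pred D p}.

HB.instance Definition _ (R : realType) (D : set R) :=
  SubChoice.on (dline D).
HB.instance Definition _ (R : realType) (D : set R) :=
  [SubChoice_isSubOrder of dline D by <: with Order.Disp tt tt].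

Definition Z2 : Type := Algebra.to_multiplicative 'cV[int]_2.
HB.instance Definition _ := Group.on Z2.

Definition det2 (R : realType) (u v : 'cV[R]_2) : R :=
  u 0 0 * v 1 0 - u 1 0 * v 0 0.

Definition toR2 (R : realType) (v : Z2) : 'cV[R]_2 :=
  map_mx intr (v : 'cV[int]_2).

(* An oriented line through 0 is given by its unit direction vector. *)
Definition unit_dir (R : realType) (d : 'cV[R]_2) :=
  d 0 0 ^+ 2 + d 1 0 ^+ 2 = 1.

Definition rational_slope (R : realType) (d : 'cV[R]_2) :=
  d 0 0 = 0 \/ rational (d 1 0 / d 0 0).

(* [det2 d v < 0] says that v lies on the right of the line directed by d. *)
Definition line_lt (R : realType) (d : 'cV[R]_2) (v w : Z2) : Prop :=
  det2 d (toR2 R (v^-1 * w)%g) < 0.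

Definition line_pts (R : realType) (d : 'cV[R]_2) : set Z2 :=
  [set v | det2 d (toR2 R v) = 0].

(* As in [dline], for the counterclockwise cyclic order: a direction d of
   rational slope is replaced by (d, false) followed by (d, true). *)
Definition dcircle_pred (R : realType) : pred ('cV[R]_2 * bool) :=
  fun p => `[< unit_dir p.1 /\ (rational_slope p.1 \/ p.2 = false) >].

Definition dcircle (R : realType) : Type :=
  {p : 'cV[R]_2 * bool | dcircle_pred p}.

HB.instance Definition _ (R : realType) := SubChoice.on (dcircle R).

(* [ccw a b c]: the triangle abc inscribed in the circle is positively oriented,
   i.e., a, b, c are met in this order when turning counterclockwise. *)
Definition ccw (R : realType) (a b c : 'cV[R]_2) : bool :=
  0 < det2 (b - a) (c - a).

Definition dccw (R : realType) (p q r : dcircle R) : bool :=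
  let jump (x y z : dcircle R) :=
    [&& (val x).1 == (val y).1, ~~ (val x).2, (val y).2 &
        (val z).1 != (val x).1] in
  [|| ccw (val p).1 (val q).1 (val r).1,
      jump p q r, jump q r p | jump r p q].

Definition dcircle_arcs (R : realType) : set (set (dcircle R)) :=
  [set A | exists p r, A = [set q | dccw p q r]].

HB.instance Definition _ (R : realType) :=
  isSubBaseTopological.Build (dcircle R) (@dcircle_arcs R) id.

Definition SOL (T : 'M[int]_2) (detT : \det T = 1) : Type := ('cV[int]_2 * int)%type.

Section SOL.
Variables (T : 'M[int]_2) (detT : \det T = 1).

HB.instance Definition _ := Choice.on (SOL detT).

Definition sol_one : SOL detT := (0, 0).
Definition sol_mul (a b : SOL detT) : SOL detT :=
  (a.1 + T ^ a.2 *m b.1, a.2 + b.2).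
Definition sol_inv (a : SOL detT) : SOL detT :=
  (- (T ^ (- a.2) *m a.1), - a.2).

Lemma sol_unit : T \is a GRing.unit.
Proof. by rewrite -[_ \is a _]/(T \in unitmx) unitmxE detT unitr1. Qed.

Lemma sol_mulA : associative sol_mul.
Proof.
move=> [u m] [v n] [w k]; rewrite /sol_mul /=; congr pair; last exact: addrA.
by rewrite exprzDr ?sol_unit// mulmxDr mulmxA addrA.
Qed.

Lemma sol_mul1 : left_id sol_one sol_mul.
Proof. by move=> [v n]; rewrite /sol_mul /= expr0z mul1mx !add0r. Qed.

Lemma sol_mulr1 : right_id sol_one sol_mul.
Proof. by move=> [v n]; rewrite /sol_mul /= mulmx0 !addr0. Qed.

Lemma sol_mulV : left_inverse sol_one sol_inv sol_mul.
Proof. by move=> [v n]; rewrite /sol_mul /= !addNr. Qed.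

Lemma sol_mulrV : right_inverse sol_one sol_inv sol_mul.
Proof.
move=> [v n]; rewrite /sol_mul /= mulmxN mulmxA.
rewrite -[T ^ n *m _]/(T ^ n * T ^ (- n)) -exprzDr ?sol_unit//.
by rewrite !subrr expr0z mul1mx subrr.
Qed.

HB.instance Definition _ :=
  isGroup.Build (SOL detT) sol_mulA sol_mul1 sol_mulr1 sol_mulV sol_mulrV.

Definition sol_t : SOL detT := (0, 1).

Definition sol_iota (v : Z2) : SOL detT := (v : 'cV[int]_2, 0).

(* The normal subgroup H. The derived subgroup is the finite index subgroup
   (T - 1)Z^2 of the Z^2 factor; it is proper when \tr T > 3, and then it is
   never convex, so H is the Z^2 factor. *)
Definition sol_H : set (SOL detT) := range sol_iota.

Definition restricts (o : LO (SOL detT)) (o' : LO Z2) :=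
  forall v w : Z2, o' v w = o (sol_iota v) (sol_iota w).

Definition t_invariant (o : LO Z2) :=
  forall v w : Z2, (sol_t * sol_iota v * sol_t^-1)%g = sol_iota w ->
    lo_lt o 1%g v -> lo_lt o 1%g w.

Definition eigendirection (R : realType) (d : 'cV[R]_2) :=
  unit_dir d /\ exists lam : R, map_mx intr T *m d = lam *: d.

Definition affine_action (R : realType) (a : SOL detT -> R -> R) (lam : R) :=
  [/\ (forall x, a 1%g x = x) /\ (forall f g x, a (f * g)%g x = a f (a g x)),
      forall g, exists u v : R, 0 < u /\ (forall x, a g x = u * x + v),
      forall g, (forall x, a g x = x) -> g = 1%g,
      eigenvalue (map_mx intr T : 'M[R]_2) lam &
      forall x, a sol_t x = lam * x].

Definition induced_by (R : realType) (a : SOL detT -> R -> R) (x : nat -> R)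
    (o : LO (SOL detT)) :=
  forall g, lo_lt o 1%g g <->
    exists i, (forall j, (j < i)%N -> a g (x j) = x j) /\ x i < a g (x i).

Definition affine_ordering (R : realType) (o : LO (SOL detT)) :=
  exists (a : SOL detT -> R -> R) (lam : R) (x : nat -> R),
    [/\ affine_action a lam, dense (range x) & induced_by a x o].

Definition orbit_lt (R : realType) (a : SOL detT -> R -> R) (x : R)
    (f g : SOL detT) : Prop := x < a (f^-1 * g)%g x.

Definition stab (R : realType) (a : SOL detT -> R -> R) (x : R) :
  set (SOL detT) := [set g | a g x = x].

Definition translations (R : realType) (a : SOL detT -> R -> R) :
  set (SOL detT) := [set g | exists c, forall x, a g x = x + c].

End SOL.

Arguments sol_t [T] detT.
Arguments sol_iota [T] detT v.
Arguments sol_H [T] detT.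
Arguments t_invariant [T] detT o.

(* Main.v *)
Require Import Defs.
From HB Require Import structures.
From mathcomp Require Import all_boot all_order all_algebra finmap.
From mathcomp Require Import all_classical all_reals all_analysis.
From mathcomp Require Import zify lra.
Import Order.TTheory GRing.Theory Num.Theory.
Import numFieldNormedType.Exports.
Local Open Scope classical_set_scope.
Local Open Scope ring_scope.

Set Implicit Arguments.
Unset Strict Implicit.
Unset Printing Implicit Defensive.

(** Everything rests on the two linear forms on Z^2 that [T] multiplies by its
    eigenvalues. They are injective on Z^2 because the eigenvalues are irrational
    ([psi_inj]), they have dense values because [T] contracts ([psi_dense]), and
    with a sign they define four affine actions on the line, [act e s], in which
    Z^2 acts by translations and [t] by homotheties. Up to homotheties there are no
    others ([affine_normal]).

    Let a left-ordering of SOL be given. If H is convex then the ordering is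
    lexicographic, given by the sign of [t] and an ordering of H ([convex_lex]);
    such orderings are Conradian. If H is not convex then it is cofinal
    ([nonconvex_cofinal]), and an element of H that moves one element of the group
    forwards moves all of them forwards. The ordering of H is therefore invariant
    under [t] and is the sign of one of the two forms ([cofinal_eigenform]). As the
    values of the form are dense, each element of the group defines a cut of the
    real line. The function [cut] so obtained is a cocycle, and an affine action has
    no others than those of orbits ([cut_orbit]): the ordering is induced by a point
    [x] of one of the four actions, and by a side [b] of [x] which matters only if
    [x] has a nontrivial stabilizer ([cut_affLO]). These orderings are not Conradian,
    since two strong contractions violate the inequality ([affLO_not_conradian]).
    Hence Conradian, H convex and not affine are equivalent.

    For the orderings of Z^2, a cut of the rationals provides the direction of the
    line ([order_direction]), and an orientation of the line remains to be chosen
    when it contains lattice points ([extends_dirLO_eq]). The orderings for which a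
    lattice point is positive form half of the doubled circle ([half_circle_arc]),
    and each arc is a neighbourhood of its points for the orderings ([arc_nbhs]).

    In the affine family [act e s] a contraction or an expansion is positive on a
    ray of the doubled line that starts at its fixed point ([pos_affLO_expand],
    [pos_affLO_contract]), and such fixed points are dense; this is the
    homeomorphism with the doubled line ([dlineLO_homeo]). The points with a
    nontrivial stabilizer are the rational multiples of the values of the form,
    because [T] has finite order modulo any integer and the traces of its powers are
    integers ([stab_nontrivial]). When the point goes to infinity the sign of an
    element is decided by its ratio, or by its translation length when it belongs to
    H ([endpt_near]): the limits are the lexicographic orderings for which the order
    of H is given by an eigenform. These are exactly the bi-orderings
    ([bi_orderingP]), and exactly the limits of affine orderings that are not affine
    ([limit_affine]). Four forms and two signs of [t] make eight of them.

    Finally no ordering is isolated: directions, points of the line, and orders of H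
    can be perturbed without changing finitely many signs ([SOL_not_isolated]).
    Sign sequences of orderings form a compact set, and so closed and open sets of
    orderings are Cantor sets ([is_cantor_LO]). *)

(** * Left-orderings and their topology *)

Definition pos (G : groupType) (o : LO G) (g : G) : bool := lo_lt o 1%g g.

Section LeftOrder.
Variable G : groupType.
Implicit Types (o : LO G) (f g h : G).

Lemma lo_refl o f : o f f. Proof. by case: o => le [] /=. Qed.
Lemma lo_anti o f g : o f g -> o g f -> f = g.
Proof. by case: o => le [_ a _ _ _] /= fg gf; apply: a; rewrite fg gf. Qed.
Lemma lo_trans o f g h : o f g -> o g h -> o f h.
Proof. by case: o => le [_ _ t _ _] /=; exact: t. Qed.
Lemma lo_total o f g : o f g || o g f.
Proof. by case: o => le [_ _ _ t _] /=; exact: t. Qed.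
Lemma lo_mul2l o h f g : o (h * f)%g (h * g)%g = o f g.
Proof.
case: o => le [_ _ _ _ m] /=; apply/idP/idP; last exact: m.
by move=> /(m _ _ h^-1%g); rewrite !mulKg.
Qed.

Lemma lo_ltE o f g : lo_lt o f g = pos o (f^-1 * g)%g.
Proof.
rewrite /pos /lo_lt -[in RHS](mulVg f) lo_mul2l; congr (~~ _ && _).
by rewrite (inj_eq (@mulgI _ f^-1%g)).
Qed.

Lemma lo_leE o f g : o f g = (f == g) || lo_lt o f g.
Proof. by rewrite /lo_lt; case: eqVneq => [->|] //=; rewrite lo_refl. Qed.

Lemma lo_leNlt o f g : o f g = ~~ lo_lt o g f.
Proof.
rewrite /lo_lt; case: eqVneq => [->|gf] /=; first by rewrite lo_refl.
apply/idP/negP => [fg gf'|]; first by rewrite (lo_anti fg gf') eqxx in gf.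
by have /orP[|] := lo_total o f g.
Qed.

Lemma lo_ltNle o f g : lo_lt o f g = ~~ o g f.
Proof. by rewrite lo_leNlt negbK. Qed.

Lemma lo_lt_trans o f g h : lo_lt o f g -> lo_lt o g h -> lo_lt o f h.
Proof.
rewrite 2!lo_ltNle => gf hg; rewrite lo_ltNle; apply/negP => hf; move/negP: hg; apply.
apply: lo_trans hf _; have := lo_total o f g; by rewrite (negbTE gf) orbF.
Qed.

Lemma lo_lt_le_trans o f g h : lo_lt o f g -> o g h -> lo_lt o f h.
Proof. by move=> fg; rewrite lo_leE => /orP[/eqP<-//|]; exact: lo_lt_trans. Qed.

Lemma lo_ltW o f g : lo_lt o f g -> o f g.
Proof. by move=> fg; rewrite lo_leE fg orbT. Qed.

Lemma lo_lt_mul2l o h f g : lo_lt o (h * f)%g (h * g)%g = lo_lt o f g.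
Proof. by do 2!rewrite lo_ltNle; rewrite lo_mul2l. Qed.

Lemma pos1 o : pos o 1%g = false. Proof. by rewrite /pos /lo_lt eqxx. Qed.

Lemma posM o f g : pos o f -> pos o g -> pos o (f * g)%g.
Proof.
move=> pf pg; apply: lo_lt_trans pf _.
by rewrite -[X in lo_lt _ X](mulg1 f) lo_lt_mul2l.
Qed.

Lemma posV o g : g != 1%g -> pos o g^-1%g = ~~ pos o g.
Proof.
move=> g1; rewrite -[X in pos _ X]mulg1 -lo_ltE lo_ltNle; congr (~~ _).
by rewrite lo_leE eq_sym (negbTE g1).
Qed.

Lemma pos_neq1 o g : pos o g -> g != 1%g.
Proof. by apply: contraTneq => ->; rewrite pos1. Qed.

Lemma pos_asym o g : pos o g -> pos o g^-1%g = false.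
Proof. by move=> pg; rewrite posV ?pg// (pos_neq1 pg). Qed.

Lemma posX o g n : pos o g -> pos o (g ^+ n.+1)%g.
Proof.
move=> pg; elim: n => [|n IH]; first by rewrite expg1.
by rewrite expgS; apply: posM.
Qed.

Lemma posXE o g n : pos o (g ^+ n.+1)%g = pos o g.
Proof.
have [->|g1] := eqVneq g 1%g; first by rewrite expg1n.
apply/idP/idP; last exact: posX.
apply: contraLR; rewrite -posV// => /(posX n).
by rewrite expVgn => /pos_asym; rewrite invgK => ->.
Qed.

(** Of [g] and [g^-1] exactly one is positive, so positive cones are maximal and
    an inclusion between two of them is an equality. *)
Lemma LO_sub_eq o o' : (forall g, pos o g -> pos o' g) -> o = o'.
Proof.
move=> sub.
have E g : pos o g = pos o' g.
  apply/idP/idP => [/sub//|pg]; have g1 := pos_neq1 pg.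
  apply: contraTT pg; rewrite -!posV//; exact: sub.
have {E sub} : lo_le o = lo_le o'.
  by apply: funext => f; apply: funext => g; rewrite !lo_leE !lo_ltE E.
case: o o' => [le p] [le' p'] /= e; move: p p'; rewrite e => p p'.
by congr MkLO; exact: Prop_irrelevance.
Qed.

Section Cone.
Variable P : G -> Prop.
Hypotheses (P1 : ~ P 1%g) (PM : forall f g, P f -> P g -> P (f * g)%g)
  (PV : forall g, g <> 1%g -> P g \/ P g^-1%g).

Definition cone_le : rel G := fun f g => (f == g) || `[< P (f^-1 * g)%g >].

Lemma cone_left_ordering : left_ordering cone_le.
Proof.
rewrite /cone_le; split.
- by move=> f; rewrite eqxx.
- move=> f g /andP[/orP[/eqP//|/asboolP a] /orP[/eqP//|/asboolP b]].
  by case: P1; move: (PM a b); rewrite -mulgA mulVKg mulVg.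
- move=> g f h /orP[/eqP->//|/asboolP a] /orP[/eqP<-|/asboolP b].
    by apply/orP; right; apply/asboolP.
  by apply/orP; right; apply/asboolP; move: (PM a b); rewrite -mulgA mulVKg.
- move=> f g; have [->|fg] := pselect (f = g); first by rewrite eqxx.
  have /PV : (f^-1 * g)%g <> 1%g.
    by move/(congr1 (fun x => (f * x)%g)); rewrite mulVKg mulg1 => /esym.
  rewrite (invgM f^-1%g) invgK; case=> [a|b]; apply/orP.
    by left; apply/orP; right; apply/asboolP.
  by right; apply/orP; right; apply/asboolP.
- move=> f g h /orP[/eqP->|]; first by rewrite eqxx.
  by move=> a; apply/orP; right; rewrite invgM -mulgA mulKg.
Qed.

Definition coneLO : LO G := MkLO cone_left_ordering.

Lemma pos_cone g : pos coneLO g <-> P g.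
Proof.
rewrite /pos /lo_lt /= /cone_le invg1 mul1g; split.
  by case/andP=> /negbTE -> /= /asboolP.
move=> Pg; apply/andP; split; last by apply/orP; right; apply/asboolP.
by apply/eqP => g1; apply: P1; rewrite g1.
Qed.

End Cone.

(** Among finitely many conditions [1 <= g] those with [g = 1] are void, and the
    others are strict: neighbourhoods can be described by positive cones only. *)
Lemma nbhs_LO o (U : set (LO G)) :
  nbhs o U <-> exists s : seq G, all (pos o) s /\
                 forall o', all (pos o') s -> U o'.
Proof.
rewrite nbhsE; split.
  move=> [V [oV Vo] VU]; case: oV => D' _ eD; move: Vo; rewrite -eD.
  move=> [s Ds so]; exists [seq g <- s | g != 1%g]; split.
    rewrite all_filter; apply: sub_all so => g /= og.
    by apply/implyP => g1; rewrite /pos /lo_lt eq_sym g1.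
  move=> o' so'; apply: VU; rewrite -eD; exists s => //.
  move: so'; rewrite all_filter; apply: sub_all => g /=.
  by case: eqVneq => [->|_] /=; rewrite ?lo_refl// /pos => /lo_ltW.
move=> [s [so sU]]; exists (lo_base s `&` [set o' | all (pos o') s]).
  split; last by split=> //; rewrite /lo_base /=; apply: sub_all so => g /lo_ltW.
  exists [set s] => //; rewrite bigcup_set1; apply/seteqP; split.
    move=> o' so'; split=> //; rewrite /=; apply/allP => g gs.
    have := allP so' _ gs; rewrite lo_leE => /orP[/eqP g1|//].
    by have := allP so _ gs; rewrite -g1 pos1.
  by move=> o' [].
by move=> o' [_]; exact: sU.
Qed.

Lemma nbhs_pos o g : pos o g -> nbhs o [set o' | pos o' g].
Proof. by move=> og; apply/nbhs_LO; exists [:: g]; rewrite /= og; split=> // o' /andP[]. Qed.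

Lemma open_pos g : open [set o | pos o g].
Proof. by rewrite openE => o og; exact: nbhs_pos. Qed.

Lemma open_posN g : open [set o | ~~ pos o g].
Proof.
have [->|g1] := eqVneq g 1%g.
  rewrite [X in open X](_ : _ = setT); first exact: openT.
  by apply/seteqP; split=> // o _ /=; rewrite pos1.
rewrite [X in open X](_ : _ = [set o | pos o g^-1%g]); first exact: open_pos.
by apply/seteqP; split=> o /=; rewrite posV.
Qed.

Lemma closed_pos g : closed [set o | pos o g].
Proof.
rewrite -openC [X in open X](_ : _ = [set o | ~~ pos o g]); first exact: open_posN.
by apply/seteqP; split=> o /= /negP.
Qed.

Lemma closed_posN g : closed [set o | ~~ pos o g].
Proof.
rewrite -openC [X in open X](_ : _ = [set o | pos o g]); first exact: open_pos.
by apply/seteqP; split=> o /=; case: (pos o g) => //=; rewrite notE.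
Qed.

Lemma clopen_all_pos (s : seq G) : clopen [set o : LO G | all (pos o) s].
Proof.
elim: s => [|g s IH] /=.
  rewrite (_ : [set _ | _] = setT); first by split; [exact: openT|exact: closedT].
  by apply/seteqP; split.
rewrite (_ : [set _ | _] = [set o | pos o g] `&` [set o | all (pos o) s]).
  apply: clopenI => //; split; [exact: open_pos|exact: closed_pos].
by apply/seteqP; split=> o /= /andP.
Qed.

Lemma within_continuous_LO (X : topologicalType) (A : set X) (F : X -> LO G) :
  (forall x g, A x -> pos (F x) g -> \forall y \near x, A y -> pos (F y) g) ->
  {within A, continuous F}.
Proof.
move=> H; apply/subspace_continuousP => x Ax U /nbhs_LO[s [sx sU]].
rewrite /= /within; near_simpl.
have : \forall y \near x, A y -> all (pos (F y)) s.
  elim: s sx {sU} => [_|g s IH /= /andP[gx sx]]; first by apply: filterE.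
  move: (H _ _ Ax gx) (IH sx); apply: filterS2 => y h1 h2 Ay.
  by rewrite h1// h2.
by apply: filterS => y h /h /sU.
Qed.

End LeftOrder.

(** * Cantor sets of orderings *)

Definition agree (X : Type) (c : X -> nat -> bool) (N : nat) (x y : X) :=
  forall n, (n < N)%N -> c y n = c x n.

(** The set [A] as a type of its own, in which points are close when many of
    their coordinates [c] agree. The parameters [c] and [a0] occur in the type so
    that its metric and its base point can be inferred from it. *)
Definition coded (R : realType) (X : Type) (c : X -> nat -> bool) (A : set X) (a0 : A) : Type :=
  set_type A.

Section CodedDef.
Variables (R : realType) (X : choiceType) (c : X -> nat -> bool).
Variables (A : set X) (a0 : A).

Local Notation T := (coded R c a0).

(** The ball of radius [r] prescribes the coordinates of index below [r^-1]. *)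
Definition coded_ball (x : T) (r : R) (y : T) : Prop :=
  0 < r /\ forall n, n%:R * r < 1 -> c (val y) n = c (val x) n.

Lemma coded_ball_center x (e : R) : 0 < e -> coded_ball x e x.
Proof. by []. Qed.

Lemma coded_ball_sym x y (e : R) : coded_ball x e y -> coded_ball y e x.
Proof. by move=> [e0 h]; split=> // n /h ->. Qed.

Lemma coded_ball_triangle x y z (e1 e2 : R) :
  coded_ball x e1 y -> coded_ball y e2 z -> coded_ball x (e1 + e2) z.
Proof.
move=> [p1 h1] [p2 h2]; split=> [|n ne]; first exact: addr_gt0.
rewrite h2 ?h1//; apply: le_lt_trans ne; apply: ler_wpM2l => //.
  by rewrite lerDl ltW.
by rewrite lerDr ltW.
Qed.

HB.instance Definition _ := Choice.on T.
HB.instance Definition _ := isPointed.Build T a0.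
HB.instance Definition _ := hasNbhs.Build T (nbhs_ (entourage_ coded_ball)).
HB.instance Definition _ := Nbhs_isPseudoMetric.Build R T
  (erefl (nbhs_ (entourage_ coded_ball)))
  coded_ball_center coded_ball_sym coded_ball_triangle erefl.

Lemma nbhs_coded (x : T) (U : set T) :
  nbhs x U <-> exists N, forall y, agree c N (val x) (val y) -> U y.
Proof.
split=> [/nbhs_ballP[e /= e0 eU]|[N NU]].
  exists (Num.truncn e^-1).+1 => y xy; apply: eU; split=> // n ne.
  apply: xy; rewrite -(@ltr_nat R); apply: lt_trans (truncnS_gt _).
  by rewrite -(ltr_pM2r e0) mulVf// gt_eqF.
apply/nbhs_ballP; exists (N.+1%:R^-1) => /=; first by rewrite invr_gt0 ltr0Sn.
move=> y [_ xy]; apply: NU => n nN; apply: xy.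
by rewrite -(ltr_pM2r (ltr0Sn R N)) mulfVK ?pnatr_eq0// mul1r ltr_nat ltnS ltnW.
Qed.

End CodedDef.

Lemma nbhs_agree_cantor (z : cantor_space) (N : nat) :
  \forall y \near z, forall n, (n < N)%N -> y n = z n.
Proof.
elim: N => [|N IH]; first by apply: filterE => y n; rewrite ltn0.
have : \forall y \near z, y N = z N.
  apply: (@proj_continuous nat (fun=> bool) N z [set b | b = z N]).
  by rewrite nbhs_principalE; exact/principal_filterP.
apply: filterS2 IH => y h e n; rewrite ltnS leq_eqVlt => /orP[/eqP->//|].
exact: h.
Qed.

Section CodedCantor.
Variables (R : realType) (X : choiceType) (c : X -> nat -> bool).
Variables (A : set X) (a0 : A).
Hypotheses (c_inj : forall x y, A x -> A y -> c x = c y -> x = y)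
  (c_perfect : forall x N, A x -> exists y, [/\ A y, y <> x & agree c N x y])
  (c_closed : forall z : nat -> bool,
     (forall N, exists x, A x /\ forall n, (n < N)%N -> c x n = z n) ->
     exists x, A x /\ c x = z).

Local Notation T := (coded R c a0).

Let clopen_coord n b : clopen [set x : T | c (val x) n = b].
Proof.
have op b' : open [set x : T | c (val x) n = b'].
  by rewrite openE => x /= xb; apply/nbhs_coded; exists n.+1 => y h /=; rewrite h.
split=> //; rewrite -openC; rewrite (_ : ~` _ = [set x : T | c (val x) n = ~~ b]) //.
by apply/seteqP; split=> x /=; case: (c _ _) b => -[].
Qed.

Let coded_inj (x y : T) : c (val x) = c (val y) -> x = y.
Proof. by move=> e; apply: val_inj; apply: c_inj e; exact/set_mem/valP. Qed.

Let coded_diff (x y : T) : x != y -> exists n, c (val x) n <> c (val y) n.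
Proof.
move=> /eqP xy; apply/existsNP => h; apply: xy; apply: coded_inj.
exact/funext.
Qed.

Let coded_zero : zero_dimensional T.
Proof.
move=> x y /coded_diff[n nxy]; exists [set z | c (val z) n = c (val x) n].
by split=> [|//|/= e]; [exact: clopen_coord|apply: nxy].
Qed.

Let coded_perfect : perfect_set [set: T].
Proof.
apply/perfectTP => x ox.
have /nbhs_coded[N h] : nbhs x [set x] by apply: open_nbhs_nbhs; split.
have [y [Ay yx xy]] := c_perfect N (set_mem (valP x)).
pose y' : T := exist _ y (mem_set Ay).
by have /= := h y' xy; move/(congr1 val).
Qed.

Let coded_hausdorff : hausdorff_space T.
Proof.
move=> x y xy; apply: contrapT => /eqP /coded_zero[U [cU Ux Uy]].
have [z [zU]] := xy U (~` U) (open_nbhs_nbhs (conj cU.1 Ux))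
  (open_nbhs_nbhs (conj (closed_openC cU.2) Uy)).
by [].
Qed.

Let coded_compact : compact [set: T].
Proof.
pose K := [set z : cantor_space | exists x, A x /\ c x = z].
have cK : closed K.
  move=> z Kz; apply: c_closed => N.
  have [y [[x [Ax xy]] yz]] := Kz _ (nbhs_agree_cantor z N).
  by exists x; split=> // n /yz <-; rewrite xy.
have compK : compact K.
  by apply: (subclosed_compact cK cantor_space_compact).
pose f (z : cantor_space) : T := xget a0 [set x : T | c (val x) = z].
have fK z : K z -> c (val (f z)) = z.
  move=> [x [Ax xz]].
  by rewrite /f; case: xgetP => // /(_ (exist _ x (mem_set Ax))) /= /(_ xz).
rewrite (_ : setT = f @` K); last first.
  apply/seteqP; split=> // x _; exists (c (val x)).
    by exists (val x); split=> //; exact/set_mem/valP.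
  apply: coded_inj; apply: fK; exists (val x); split=> //; exact/set_mem/valP.
apply: continuous_compact compK; apply/subspace_continuousP => z Kz U.
move=> /nbhs_coded[N NU]; rewrite /= /within; near_simpl.
move: (nbhs_agree_cantor z N); apply: filterS => y yz Ky; apply: NU => n nN.
by rewrite !fK// yz.
Qed.

Lemma coded_cantor_like : cantor_like T.
Proof.
split; [exact: coded_perfect|exact: coded_compact|exact: coded_hausdorff|].
exact: coded_zero.
Qed.

End CodedCantor.

(** The coordinates embed [A] into the Cantor space with a closed image, and a
    compact, zero-dimensional, perfect metric space is a Cantor set. *)
Lemma is_cantor_coords (R : realType) (X : topologicalType)
    (c : X -> nat -> bool) (A : set X) :
  A !=set0 ->
  (forall x y, A x -> A y -> c x = c y -> x = y) ->
  (forall x N, A x -> exists y, [/\ A y, y <> x & agree c N x y]) ->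
  (forall z : nat -> bool,
     (forall N, exists x, A x /\ forall n, (n < N)%N -> c x n = z n) ->
     exists x, A x /\ c x = z) ->
  (forall x U, A x -> nbhs x U ->
     exists N, forall y, A y -> agree c N x y -> U y) ->
  (forall x N, A x -> \forall y \near x, agree c N x y) ->
  is_cantor A.
Proof.
move=> [x0 Ax0] cinj cperf cclosed nbA nbc.
pose a0 : A := exist _ x0 (mem_set Ax0).
have [F [Fcont Fclosed]] :=
  homeomorphism_cantor_like (coded_cantor_like R a0 cinj cperf cclosed).
have := @bij _ _ _ _ F; rewrite setTT_bijective => -[Fi FK FiK].
have Ficont : continuous (Fi : coded R c a0 -> cantor_space).
  apply/continuous_closedP => B /Fclosed; congr closed.
  apply/seteqP; split=> [_ [b Bb <-]|x /= Bx]; first by rewrite /= FK.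
  by exists (Fi x); rewrite ?FiK.
have AF z : A (val (F z)) by exact/set_mem/valP.
pose toA (x : X) : coded R c a0 := insubd a0 x.
have toAK x : A x -> val (toA x) = x by move=> Ax; rewrite /toA insubdK//; exact/mem_set.
have toAv (y : coded R c a0) : toA (val y) = y.
  by apply: val_inj; rewrite toAK//; exact/set_mem/valP.
exists (Fi \o toA); exists (fun z => val (F z)); split.
- by move=> x Ax; rewrite /= FiK toAK.
- by move=> z _; split; [exact: AF|rewrite /= toAv FK].
- apply/subspace_continuousP => x Ax U.
  move=> /(Ficont (toA x)); rewrite /= => /nbhs_coded[N NU].
  rewrite /= /within; near_simpl; move: (nbc x N Ax); apply: filterS.
  by move=> y xy Ay; apply: NU; rewrite !toAK.
- apply/subspace_continuousP => z _ U zU.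
  have [N NU] := nbA _ _ (AF z) zU.
  rewrite /= /within; near_simpl.
  have : \forall t \near (F z : coded R c a0), agree c N (val (F z)) (val t).
    by apply/nbhs_coded; exists N.
  move/(Fcont z); rewrite /=; near_simpl; apply: filterS => t h _.
  by apply: NU h; exact: AF.
Qed.

Lemma nbhs_agree_LO (G : groupType) (e : nat -> G) (o : LO G) N :
  \forall o' \near o, agree (fun o n => pos o (e n)) N o o'.
Proof.
elim: N => [|N IH]; first by apply: filterE => o' n; rewrite ltn0.
have : \forall o' \near o, pos o' (e N) = pos o (e N).
  case E: (pos o (e N)); first exact: nbhs_pos.
  apply: (@filterS _ _ _ [set o' | ~~ pos o' (e N)]).
    by move=> o' /= /negbTE.
  by apply: open_nbhs_nbhs; split; [exact: open_posN|rewrite /= E].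
apply: filterS2 IH => o' h eN n; rewrite ltnS leq_eqVlt => /orP[/eqP->//|].
exact: h.
Qed.

(** The coordinates are the signs of the elements of an enumeration of [G]. To be
    a positive cone is a condition on finitely many signs at a time, so that a
    limit of sign sequences of orderings is again one: this is compactness. *)
Lemma is_cantor_LO (R : realType) (G : groupType) (e : nat -> G)
    (A : set (LO G)) :
  (forall g, exists n, e n = g) -> A !=set0 -> closed A ->
  (forall o U, A o -> nbhs o U -> exists o', [/\ A o', o' <> o & U o']) ->
  is_cantor A.
Proof.
move=> e_surj A0 clA Aperf; pose c (o : LO G) n := pos o (e n).
have [idx idxK] := choice e_surj.
apply: (@is_cantor_coords R _ c) => //.
- move=> o o' _ _ h; apply: LO_sub_eq => g.
  by rewrite -(idxK g) -[pos o _]/(c o (idx g)) h.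
- move=> o N Ao; have [q [? ? ?]] := Aperf o _ Ao (nbhs_agree_LO e o N).
  by exists q.
- move=> z zA.
  have z_ok (s : seq nat) : exists o, A o /\ {in s, forall n, c o n = z n}.
    have [q [Aq oz]] := zA (\max_(n <- s) n).+1.
    exists q; split=> // n ns; apply: oz; rewrite ltnS.
    by rewrite (big_rem n)//= leq_maxl.
  pose P g := z (idx g) : Prop.
  have P1 : ~ P 1%g.
    have [q [_ h]] := z_ok [:: idx 1%g].
    by rewrite /P -h ?inE// /c idxK pos1.
  have PM f g : P f -> P g -> P (f * g)%g.
    have [q [_ h]] := z_ok [:: idx f; idx g; idx (f * g)%g].
    rewrite /P -!h ?inE ?eqxx ?orbT// /c !idxK; exact: posM.
  have PV g : g <> 1%g -> P g \/ P g^-1%g.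
    move=> /eqP g1; have [q [_ h]] := z_ok [:: idx g; idx g^-1%g].
    rewrite /P -!h ?inE ?eqxx ?orbT// /c !idxK posV//.
    by case: (pos q g); [left|right].
  have posz g : pos (coneLO P1 PM PV) g = z (idx g).
    apply/idP/idP => [/(pos_cone P1 PM PV)//|zg]; exact/(pos_cone P1 PM PV).
  exists (coneLO P1 PM PV); split.
    apply: clA => U /nbhs_LO[s [sz sU]].
    have [q [Aq h]] := z_ok (map idx s).
    exists q; split=> //; apply: sU; apply/allP => g gs.
    have := allP sz _ gs; rewrite posz -h ?map_f// /c idxK.
    by [].
  apply/funext => n; rewrite /c posz.
  have [q [_ h]] := z_ok [:: n; idx (e n)].
  by rewrite -!h ?inE ?eqxx ?orbT// /c idxK.
- move=> o U _ /nbhs_LO[s [so sU]].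
  exists (\max_(g <- s) idx g).+1 => o' _ oo'; apply: sU; apply/allP => g gs.
  have := oo' (idx g); rewrite ltnS (big_rem g)//= leq_maxl => /(_ isT).
  by rewrite /c idxK => ->; exact: (allP so).
- by move=> o N _; exact: nbhs_agree_LO.
Qed.

(** * Pseudo-orderings defined by a real-valued function *)

Lemma group_closedP (G : groupType) (K : set G) :
  group_closed [in K] <->
  K 1%g /\ forall x y, K x -> K y -> K (x / y)%g.
Proof.
split=> [[]|[h1 h2]].
  rewrite inE => K1 h; split=> // x y Kx Ky.
  by have := h x y; rewrite !inE => /(_ Kx Ky).
by split=> [|x y]; rewrite !inE//; exact: h2.
Qed.

Section RealPseudoOrder.
Variables (R : realType) (G : groupType) (p : G -> R).
Hypothesis pM : forall h f g, p f < p g -> p (h * f)%g < p (h * g)%g.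

Let K := [set g | p g = p 1%g].

Lemma pseudo_mul2l h f g : (p (h * f)%g < p (h * g)%g) = (p f < p g).
Proof.
apply/idP/idP; last exact: pM.
by move=> /(pM h^-1%g); rewrite !mulKg.
Qed.

Lemma pseudo_mul2l_eq h f g : (p (h * f)%g == p (h * g)%g) = (p f == p g).
Proof. by rewrite !eq_le !leNgt !pseudo_mul2l. Qed.

(** As for the orbit map [p] of a point under an action on the line: the values
    of [p] correspond to the left cosets of the stabilizer [K]. *)
Lemma pseudo_stab_coset f g : K (f^-1 * g)%g <-> p f = p g.
Proof.
rewrite /K /= -[in p 1%g](mulVg f); split=> [/eqP|fg].
  by rewrite pseudo_mul2l_eq => /eqP.
by apply/eqP; rewrite pseudo_mul2l_eq fg.
Qed.

Lemma pseudo_stab_group : group_closed [in K].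
Proof.
apply/group_closedP; split=> // x y Kx Ky; rewrite -[x]invgK.
apply/pseudo_stab_coset; have /pseudo_stab_coset : K (x^-1^-1 * 1)%g.
  by rewrite invgK mulg1.
move=> ->; rewrite -(mulVg y) -[RHS]/(p y^-1%g) -[in RHS](mulg1 y^-1%g).
by apply/eqP; rewrite pseudo_mul2l_eq Ky.
Qed.

Lemma lcoset_pseudoP f x : lcoset K f x <-> p x = p f.
Proof.
split=> [[k Kk <-]|xf].
  by rewrite -[in RHS](mulg1 f); apply/eqP; rewrite pseudo_mul2l_eq Kk.
exists (f^-1 * x)%g; last by rewrite mulVKg.
exact/pseudo_stab_coset.
Qed.

Lemma lcoset_pseudo_eq f g : lcoset K f = lcoset K g <-> p f = p g.
Proof.
split=> [e|e].
  by apply/lcoset_pseudoP; rewrite -e; exact/lcoset_pseudoP.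
by apply/seteqP; split=> x /lcoset_pseudoP xf; apply/lcoset_pseudoP; rewrite xf.
Qed.

Lemma pseudo_ordering_real : pseudo_ordering (fun f g => p f < p g) K.
Proof.
split; first exact: pseudo_stab_group.
exists (fun X Y => exists f g, [/\ X = lcoset K f, Y = lcoset K g & p f <= p g]).
have leE f g : (exists f' g', [/\ lcoset K f = lcoset K f',
    lcoset K g = lcoset K g' & p f' <= p g']) <-> p f <= p g.
  split; last by exists f, g.
  by move=> [f' [g' [/lcoset_pseudo_eq-> /lcoset_pseudo_eq->]]].
split.
- by move=> f; apply/leE.
- move=> f g /leE fg /leE gf; apply/lcoset_pseudo_eq/eqP.
  by rewrite eq_le fg.
- by move=> f g h /leE fg /leE gh; apply/leE; exact: le_trans gh.
- by move=> f g; have /orP[|] := le_total (p f) (p g) => h; [left|right]; apply/leE.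
split.
- by move=> f g h /leE; rewrite leNgt -(pseudo_mul2l h) -leNgt => ?; apply/leE.
- move=> f g; split=> [fg|[/leE]].
    split; first by apply/leE/ltW.
    by move=> /lcoset_pseudo_eq e; rewrite e ltxx in fg.
  rewrite le_eqVlt => /orP[/eqP fg|//] /lcoset_pseudo_eq; by case.
Qed.

Lemma pseudo_convex_stab : pseudo_convex (fun f g => p f < p g) K K.
Proof.
split; [exact: pseudo_stab_group|by []|].
move=> h1 h2 g; rewrite /K /= => h1K h2K [<-//|h1g] [->//|gh2].
by have := lt_trans h1g gh2; rewrite h1K h2K ltxx.
Qed.

Section Tie.
Variable q : G -> R.
Hypotheses (qM : forall h k, K h -> K k -> q (h * k)%g = q h + q k)
  (q0 : forall h, K h -> q h = 0 -> h = 1%g).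

Let P g := p 1%g < p g \/ (K g /\ 0 < q g).

Let K1 : K 1%g. Proof. by []. Qed.

Let q1 : q 1%g = 0.
Proof. by have /eqP := qM K1 K1; rewrite mulg1 -subr_eq0 opprD addrA subrr sub0r oppr_eq0 => /eqP. Qed.

Let tie_P1 : ~ P 1%g.
Proof. by rewrite /P ltxx q1 ltxx => -[//|[]]. Qed.

Let tie_PM f g : P f -> P g -> P (f * g)%g.
Proof.
rewrite /P => -[f1|[Kf qf]] [g1|[Kg qg]].
- by left; apply: lt_trans f1 _; have := pM f g1; rewrite mulg1.
- left; suff -> : p (f * g)%g = p f by [].
  by rewrite -[in RHS](mulg1 f); apply/eqP; rewrite pseudo_mul2l_eq Kg.
- by left; have := pM f g1; rewrite mulg1 Kf.
- right; split; last by rewrite qM// addr_gt0.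
  rewrite /K /= -Kf -[in RHS](mulg1 f).
  by apply/eqP; rewrite pseudo_mul2l_eq Kg.
Qed.

Let KV g : K g -> K g^-1%g.
Proof.
have [_ h] := (group_closedP K).1 pseudo_stab_group.
by move=> /(h _ _ K1); rewrite mul1g.
Qed.

Let tie_PV g : g <> 1%g -> P g \/ P g^-1%g.
Proof.
move=> g1; case: (ltgtP (p 1%g) (p g)) => [?|pg|/esym Kg]; first by left; left.
  by right; left; rewrite -(pseudo_mul2l g) mulgV mulg1.
have := lt_total; case: (ltgtP 0 (q g)) => [qg _|qg _|/esym /(q0 Kg)//].
  by left; right.
right; right; split; first exact: KV.
have /eqP := qM Kg (KV Kg); rewrite mulgV q1 eq_sym addrC addr_eq0 => /eqP ->.
by rewrite oppr_gt0.
Qed.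

(** The ordering obtained by breaking the ties of the pseudo-ordering, that is,
    by ordering [K], with the homomorphism [q]. *)
Definition tieLO : LO G := coneLO tie_P1 tie_PM tie_PV.

Lemma pos_tieLO g : pos tieLO g <-> p 1%g < p g \/ (K g /\ 0 < q g).
Proof. exact: pos_cone. Qed.

Lemma extends_tieLO : extends tieLO (fun f g => p f < p g).
Proof.
by move=> f g fg; rewrite lo_ltE; apply/pos_tieLO; left; rewrite -(pseudo_mul2l f) mulVKg mulg1.
Qed.

End Tie.

Lemma is_ordering_real :
  is_ordering (fun f g => p f < p g) <-> K = [set 1%g].
Proof.
split=> [[le leE]|K1].
  apply/seteqP; split=> [g Kg|g ->//]; apply/eqP; apply: contraT => g1.
  have : pos le g || pos le g^-1%g by rewrite posV// orbN.
  rewrite -[X in _ || X](_ : lo_lt le g 1%g = _); last by rewrite lo_ltE mulg1.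
  by rewrite /pos => /orP[] /leE; rewrite Kg ltxx.
have qM h k : K h -> K k -> (0 : R) = 0 + 0 by rewrite addr0.
have q0 h : K h -> (0 : R) = 0 -> h = 1%g by rewrite K1 => ->.
exists (tieLO qM q0) => f g; split; first exact: extends_tieLO.
rewrite lo_ltE => /pos_tieLO [|[_]]; last by rewrite ltxx.
by rewrite -(pseudo_mul2l f) mulVKg mulg1.
Qed.

Lemma extends_pos o g : extends o (fun f g => p f < p g) ->
  p 1%g < p g -> pos o g.
Proof. by move=> h /h. Qed.

Lemma extends_neg o g : extends o (fun f g => p f < p g) ->
  p g < p 1%g -> pos o g = false.
Proof.
move=> h /h; rewrite lo_ltE mulg1 => /pos_asym; by rewrite invgK.
Qed.

Lemma extends_unique o o' : extends o (fun f g => p f < p g) ->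
  extends o' (fun f g => p f < p g) ->
  (forall g, K g -> pos o g -> pos o' g) -> o = o'.
Proof.
move=> e e' h; apply: LO_sub_eq => g.
case: (ltgtP (p 1%g) (p g)) => [pg|pg|/esym Kg]; last exact: h.
  by move=> _; exact: extends_pos pg.
by rewrite (extends_neg e pg).
Qed.

Lemma extends_cyclic_unique o o' g : extends o (fun f g => p f < p g) ->
  extends o' (fun f g => p f < p g) -> K = cyclic_subgroup g ->
  pos o g = pos o' g -> o = o'.
Proof.
move=> e e' Kg og; apply: extends_unique => // h; rewrite Kg => -[n].
have [->|g1] := eqVneq g 1%g; first by rewrite !expg1n invg1 => -[]->; rewrite pos1.
case: n => [|n]; first by rewrite expg0 invg1 => -[]->; rewrite pos1.
by case=> ->; rewrite -?expVgn !posXE ?posV ?og.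
Qed.

(** Only the order on the cyclic group [K] remains to be chosen. The injective
    homomorphism [q] and its opposite give both choices for the sign of [g]. *)
Lemma exists_unique_extension (q : G -> R) g b :
  (forall h k, K h -> K k -> q (h * k)%g = q h + q k) ->
  (forall h, K h -> q h = 0 -> h = 1%g) ->
  K = cyclic_subgroup g -> g <> 1%g ->
  exists! o, extends o (fun f g => p f < p g) /\ lo_lt o 1%g g = b.
Proof.
move=> qM q0 KE g1.
have Kg : K g by rewrite KE; exists 1%N; left; rewrite expg1.
pose s : R := if (0 < q g) == b then 1 else -1; pose q' h := s * q h.
have qM' h k : K h -> K k -> q' (h * k)%g = q' h + q' k.
  by move=> Kh Kk; rewrite /q' qM// mulrDr.
have q0' h : K h -> q' h = 0 -> h = 1%g.
  move=> Kh qh; apply: q0 => //; move: qh; rewrite /q' /s.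
  by case: ifP => _; rewrite ?mulN1r ?mul1r// => /eqP; rewrite oppr_eq0 => /eqP.
have posg : pos (tieLO qM' q0') g = b.
  have qg : q g != 0 by apply/eqP => /(q0 _ Kg).
  have -> : pos (tieLO qM' q0') g = (0 < q' g).
    apply/idP/idP => [/pos_tieLO[|[]//]|]; first by rewrite Kg ltxx.
    by move=> h; apply/pos_tieLO; right.
  rewrite /q' /s; have [qp|qn] := ltP 0 (q g); case: (b) => /=.
  - by rewrite mul1r.
  - by rewrite mulN1r oppr_gt0 ltNge ltW.
  - by rewrite mulN1r oppr_gt0 lt_neqAle qg.
  - by rewrite mul1r ltNge qn.
exists (tieLO qM' q0'); split; first by split=> //; exact: extends_tieLO.
move=> o [e og]; apply: (extends_cyclic_unique _ e KE); first exact: extends_tieLO.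
by rewrite posg -og.
Qed.

End RealPseudoOrder.

(** An element with the least positive value of [c] generates [K]. *)
Lemma cyclic_of_int (G : groupType) (K : set G) (c : G -> int) :
  group_closed [in K] ->
  (forall h k, K h -> K k -> c (h * k)%g = c h + c k) ->
  (forall h, K h -> c h = 0 -> h = 1%g) ->
  exists g, K = cyclic_subgroup g.
Proof.
move=> /group_closedP[K1 KD] cM c0.
have KV h : K h -> K h^-1%g by move=> /(KD _ _ K1); rewrite mul1g.
have KM h k : K h -> K k -> K (h * k)%g by move=> Kh /KV /(KD _ _ Kh); rewrite invgK.
have c1 : c 1%g = 0 by have := cM _ _ K1 K1; rewrite mulg1; lia.
have cV h : K h -> c h^-1%g = - c h.
  by move=> Kh; have := cM _ _ Kh (KV _ Kh); rewrite mulgV c1; lia.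
have KX h n : K h -> K (h ^+ n)%g.
  by move=> Kh; elim: n => [//|n IH]; rewrite expgS; exact: KM.
have cX h n : K h -> c (h ^+ n)%g = c h * n%:Z.
  move=> Kh; elim: n => [|n IH]; first by rewrite c1 mulr0.
  by rewrite expgS cM ?IH//; [lia|exact: KX].
have [all0|/existsNP[h /not_implyP[Kh ch]]] := pselect (forall h, K h -> c h = 0).
  exists 1%g; apply/seteqP; split=> [h Kh|h [n]]; last first.
    by rewrite expg1n invg1 => -[]->.
  by exists 0%N; left; rewrite expg0; exact: c0 Kh (all0 _ Kh).
have ex : exists n, `[< exists h, K h /\ c h = n.+1%:Z >].
  have [cp|cn] := ltP 0 (c h).
    by exists `|c h|.-1; apply/asboolP; exists h; split=> //; lia.
  exists `|c h|.-1; apply/asboolP; exists h^-1%g; split; first exact: KV.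
  by rewrite cV//; lia.
case: (ex_minnP ex) => m /asboolP[g [Kg cg]] mmin.
exists g; apply/seteqP; split=> [k Kk|k [n [->|->]]]; last 2 first.
- exact: KX.
- exact/KV/KX.
(* The remainder of a value of [c] is again a value, smaller than the least
   positive one, and hence zero. *)
have kill r (z : G) : K z -> K r -> c (r * z)%g = (c r %% m.+1%:Z)%Z -> r = z^-1%g.
  move=> Kz Kr cr; rewrite -[z^-1%g]mul1g; apply: (mulIg z); rewrite mulgVK.
  apply: c0; first exact: KM.
  have : (0 <= c (r * z)%g < m.+1)%R by rewrite cr modz_ge0// ltz_pmod.
  case E : (c (r * z)%g) => [[|i]|i] // im.
  have := mmin i; have -> : `[< exists h, K h /\ c h = i.+1%:Z >].
    by apply/asboolP; exists (r * z)%g; split; [exact: KM|].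
  by move=> /(_ isT); lia.
have dv := divz_eq (c k) m.+1%:Z.
exists `|(c k %/ m.+1%:Z)%Z|%N.
have [dp|dn] := leP 0 (c k %/ m.+1%:Z)%Z.
  left; rewrite -[RHS]invgK; apply: kill => //; first exact/KV/KX.
  rewrite cM ?cV ?cX// ?cg; [lia|exact: KX|exact/KV/KX].
right; apply: kill => //; first exact: KX.
by rewrite cM ?cX// ?cg; [lia|exact: KX].
Qed.

(** * Half-planes and lattice points *)

Lemma ord2P (i : 'I_2) : i = 0 \/ i = 1.
Proof.
by case: i => -[|[|//]] h; [left|right]; apply/val_inj.
Qed.

Definition col2 (K : Type) (a b : K) : 'cV[K]_2 :=
  \col_i (if i == 0 then a else b).

Lemma col2_0 (K : Type) (a b : K) : col2 a b 0 0 = a.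
Proof. by rewrite mxE. Qed.

Lemma col2_1 (K : Type) (a b : K) : col2 a b 1 0 = b.
Proof. by rewrite mxE. Qed.

Lemma col2_eq (K : Type) (u v : 'cV[K]_2) :
  u 0 0 = v 0 0 -> u 1 0 = v 1 0 -> u = v.
Proof.
by move=> h0 h1; apply/matrixP => i j; rewrite (ord1 j); case: (ord2P i) => ->.
Qed.

Section HalfPlane.
Variable R : realType.
Implicit Types (d : 'cV[R]_2) (v w : Z2).

Definition zx v : R := ((v : 'cV[int]_2) 0 0)%:~R.
Definition zy v : R := ((v : 'cV[int]_2) 1 0)%:~R.

(** The form that vanishes on the line directed by [d] and is positive on its
    right. *)
Definition hp d v : R := d 1 0 * zx v - d 0 0 * zy v.
Definition dot d v : R := d 0 0 * zx v + d 1 0 * zy v.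

Lemma hpE d v : hp d v = - det2 d (toR2 R v).
Proof. by rewrite /hp /det2 /toR2 !mxE opprB. Qed.

Lemma zxM v w : zx (v * w)%g = zx v + zx w.
Proof. by rewrite /zx -intrD; congr _%:~R; rewrite -[(v * w)%g]/((v : 'cV[int]_2) + w) mxE. Qed.
Lemma zyM v w : zy (v * w)%g = zy v + zy w.
Proof. by rewrite /zy -intrD; congr _%:~R; rewrite -[(v * w)%g]/((v : 'cV[int]_2) + w) mxE. Qed.
Lemma zx1 : zx 1%g = 0.
Proof. by rewrite /zx -[1%g]/(0 : 'cV[int]_2) mxE. Qed.
Lemma zy1 : zy 1%g = 0.
Proof. by rewrite /zy -[1%g]/(0 : 'cV[int]_2) mxE. Qed.
Lemma zxV v : zx v^-1%g = - zx v.
Proof. by apply/eqP; rewrite -addr_eq0 -zxM mulVg zx1. Qed.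
Lemma zyV v : zy v^-1%g = - zy v.
Proof. by apply/eqP; rewrite -addr_eq0 -zyM mulVg zy1. Qed.

Lemma Z2_eq v w : zx v = zx w -> zy v = zy w -> v = w.
Proof. by move=> /intr_inj h0 /intr_inj h1; exact: col2_eq. Qed.

Lemma hpM d v w : hp d (v * w)%g = hp d v + hp d w.
Proof. rewrite /hp zxM zyM; lra. Qed.
Lemma hp1 d : hp d 1%g = 0.
Proof. by rewrite /hp zx1 zy1 !mulr0 subrr. Qed.
Lemma hpV d v : hp d v^-1%g = - hp d v.
Proof. rewrite /hp zxV zyV; lra. Qed.
Lemma hpX d v n : hp d (v ^+ n)%g = n%:R * hp d v.
Proof.
elim: n => [|n IH]; first by rewrite hp1 mul0r.
by rewrite expgS hpM IH -natr1 mulrDl mul1r addrC.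
Qed.
Lemma dotM d v w : dot d (v * w)%g = dot d v + dot d w.
Proof. rewrite /dot zxM zyM; lra. Qed.
Lemma hpZ c d v : hp (c *: d) v = c * hp d v.
Proof. rewrite /hp !mxE; lra. Qed.
Lemma hpN d v : hp (- d) v = - hp d v.
Proof. rewrite /hp !mxE; lra. Qed.

Lemma line_ltE d v w : line_lt d v w <-> hp d v < hp d w.
Proof.
by rewrite -subr_gt0 -hpV addrC -hpM hpE oppr_gt0.
Qed.

Lemma line_lt1E d v : line_lt d 1%g v <-> 0 < hp d v.
Proof. by rewrite line_ltE hp1. Qed.

Lemma line_lt_fun d : line_lt d = (fun v w => hp d v < hp d w).
Proof. by apply/funext => v; apply/funext => w; apply/propext; exact: line_ltE. Qed.

Lemma line_ptsE d : line_pts d = [set v | hp d v = hp d 1%g].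
Proof.
apply/seteqP; split=> v; rewrite /line_pts /= hp1 hpE.
  by move=> ->; rewrite oppr0.
by move/eqP; rewrite oppr_eq0 => /eqP.
Qed.

Lemma hp_lt_mul2l d h f g : hp d f < hp d g -> hp d (h * f)%g < hp d (h * g)%g.
Proof. by rewrite !hpM ltrD2l. Qed.

Lemma col2Z_zx a b : zx (col2 a b : 'cV[int]_2) = a%:~R.
Proof. by rewrite /zx col2_0. Qed.
Lemma col2Z_zy a b : zy (col2 a b : 'cV[int]_2) = b%:~R.
Proof. by rewrite /zy col2_1. Qed.

Lemma mul_floor_le (c x : R) : `|c * (Num.floor x)%:~R - c * x| <= `|c|.
Proof.
rewrite -mulrBr normrM ler_piMr// distrC.
have /andP[h1 h2] := floor_itv x.
by rewrite ger0_norm ?subr_ge0// lerBlDl -intrD1 ltW.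
Qed.

(** Near a large multiple of the real point where the two forms have the values
    [1] and [-1] there is a lattice point where they keep these signs. *)
Lemma separating_vector d d' : det2 d d' != 0 ->
  exists v, 0 < hp d v /\ hp d' v < 0.
Proof.
set D := det2 d d' => D0.
pose a := (- d' 0 0 - d 0 0) / D; pose b := (- d 1 0 - d' 1 0) / D.
have e1 : d 1 0 * a - d 0 0 * b = 1.
  rewrite /a /b !mulrA -mulrBl; apply: (mulIf D0); rewrite mulfVK// /D /det2; lra.
have e2 : d' 1 0 * a - d' 0 0 * b = -1.
  rewrite /a /b !mulrA -mulrBl; apply: (mulIf D0); rewrite mulfVK// /D /det2; lra.
have [N EN] : exists N : R, N = `|d 0 0| + `|d 1 0| + `|d' 0 0| + `|d' 1 0| + 1 by eexists.
exists (col2 (Num.floor (N * a)) (Num.floor (N * b)) : 'cV[int]_2).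
rewrite /hp col2Z_zx col2Z_zy.
move: (mul_floor_le (d 1 0) (N * a)) (mul_floor_le (d 0 0) (N * b)).
move: (mul_floor_le (d' 1 0) (N * a)) (mul_floor_le (d' 0 0) (N * b)).
have E1 : d 1 0 * (N * a) - d 0 0 * (N * b) = N by rewrite !(mulrCA _ N) -mulrBr e1 mulr1.
have E2 : d' 1 0 * (N * a) - d' 0 0 * (N * b) = - N by rewrite !(mulrCA _ N) -mulrBr e2 mulrN1.
move: E1 E2; rewrite !ler_norml.
have := normr_ge0 (d 0 0); have := normr_ge0 (d 1 0).
have := normr_ge0 (d' 0 0); have := normr_ge0 (d' 1 0).
move=> ? ? ? ? ? ? /andP[? ?] /andP[? ?] /andP[? ?] /andP[? ?].
split; lra.
Qed.

Lemma unit_neq0 d : unit_dir d -> d != 0.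
Proof.
move=> u; apply/eqP => d0; move: u; rewrite /unit_dir d0 !mxE expr0n addr0.
by move/eqP; rewrite eq_sym oner_eq0.
Qed.

Lemma neq0_sqr_gt0 d : d != 0 -> 0 < d 0 0 ^+ 2 + d 1 0 ^+ 2.
Proof.
move=> d0; rewrite lt_neqAle addr_ge0 ?sqr_ge0// andbT eq_sym.
apply: contraNneq d0 => /eqP; rewrite paddr_eq0 ?sqr_ge0// !sqrf_eq0.
by move=> /andP[/eqP h0 /eqP h1]; apply/eqP/col2_eq; rewrite mxE.
Qed.

Lemma normalize_dir d : d != 0 -> exists c, 0 < c /\ unit_dir (c *: d).
Proof.
move=> d0N; have s := neq0_sqr_gt0 d0N; set D := _ + _ in s.
have c0 : 0 < (Num.sqrt D)^-1 by rewrite invr_gt0 sqrtr_gt0.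
exists (Num.sqrt D)^-1; split=> //; rewrite /unit_dir !mxE !exprMn -mulrDr -/D.
by rewrite exprVn sqr_sqrtr ?ltW// mulVf// gt_eqF.
Qed.

(** Two directions that are not parallel are separated by a lattice point, and
    opposite directions have opposite right sides. *)
Lemma parallel_of_halfplane d d' : d != 0 -> d' != 0 ->
  (forall v, 0 < hp d v -> 0 <= hp d' v) -> exists c, 0 < c /\ d' = c *: d.
Proof.
move=> d0 d'0 h.
have D0 : det2 d d' = 0.
  apply/eqP; apply: contraT => /separating_vector[v [/h]].
  by rewrite leNgt => /negbTE ->.
have s := neq0_sqr_gt0 d0; set S := _ + _ in s.
pose c := (d 0 0 * d' 0 0 + d 1 0 * d' 1 0) / S.
have cd : d' = c *: d.
  apply: col2_eq; rewrite mxE; apply: (@mulfI _ S); rewrite ?gt_eqF//;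
    rewrite mulrA (mulrC S c) /c mulfVK ?gt_eqF//; move: D0; rewrite /S /det2 => D0.
    have /= := congr1 (fun z => d 1 0 * z) D0; rewrite mulr0; lra.
  have /= := congr1 (fun z => d 0 0 * z) D0; rewrite mulr0; lra.
exists c; split=> //.
have c0 : c != 0 by apply: contraNneq d'0 => c0; rewrite cd c0 scale0r.
rewrite lt_neqAle eq_sym c0 /= leNgt; apply/negP => cn.
have [v [v1 v2]] : exists v, 0 < hp d v /\ hp (col2 (- d 1 0) (d 0 0)) v < 0.
  apply: separating_vector; rewrite /det2 col2_0 col2_1.
  by rewrite gt_eqF//; move: s; rewrite /S; lra.
by have := h v v1; rewrite cd hpZ leNgt nmulr_rlt0// v1.
Qed.

Lemma dot_hp d v : dot d v ^+ 2 + hp d v ^+ 2 =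
  (d 0 0 ^+ 2 + d 1 0 ^+ 2) * (zx v ^+ 2 + zy v ^+ 2).
Proof. rewrite /dot /hp; lra. Qed.

Lemma dot_hp_eq0 d v : unit_dir d -> hp d v = 0 -> dot d v = 0 -> v = 1%g.
Proof.
move=> u h1 h2; have := dot_hp d v; rewrite h1 h2 u expr0n addr0 mul1r => /esym/eqP.
rewrite paddr_eq0 ?sqr_ge0// !sqrf_eq0 => /andP[/eqP h3 /eqP h4].
by apply: Z2_eq; rewrite ?zx1 ?zy1.
Qed.

Section DirLO.
Variables (d : 'cV[R]_2) (ud : unit_dir d) (b : bool).

Let sg : R := if b then 1 else -1.

Let qM v w : hp d v = hp d 1%g -> hp d w = hp d 1%g ->
  sg * dot d (v * w)%g = sg * dot d v + sg * dot d w.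
Proof. by move=> _ _; rewrite dotM mulrDr. Qed.

Let q0 v : hp d v = hp d 1%g -> sg * dot d v = 0 -> v = 1%g.
Proof.
rewrite hp1 => hv /eqP; rewrite mulf_eq0 => /orP[|/eqP]; last exact: dot_hp_eq0.
by rewrite /sg; case: (b); rewrite ?oppr_eq0 oner_eq0.
Qed.

(** The lattice points of the line itself are ordered along [d] if [b] holds, and
    backwards otherwise. *)
Definition dirLO : LO Z2 := tieLO (@hp_lt_mul2l d) qM q0.

Lemma pos_dirLO v : pos dirLO v <->
  0 < hp d v \/ (hp d v = 0 /\ 0 < (if b then 1 else -1) * dot d v).
Proof. by have := pos_tieLO (@hp_lt_mul2l d) qM q0 v; rewrite /= hp1. Qed.

Lemma extends_dirLO : extends dirLO (line_lt d).
Proof. by move=> v w /line_ltE; exact: extends_tieLO. Qed.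

End DirLO.

Lemma pos_dirLOV d (ud : unit_dir d) b v : hp d v = 0 -> v != 1%g ->
  pos (dirLO ud b) v = ((0 < dot d v) == b).
Proof.
move=> hv v1; have dv : dot d v != 0 by apply: contra v1 => /eqP /(dot_hp_eq0 ud hv) ->.
have -> : pos (dirLO ud b) v = (0 < (if b then 1 else -1) * dot d v).
  apply/idP/idP => [/pos_dirLO[|[]//]|h]; first by rewrite hv ltxx.
  by apply/pos_dirLO; right.
case: b; rewrite ?mul1r ?eqb_id// mulN1r oppr_gt0 eqbF_neg -leNgt le_eqVlt.
by rewrite (negbTE dv).
Qed.

Lemma rational_slopeP d : unit_dir d ->
  rational_slope d <-> exists v, v != 1%g /\ hp d v = 0.
Proof.
move=> ud; split=> [[d0|[q _ qE]]|[v [v1 hv]]].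
- exists (col2 0 1 : 'cV[int]_2); rewrite /hp col2Z_zx col2Z_zy d0 mulr0 mul0r subrr.
  by split=> //; apply/eqP => /(congr1 zy); rewrite col2Z_zy zy1 => /eqP; rewrite oner_eq0.
- have [d0|d0] := eqVneq (d 0 0) 0.
    exists (col2 0 1 : 'cV[int]_2); rewrite /hp col2Z_zx col2Z_zy d0 mulr0 mul0r subrr.
    by split=> //; apply/eqP => /(congr1 zy); rewrite col2Z_zy zy1 => /eqP; rewrite oner_eq0.
  exists (col2 (denq q) (numq q) : 'cV[int]_2); split.
    apply/eqP => /(congr1 zx); rewrite col2Z_zx zx1 => /eqP.
    by rewrite intr_eq0 denq_eq0.
  rewrite /hp col2Z_zx col2Z_zy; apply/eqP; rewrite subr_eq0; apply/eqP.
  have -> : d 1 0 = d 0 0 * ratr q by rewrite qE mulrC mulfVK.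
  by rewrite -mulrA /ratr mulfVK// intr_eq0 denq_eq0.
- have [d0|d0] := eqVneq (d 0 0) 0; first by left.
  right; have vx : zx v != 0.
    apply: contra v1 => /eqP vx; move: hv; rewrite /hp vx mulr0 sub0r => /eqP.
    rewrite oppr_eq0 mulf_eq0 (negbTE d0) /= => /eqP vy.
    by apply/eqP/Z2_eq; rewrite ?zx1 ?zy1.
  exists (((v : 'cV[int]_2) 1 0)%:~R / ((v : 'cV[int]_2) 0 0)%:~R) => //.
  rewrite rmorphM fmorphV !rmorph_int -/(zx v) -/(zy v).
  apply: (mulIf vx); apply: (mulfI d0); rewrite mulfVK// mulrA mulrCA mulfV// mulr1.
  by move/eqP: hv; rewrite subr_eq0 => /eqP ->.
Qed.

Lemma line_pts_trivial d : unit_dir d ->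
  line_pts d = [set 1%g] <-> ~ rational_slope d.
Proof.
move=> ud; rewrite (rational_slopeP ud) line_ptsE hp1; split=> [e [v [v1 hv]]|h].
  have : [set v | hp d v = 0] v by [].
  by rewrite e /= => v1'; rewrite v1' eqxx in v1.
apply/seteqP; split=> [v /= hv|v ->]; last exact: hp1.
by apply/eqP; apply: contraT => v1; case: h; exists v.
Qed.

Lemma line_pts_cyclic d : unit_dir d -> exists v, line_pts d = cyclic_subgroup v.
Proof.
move=> ud; rewrite line_ptsE.
have gc := pseudo_stab_group (@hp_lt_mul2l d).
have [d0|d0] := eqVneq (d 0 0) 0.
  apply: (@cyclic_of_int _ _ (fun v : Z2 => (v : 'cV[int]_2) 1 0)) => //.
    by move=> v w _ _; rewrite -[(v * w)%g]/((v : 'cV[int]_2) + w) mxE.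
  move=> v; rewrite /= hp1 /hp d0 mul0r subr0 => /eqP h1 h2.
  apply: Z2_eq; rewrite ?zx1 ?zy1; last by rewrite /zy h2.
  move: h1; rewrite mulf_eq0 => /orP[/eqP d1|/eqP//].
  by move: (unit_neq0 ud) => /eqP; case; apply: col2_eq; rewrite mxE.
apply: (@cyclic_of_int _ _ (fun v : Z2 => (v : 'cV[int]_2) 0 0)) => //.
  by move=> v w _ _; rewrite -[(v * w)%g]/((v : 'cV[int]_2) + w) mxE.
move=> v; rewrite /= hp1 /hp => /eqP h1 h2.
have vx : zx v = 0 by rewrite /zx h2.
apply: Z2_eq; rewrite ?zx1 ?zy1 => //; move: h1; rewrite vx mulr0 sub0r oppr_eq0 mulf_eq0.
by rewrite (negbTE d0) => /eqP.
Qed.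

(** An extension of the pseudo-ordering amounts to an orientation of the cyclic
    group of lattice points on the line. When this group is trivial both
    orientations give the same ordering, and [b] is normalized to [false]. *)
Lemma extends_dirLO_eq (o : LO Z2) d (ud : unit_dir d) : extends o (line_lt d) ->
  exists b, o = dirLO ud b /\ (rational_slope d \/ b = false).
Proof.
move=> e; have [v ev] := line_pts_cyclic ud.
have K b : pos o v = pos (dirLO ud b) v -> o = dirLO ud b.
  move=> h; apply: (@extends_cyclic_unique _ _ (hp d) _ _ v _ _ _ h).
  - by rewrite -line_lt_fun.
  - by rewrite -line_lt_fun; exact: extends_dirLO.
  - by rewrite -line_ptsE.
have [v1|v1] := eqVneq v 1%g.
  by exists false; split; [apply: K; rewrite v1 !pos1|right].
have hv : hp d v = 0.
  rewrite -(hp1 d); have : line_pts d v by rewrite ev; exists 1%N; left; rewrite expg1.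
  by rewrite line_ptsE.
exists ((0 < dot d v) == pos o v); split.
  by apply: K; rewrite pos_dirLOV//; case: (pos o v); case: (_ < _).
by left; apply/(rational_slopeP ud); exists v.
Qed.

End HalfPlane.

(** * The direction of an ordering of Z^2 *)

Section OrderDirection.
Variables (R : realType) (P : int -> int -> bool).
Hypotheses (P10 : P 1 0) (P01 : P 0 1)
  (PD : forall a b a' b', P a b -> P a' b' -> P (a + a') (b + b'))
  (PN : forall a b, (a != 0) || (b != 0) -> P (- a) (- b) = ~~ P a b).

Let PX a b (n : nat) : P a b -> P (a * n.+1%:Z) (b * n.+1%:Z).
Proof.
move=> ab; elim: n => [|n IH]; first by rewrite !mulr1.
by rewrite -(addn1 n.+1) PoszD !mulrDr !mulr1; exact: PD.
Qed.

Let PXE a b (n : nat) : P (a * n.+1%:Z) (b * n.+1%:Z) = P a b.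
Proof.
have [ab0|ab] := boolP ((a != 0) || (b != 0)); last first.
  by move: ab; rewrite negb_or !negbK => /andP[/eqP-> /eqP->]; rewrite !mul0r.
apply/idP/idP; last exact: PX.
apply: contraLR; rewrite -PN// => /(PX n); rewrite !mulNr PN//.
by rewrite !mulf_eq0 !negb_or /= !andbT.
Qed.

Let S : set R := [set x | exists (m : int) (n : nat),
  P (- m) n.+1%:Z /\ x = m%:~R / n.+1%:R].

Let S0 : S 0.
Proof. by exists 0, 0%N; rewrite oppr0 mul0r. Qed.

Let Pa0 (a : int) : 0 < a -> P a 0.
Proof.
case: a => [[//|n]|//] _; have := PX n P10.
by rewrite mul1r mul0r.
Qed.

Let above a b (x : R) : (0 < b)%R -> S x -> - a%:~R / b%:~R < x -> P a b.
Proof.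
move=> b0 [m [n [Pmn ->]]].
have bR : (0 : R) < b%:~R by rewrite ltr0z.
rewrite ltr_pdivrMr// mulrAC ltr_pdivlMr ?ltr0Sn// => h.
have {}h : (0 < a * n.+1%:Z + m * b)%R.
  rewrite -(@ltr0z R) intrD !intrM -[(n.+1%:Z)%:~R]/(n.+1%:R); lra.
rewrite -(PXE _ _ n).
case: b b0 {bR} h => [[//|k]|//] _ h.
have := PD (PX k Pmn) (Pa0 h).
rewrite addr0 mulNr addrC addrK mulrC.
by rewrite (mulrC k.+1%:Z).
Qed.

(** Here [P] is the positive cone of an ordering of Z^2 for which both basis
    vectors are positive. For [0 < b] the sign of [(a, b)] is decided by the
    position of [- a / b] with respect to a cut of the rationals, of which [S] is
    the lower part. The cut is a real number or infinite, and provides the form. *)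
Lemma lattice_cone_functional :
  exists x y : R, (x != 0) || (y != 0) /\
    forall a b, 0 < x * a%:~R + y * b%:~R -> P a b.
Proof.
have [ubS|nubS] := pselect (has_ubound S); last first.
  exists 0, 1; split; first by rewrite oner_eq0 orbT.
  move=> a b; rewrite mul0r add0r mul1r ltr0z => b0.
  have [x Sx xab] : exists2 x, S x & - a%:~R / b%:~R < x.
    apply: contrapT => h; apply: nubS; exists (- a%:~R / b%:~R) => x Sx.
    by rewrite leNgt; apply/negP => xab; apply: h; exists x.
  exact: above Sx xab.
have hS : has_sup S by split=> //; exists 0; exact: S0.
exists 1, (sup S); split; first by rewrite oner_eq0.
move=> a b; rewrite mul1r => h.
have [b0|b0|b0] := ltgtP b 0.
- rewrite -[a]opprK -[b]opprK PN; last by rewrite !oppr_eq0 (lt_eqF b0) orbT.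
  apply/negP => Pab; case: b b0 h Pab => [//|k] _ h Pab.
  have Sx : S (a%:~R / k.+1%:R) by exists a, k; split.
  have := ub_le_sup ubS Sx; rewrite leNgt => /negP; apply.
  rewrite ltr_pdivlMr ?ltr0Sn//; move: h.
  rewrite NegzE rmorphN/= mulrN subr_gt0; by [].
- have bR : (0 : R) < b%:~R by rewrite ltr0z.
  have e0 : 0 < sup S + a%:~R / b%:~R.
    by rewrite -(pmulr_lgt0 _ bR) mulrDl mulfVK ?gt_eqF// addrC.
  have [x Sx hx] := sup_adherent e0 hS.
  by apply: above Sx _ => //; move: hx; rewrite mulNr; lra.
- by move: h; rewrite b0 mulr0 addr0 ltr0z; exact: Pa0.
Qed.

End OrderDirection.

Section Directions.
Variable R : realType.

Lemma order_direction (o : LO Z2) :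
  exists d : 'cV[R]_2, unit_dir d /\ extends o (line_lt d).
Proof.
pose e1 : Z2 := col2 1 0; pose e2 : Z2 := col2 0 1.
(* Reversing the coordinate axes makes both basis vectors positive. *)
pose s1 : int := if pos o e1 then 1 else -1.
pose s2 : int := if pos o e2 then 1 else -1.
have s1K : s1 * s1 = 1 by rewrite /s1; case: ifP.
have s2K : s2 * s2 = 1 by rewrite /s2; case: ifP.
pose P a b := pos o (col2 (s1 * a) (s2 * b) : 'cV[int]_2).
have P10 : P 1 0.
  rewrite /P /s1; have [h|h] := boolP (pos o e1).
    rewrite (_ : col2 _ _ = e1 :> Z2)//.
    by apply: col2_eq; rewrite ?col2_0 ?col2_1 ?mulr0.
  rewrite (_ : col2 _ _ = (e1^-1)%g :> Z2).
    rewrite posV//; apply/eqP => /(congr1 (@zx R)); rewrite zx1 col2Z_zx => /eqP.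
    by rewrite oner_eq0.
  by apply: (@Z2_eq R); rewrite ?zxV ?zyV !(col2Z_zx, col2Z_zy) !(mulr1, mulr0) ?oppr0 ?rmorphN1.
have P01 : P 0 1.
  rewrite /P /s2; have [h|h] := boolP (pos o e2).
    rewrite (_ : col2 _ _ = e2 :> Z2)//.
    by apply: col2_eq; rewrite ?col2_0 ?col2_1 ?mulr0.
  rewrite (_ : col2 _ _ = (e2^-1)%g :> Z2).
    rewrite posV//; apply/eqP => /(congr1 (@zy R)); rewrite zy1 col2Z_zy => /eqP.
    by rewrite oner_eq0.
  by apply: (@Z2_eq R); rewrite ?zxV ?zyV !(col2Z_zx, col2Z_zy) !(mulr1, mulr0) ?oppr0 ?rmorphN1.
have PD a b a' b' : P a b -> P a' b' -> P (a + a') (b + b').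
  move=> h h'; have := posM h h'; congr (pos o _).
  by apply: (@Z2_eq R); rewrite ?zxM ?zyM !(col2Z_zx, col2Z_zy) -intrD mulrDr.
have PN a b : (a != 0) || (b != 0) -> P (- a) (- b) = ~~ P a b.
  move=> ab; rewrite /P -posV.
    congr (pos o _).
    by apply: (@Z2_eq R); rewrite ?zxV ?zyV !(col2Z_zx, col2Z_zy) mulrN rmorphN.
  apply: contraTneq ab => ab; rewrite negb_or !negbK.
  have := congr1 (@zx R) ab; have := congr1 (@zy R) ab.
  rewrite zx1 zy1 col2Z_zx col2Z_zy => /eqP; rewrite intr_eq0 => /eqP h2 /eqP.
  rewrite intr_eq0 => /eqP h1.
  by rewrite -[a]mul1r -[b]mul1r -{1}s1K -{1}s2K -!mulrA h1 h2 !mulr0 eqxx.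
have [x [y [xy0 xyP]]] := @lattice_cone_functional R P P10 P01 PD PN.
have posP v : pos o v = P (s1 * (v : 'cV[int]_2) 0 0) (s2 * (v : 'cV[int]_2) 1 0).
  rewrite /P !mulrA s1K s2K !mul1r; congr (pos o _).
  by apply: (@Z2_eq R); rewrite ?col2Z_zx ?col2Z_zy.
pose d0 : 'cV[R]_2 := col2 (- (y * s2%:~R)) (x * s1%:~R).
have sR (s : int) : s * s = 1 -> (s%:~R : R) * s%:~R = 1 by move=> e; rewrite -intrM e.
have d0N : d0 != 0.
  apply: contraTneq xy0 => d00; rewrite negb_or !negbK.
  have := congr1 (fun M : 'cV[R]_2 => M 0 0) d00.
  have := congr1 (fun M : 'cV[R]_2 => M 1 0) d00.
  rewrite col2_0 col2_1 !mxE => h1 /eqP; rewrite oppr_eq0 => /eqP h2.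
  have -> : x = x * s1%:~R * s1%:~R by rewrite -mulrA sR ?mulr1.
  have -> : y = y * s2%:~R * s2%:~R by rewrite -mulrA sR ?mulr1.
  by rewrite h1 h2 !mul0r eqxx.
have hd0 v : 0 < hp d0 v -> pos o v.
  rewrite posP => h; apply: xyP; move: h; rewrite /hp col2_0 col2_1 mulNr opprK.
  by rewrite !intrM !mulrA.
have [c [c0 uc]] := normalize_dir d0N; exists (c *: d0); split=> //.
move=> v w /line_ltE; rewrite !hpZ ltr_pM2l// => vw; rewrite lo_ltE; apply: hd0.
by rewrite hpM hpV addrC subr_gt0.
Qed.

End Directions.

(** * Perturbing directions *)

Section Circle.
Variable R : realType.
Implicit Types (d : 'cV[R]_2) (v w : Z2).

Lemma det2Zl c (u v : 'cV[R]_2) : det2 (c *: u) v = c * det2 u v.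
Proof. rewrite /det2 !mxE; lra. Qed.

Lemma det2vv (u : 'cV[R]_2) : det2 u u = 0.
Proof. by rewrite /det2 mulrC subrr. Qed.

Lemma unit_parallel d d' c : unit_dir d -> unit_dir d' -> 0 < c -> d' = c *: d ->
  d' = d.
Proof.
move=> ud ud' c0 e; suff -> : d' = 1 *: d by rewrite scale1r.
rewrite e; congr (_ *: _); move: ud'; rewrite /unit_dir e !mxE !exprMn -mulrDr ud mulr1.
by move/eqP; rewrite sqrp_eq1 ?ltW// => /eqP.
Qed.

Lemma extends_dir_unique (o : LO Z2) d d' : unit_dir d -> unit_dir d' ->
  extends o (line_lt d) -> extends o (line_lt d') -> d = d'.
Proof.
move=> ud ud' e e'.
have [c [c0 ec]] : exists c, 0 < c /\ d' = c *: d.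
  apply: parallel_of_halfplane; rewrite ?unit_neq0// => v hv.
  rewrite leNgt; apply/negP => hv'.
  have /e : line_lt d 1%g v by apply/line_lt1E.
  have /e' : line_lt d' 1%g v^-1%g by apply/line_lt1E; rewrite hpV oppr_gt0.
  by rewrite -!/(pos _ _) => /[swap] /pos_asym ->.
by rewrite (unit_parallel ud ud' c0 ec).
Qed.

(** A small rotation of the line that brings its positive lattice points to its
    right preserves the sign of finitely many given lattice points. *)
Lemma dirLO_perfect (o : LO Z2) U : nbhs o U -> exists o', o' <> o /\ U o'.
Proof.
move=> /nbhs_LO[s [so sU]].
have [d [ud ed]] := order_direction R o.
have [b [oE _]] := extends_dirLO_eq ud ed.
pose n : 'cV[R]_2 := col2 (- d 1 0) (d 0 0).
pose sg : R := if b then 1 else -1.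
have hpn e v : hp (d + (e * sg) *: n) v = hp d v + e * (sg * dot d v).
  by rewrite /hp /dot !mxE /=; lra.
have [e0 [e00 e0P]] : exists e0 : R, 0 < e0 /\ forall e, 0 < e -> e < e0 ->
    all (fun v => 0 < hp (d + (e * sg) *: n) v) s.
  elim: s so {sU} => [_|v s IH /= /andP[vo so]]; first by exists 1.
  have [e0 [e00 e0P]] := IH so.
  have [e1 [e10 e1P]] : exists e1 : R, 0 < e1 /\ forall e, 0 < e -> e < e1 ->
      0 < hp (d + (e * sg) *: n) v.
    move: vo; rewrite oE => /pos_dirLO[hv|[hv dv]]; last first.
      by exists 1; split=> // e ep _; rewrite hpn hv add0r mulr_gt0.
    have [dv|dv] := leP 0 (sg * dot d v).
      exists 1; split=> // e ep _; rewrite hpn; have := mulr_ge0 (ltW ep) dv; lra.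
    exists (hp d v / - (sg * dot d v)).
    split; first by rewrite divr_gt0// oppr_gt0.
    move=> e ep; rewrite ltr_pdivlMr ?oppr_gt0// hpn; lra.
  exists (Num.min e0 e1); split; first by rewrite lt_min e00.
  move=> e ep; rewrite lt_min => /andP[h0 h1].
  by rewrite e1P// e0P.
pose e := e0 / 2; have ep : 0 < e by rewrite divr_gt0.
have ee : e < e0 by rewrite /e; lra.
pose d1 := d + (e * sg) *: n.
have d10 : d1 != 0.
  apply/eqP => d10.
  have : det2 d d1 = e * sg.
    rewrite /d1 /det2 !mxE /=; have ud' : d 0 0 ^+ 2 + d 1 0 ^+ 2 = 1 := ud.
    have := congr1 (fun z => e * sg * z) ud'; rewrite mulr1; lra.
  rewrite d10 /det2 !mxE !mulr0 subrr => /eqP; rewrite eq_sym mulf_eq0 gt_eqF//=.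
  by rewrite /sg; case: (b); rewrite ?oppr_eq0 oner_eq0.
have [c [c0 ud1]] := normalize_dir d10.
exists (dirLO ud1 false); split; last first.
  apply: sU; apply/allP => v vs; apply/pos_dirLO; left; rewrite hpZ mulr_gt0//.
  exact: (allP (e0P e ep ee)).
move=> oeq; have e1 : extends o (line_lt (c *: d1)) by rewrite -oeq; exact: extends_dirLO.
have dd := extends_dir_unique ud ud1 ed e1.
have : det2 d d1 = e * sg.
  rewrite /d1 /det2 !mxE /=; have ud' : d 0 0 ^+ 2 + d 1 0 ^+ 2 = 1 := ud.
  have := congr1 (fun z => e * sg * z) ud'; rewrite mulr1; lra.
have -> : det2 d d1 = 0.
  by rewrite dd det2Zl det2vv mulr0.
move/eqP; rewrite eq_sym mulf_eq0 gt_eqF//=.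
by rewrite /sg; case: (b); rewrite ?oppr_eq0 oner_eq0.
Qed.

Lemma LO_Z2_cantor : is_cantor [set: LO Z2].
Proof.
pose e (n : nat) : Z2 := if @choice.unpickle 'cV[int]_2 n is Some v then v else 0.
apply: (@is_cantor_LO R _ e).
- by move=> g; exists (@choice.pickle 'cV[int]_2 g); rewrite /e choice.pickleK.
- have u : unit_dir (col2 1 0 : 'cV[R]_2) by rewrite /unit_dir col2_0 col2_1 expr1n expr0n addr0.
  by exists (dirLO u false).
- exact: closedT.
- by move=> o U _ /dirLO_perfect[q [? ?]]; exists q.
Qed.

(** Lattice points separating [d] from the two directions [d + e n] and
    [d - e n], where [n] is orthogonal to [d], confine a direction to a small arc
    around [d]. *)
Lemma confining_vectors d (e : R) : unit_dir d -> 0 < e ->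
  exists v w, [/\ 0 < hp d v, 0 < hp d w & forall d', unit_dir d' ->
    0 <= hp d' v -> 0 <= hp d' w ->
    0 < d 0 0 * d' 0 0 + d 1 0 * d' 1 0 /\
    `|det2 d d'| <= e * (d 0 0 * d' 0 0 + d 1 0 * d' 1 0)].
Proof.
move=> ud e0; pose n : 'cV[R]_2 := col2 (- d 1 0) (d 0 0).
have ud' : d 0 0 ^+ 2 + d 1 0 ^+ 2 = 1 := ud.
have dn s : det2 d (d + s *: n) = s.
  rewrite /det2 !mxE /=; have := congr1 (fun z => s * z) ud'; rewrite mulr1; lra.
have [v [v1 v2]] : exists v, 0 < hp d v /\ hp (d + e *: n) v < 0.
  by apply: separating_vector; rewrite dn gt_eqF.
have [w [w1 w2]] : exists v, 0 < hp d v /\ hp (d + (- e) *: n) v < 0.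
  by apply: separating_vector; rewrite dn oppr_eq0 gt_eqF.
exists v, w; split=> // d1 u1; set x := _ + _; set y := det2 d d1.
have hpn z : hp n z = dot d z by rewrite /hp /dot !mxE /=; lra.
have E z : hp d1 z = x * hp d z + y * hp n z.
  rewrite -[LHS]mul1r -ud' /x /y /det2 hpn /hp /dot; lra.
have xy : x ^+ 2 + y ^+ 2 = 1.
  have u1' : d1 0 0 ^+ 2 + d1 1 0 ^+ 2 = 1 := u1.
  have := congr2 (fun a b => a * b) ud' u1'; rewrite /x /y /det2 mulr1; lra.
have hpD s z : hp (d + s *: n) z = hp d z + s * hp n z by rewrite /hp !mxE /=; lra.
rewrite !E; move: v2 w2; rewrite !hpD => v2 w2 h1 h2.
have [y0|y0|y0] := ltgtP y 0.
- have : 0 < hp d w * (e * x + y).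
    have := mulr_ge0 (ltW e0) h2; have : y * (hp d w + - e * hp n w) > 0 by rewrite nmulr_rgt0.
    lra.
  rewrite pmulr_rgt0// => h; have xp : 0 < e * x by lra.
  rewrite pmulr_rgt0// in xp; rewrite ltr0_norm//; split=> //; lra.
- have : 0 < hp d v * (e * x - y).
    have := mulr_ge0 (ltW e0) h1; have : y * (hp d v + e * hp n v) < 0 by rewrite pmulr_rlt0.
    lra.
  rewrite pmulr_rgt0// => h; have xp : 0 < e * x by lra.
  rewrite pmulr_rgt0// in xp; rewrite gtr0_norm//; split=> //; lra.
- move: h1; rewrite y0 mul0r addr0 pmulr_lge0// => x0.
  have xp : 0 < x.
    rewrite lt_neqAle x0 andbT eq_sym; apply: contra_eq_neq xy => ->.
    by rewrite y0 expr0n addr0 eq_sym oner_eq0.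
  by rewrite normr0 mulr_ge0 ?ltW.
Qed.

End Circle.

(** * The doubled circle *)

Section DCircle.
Variable R : realType.
Implicit Types (d : 'cV[R]_2) (v w : Z2) (p q r : dcircle R).

Lemma dcircleP p : unit_dir (val p).1 /\
  (rational_slope (val p).1 \/ (val p).2 = false).
Proof. by have /asboolP := valP p. Qed.

Definition mk_dcircle d b (h : unit_dir d /\ (rational_slope d \/ b = false)) :
  dcircle R := exist _ (d, b) (asboolT h).

Lemma dcircle_eq p q : (val p).1 = (val q).1 -> (val p).2 = (val q).2 -> p = q.
Proof.
by move=> h1 h2; apply: val_inj; move: h1 h2; case: (val p) (val q) => [? ?] [? ?] /= -> ->.
Qed.

Definition dcircleLO p : LO Z2 := dirLO (dcircleP p).1 (val p).2.

Lemma extends_dcircleLO p : extends (dcircleLO p) (line_lt (val p).1).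
Proof. exact: extends_dirLO. Qed.

Lemma dcircleLO_inj : injective dcircleLO.
Proof.
move=> p q pq; have [up hp_] := dcircleP p; have [uq hq] := dcircleP q.
have e : (val p).1 = (val q).1.
  apply: (extends_dir_unique up uq (@extends_dcircleLO p)).
  by rewrite pq; exact: extends_dcircleLO.
apply: dcircle_eq => //.
have [rp|np] := pselect (rational_slope (val p).1); last first.
  case: hp_ => // ->; case: hq => // rq; by case: np; rewrite e.
have [v [v1 hv]] := (rational_slopeP up).1 rp.
have hv' : hp (val q).1 v = 0 by rewrite -e.
have := congr1 (fun o => pos o v) pq; rewrite /dcircleLO !pos_dirLOV// e.
by case: (0 < _); case: (val p).2; case: (val q).2.
Qed.

Lemma dcircleLO_surj (o : LO Z2) : exists p, dcircleLO p = o.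
Proof.
have [d [ud ed]] := order_direction R o.
have [b [oE rb]] := extends_dirLO_eq ud ed.
exists (mk_dcircle (conj ud rb)); rewrite oE /dcircleLO /=.
by congr dirLO; exact: Prop_irrelevance.
Qed.

Lemma open_arc p r : open [set q | dccw p q r].
Proof.
exists [set [set q | dccw p q r]]; last by rewrite bigcup_set1.
move=> _ ->; exists (fset1 [set q | dccw p q r]); last by rewrite set_fset1 bigcap_set1.
by move=> A /fset1P ->; apply/mem_set; exists p, r.
Qed.

Lemma nbhs_arcs q U : nbhs q U -> exists F : seq (dcircle R * dcircle R),
  (forall pr, pr \in F -> dccw pr.1 q pr.2) /\
  forall q', (forall pr, pr \in F -> dccw pr.1 q' pr.2) -> U q'.
Proof.
case=> ? [[ I Irp] <-] [A] /[dup] /(Irp _) [F rayF <-] IF Fq IU.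
have /choice[g gE] : forall X : set (dcircle R), exists y : dcircle R * dcircle R,
    X \in F -> X = [set x | dccw y.1 x y.2].
  move=> X.
  have [XF|XF] := pselect (X \in F); last by exists (q, q).
  have /set_mem[p [r e]] : X \in @dcircle_arcs R by exact: rayF.
  by exists (p, r).
exists (map g F); split=> [_ /mapP[X XF ->]|q' h].
  by have := Fq X XF; rewrite [in X in X -> _](gE X XF).
apply: IU; exists (\bigcap_(i in [set` F]) i) => //.
by move=> X XF; rewrite (gE X XF) /=; apply: h; exact: map_f.
Qed.

Lemma unit_collinear d d' : unit_dir d -> unit_dir d' -> det2 d d' = 0 ->
  d' = d \/ d' = - d.
Proof.
move=> ud ud' D0; pose s := d 0 0 * d' 0 0 + d 1 0 * d' 1 0.
have e : d' = s *: d.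
  have u : d 0 0 ^+ 2 + d 1 0 ^+ 2 = 1 := ud.
  apply: col2_eq; rewrite mxE -[LHS]mul1r -u /s; move: D0; rewrite /det2 => D0.
    have /= := congr1 (fun z => d 1 0 * z) D0; rewrite mulr0; lra.
  have /= := congr1 (fun z => d 0 0 * z) D0; rewrite mulr0; lra.
have : s ^+ 2 = 1 by move: ud'; rewrite /unit_dir e !mxE !exprMn -mulrDr ud mulr1.
move/eqP; rewrite sqrf_eq1 e => /orP[/eqP ->|/eqP ->]; [left|right].
  by rewrite scale1r.
by rewrite scaleN1r.
Qed.

(** A lattice point [v] is positive for the directions of the open half circle
    that goes from its own direction [y] to [- y], and for those copies of [y] and
    of [- y] that order the line suitably; the other copy of each bounds this
    arc. *)
Lemma half_circle_arc v : v != 1%g ->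
  exists p r, forall q, dccw p q r = pos (dcircleLO q) v.
Proof.
move=> v1; pose x : 'cV[R]_2 := col2 (zx R v) (zy R v).
have x0 : x != 0.
  apply: contraNneq v1 => x0; apply/eqP/(@Z2_eq R); rewrite ?zx1 ?zy1.
    by have := congr1 (fun M : 'cV[R]_2 => M 0 0) x0; rewrite col2_0 mxE.
  by have := congr1 (fun M : 'cV[R]_2 => M 1 0) x0; rewrite col2_1 mxE.
have [c [c0 ux]] := normalize_dir x0; set y := c *: x in ux.
have hy : hp y v = 0 by rewrite hpZ /hp col2_0 col2_1; lra.
have uNy : unit_dir (- y) by rewrite /unit_dir !mxE !sqrrN; move: ux; rewrite /unit_dir !mxE.
have ry : rational_slope y by apply/(rational_slopeP ux); exists v.
have rNy : rational_slope (- y).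
  by apply/(rational_slopeP uNy); exists v; rewrite hpN hy oppr0.
exists (mk_dcircle (conj ux (or_introl ry) : _ /\ (_ \/ false = false))).
exists (mk_dcircle (conj uNy (or_introl rNy) : _ /\ (_ \/ true = false))).
move=> q; have [uq hq] := dcircleP q.
have yNy : - y != y.
  apply/eqP => e; have := unit_neq0 ux; have := congr1 (fun M => M + y) e.
  rewrite addNr => /esym e2; suff -> : y = 0 by rewrite eqxx.
  apply: col2_eq; rewrite mxE; have := congr1 (fun M : 'cV[R]_2 => M 0 0) e2;
  have := congr1 (fun M : 'cV[R]_2 => M 1 0) e2; rewrite !mxE; lra.
have dety : det2 y (val q).1 = c * hp (val q).1 v.
  by rewrite /det2 /hp !mxE /=; lra.
have ccwE : ccw y (val q).1 (- y) = (0 < hp (val q).1 v).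
  rewrite -(pmulr_rgt0 (hp (val q).1 v) c0) -dety /ccw.
  rewrite -(pmulr_rgt0 (det2 y (val q).1) (ltr0n R 2)).
  by congr (0 < _); rewrite /det2 !mxE; lra.
rewrite /dccw /= ccwE; have [hv|hv|hv] := ltgtP 0 (hp (val q).1 v).
- by apply/esym/pos_dirLO; left.
- have -> : pos (dcircleLO q) v = false.
    apply/negP => /pos_dirLO[|[]]; last by move=> h; rewrite h ltxx in hv.
    by rewrite ltNge ltW.
  have qy : y != (val q).1 by apply: contraTneq hv => <-; rewrite hy ltxx.
  have qNy : (val q).1 != - y by apply: contraTneq hv => ->; rewrite hpN hy oppr0 ltxx.
  by rewrite (negbTE qy) (negbTE qNy) /= andbF.
- rewrite pos_dirLOV//.
  have doty : 0 < dot y v.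
    rewrite /dot !mxE /=.
    have := neq0_sqr_gt0 x0; rewrite col2_0 col2_1 => /(mulr_gt0 c0); lra.
  have dety0 : det2 y (val q).1 = 0 by rewrite dety -hv mulr0.
  have [] : (val q).1 = y \/ (val q).1 = - y.
    exact: unit_collinear ux uq dety0.
  + move=> ->; rewrite !eqxx (eq_sym y) (negbTE yNy) doty.
    by case: (val q).2.
  + move=> ->; rewrite !eqxx (eq_sym y) (negbTE yNy) /=.
    have -> : 0 < dot (- y) v = false.
      apply/negbTE; rewrite -leNgt; apply: ltW.
      by rewrite -oppr_gt0; move: doty; rewrite /dot !mxE /=; lra.
    by case: (val q).2.
Qed.

(** With [det2 d], the coordinates in the orthonormal frame of the unit vector
    [d]; the lemmas below express everything in this frame. *)
Definition inner d d' : R := d 0 0 * d' 0 0 + d 1 0 * d' 1 0.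

Lemma inner_det2_unit d d' : unit_dir d -> unit_dir d' -> inner d d' ^+ 2 + det2 d d' ^+ 2 = 1.
Proof.
move=> ud ud'.
have u : d 0 0 ^+ 2 + d 1 0 ^+ 2 = 1 := ud.
have u' : d' 0 0 ^+ 2 + d' 1 0 ^+ 2 = 1 := ud'.
have := congr2 (fun a b => a * b) u u'; rewrite /inner /det2 mulr1; lra.
Qed.

Lemma hp_coord d d' v : unit_dir d ->
  hp d' v = inner d d' * hp d v + det2 d d' * dot d v.
Proof.
move=> ud; have u : d 0 0 ^+ 2 + d 1 0 ^+ 2 = 1 := ud.
rewrite -[LHS]mul1r -u /inner /det2 /hp /dot; lra.
Qed.

Lemma ccw_coord d a b c : unit_dir d -> ccw a b c =
  (0 < (inner d b - inner d a) * (det2 d c - det2 d a)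
     - (det2 d b - det2 d a) * (inner d c - inner d a)).
Proof.
move=> ud; have u : d 0 0 ^+ 2 + d 1 0 ^+ 2 = 1 := ud.
rewrite /ccw; congr (0 < _); rewrite -[LHS]mul1r -u /inner /det2 !mxE; lra.
Qed.

Lemma inner_id d : unit_dir d -> inner d d = 1.
Proof. by rewrite /unit_dir /inner -!expr2. Qed.

Lemma inner_eq1 d d' : unit_dir d -> unit_dir d' -> inner d d' = 1 -> d' = d.
Proof.
move=> ud ud' h; have := inner_det2_unit ud ud'.
rewrite h expr1n => /eqP; rewrite -subr_eq0 addrAC subrr add0r sqrf_eq0 => /eqP D0.
have [//|e] := unit_collinear ud ud' D0.
have dN : inner d (- d) = - inner d d by rewrite /inner !mxE; lra.
by move: h; rewrite e dN inner_id// => /eqP; rewrite eqNr oner_eq0.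
Qed.

Lemma le1_of_sqr (x : R) : x ^+ 2 <= 1 -> x <= 1.
Proof. by move=> h; rewrite leNgt; apply/negP => h4; nra. Qed.

Lemma inner_lt1 d d' : unit_dir d -> unit_dir d' -> d' != d -> inner d d' < 1.
Proof.
move=> ud ud' dd; rewrite lt_neqAle; apply/andP; split.
  by apply: contra_neq dd; exact: inner_eq1.
have := inner_det2_unit ud ud'; have := sqr_ge0 (det2 d d') => h1 h2.
by apply: le1_of_sqr; lra.
Qed.

(** On the unit circle the first coordinate [x] of a point close to [(1, 0)]
    differs from [1] only to second order in the other coordinate [y]. *)
Lemma second_order_bound (x y a b : R) : x <= 1 -> 1 - x <= y ^+ 2 -> y != 0 ->
  `|y| <= (1 - a) / 2 -> `|b| <= 1 -> `|(1 - x) * b| < `|y| * (1 - a).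
Proof.
move=> x1 xy y0 ya b1; have yp : 0 < `|y| by rewrite normr_gt0.
apply: (@le_lt_trans _ _ (`|y| * `|y|)); last by rewrite ltr_pM2l//; lra.
rewrite normrM ger0_norm ?subr_ge0// -[leRHS]mulr1 ler_pM ?subr_ge0//.
by rewrite -expr2 real_normK ?num_real.
Qed.

Lemma confine q (e : R) : 0 < e -> exists v w,
  [/\ pos (dcircleLO q) v, pos (dcircleLO q) w &
    forall q', pos (dcircleLO q') v -> pos (dcircleLO q') w ->
      [/\ 0 < inner (val q).1 (val q').1, inner (val q).1 (val q').1 <= 1,
         `|det2 (val q).1 (val q').1| <= e,
         `|det2 (val q).1 (val q').1| <= e * inner (val q).1 (val q').1 &
         1 - inner (val q).1 (val q').1 <= det2 (val q).1 (val q').1 ^+ 2]].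
Proof.
move=> e0; have [uq _] := dcircleP q.
have [v [w [hv hw H]]] := confining_vectors uq e0.
exists v, w; split; [by apply/pos_dirLO; left|by apply/pos_dirLO; left|].
move=> q'; have [uq' _] := dcircleP q'.
have pos_ge0 z : pos (dcircleLO q') z -> 0 <= hp (val q').1 z.
  by move=> /pos_dirLO[/ltW//|[->]].
move=> /pos_ge0 h1 /pos_ge0 h2; have [x0 yx] := H _ uq' h1 h2.
have xy := inner_det2_unit uq uq'; rewrite -/(inner _ _) in x0 yx.
set x := inner _ _ in x0 yx xy *; set y := det2 _ _ in yx xy *.
have y2 := sqr_ge0 y.
have x1 : x <= 1 by apply: le1_of_sqr; lra.
split=> //.
  by apply: le_trans yx _; rewrite ger_pMr.
have : x ^+ 2 <= x by rewrite expr2 ger_pMr.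
lra.
Qed.

Lemma dcircle_line_vector q : rational_slope (val q).1 ->
  exists v, [/\ v != 1%g, hp (val q).1 v = 0 & 0 < dot (val q).1 v].
Proof.
have [uq _] := dcircleP q; move=> /(rational_slopeP uq)[v [v1 hv]].
have [dv|dv|dv] := ltgtP 0 (dot (val q).1 v); first by exists v.
  exists v^-1%g; rewrite invg_eq1 v1 hpV hv oppr0; split=> //.
  by move: dv; rewrite /dot zxV zyV; lra.
by move: v1; rewrite (dot_hp_eq0 uq hv (esym dv)) eqxx.
Qed.

(** Lattice points whose direction is close to that of [q] or to its opposite
    confine the direction of [q'] to a small arc around that of [q]. When [p] or
    [r] is the other copy of the direction of [q], a lattice point on the line
    blocks moreover the side on which that copy lies. *)
Lemma arc_nbhs p q r : dccw p q r -> exists s, all (pos (dcircleLO q)) s /\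
  forall q', all (pos (dcircleLO q')) s -> dccw p q' r.
Proof.
have [up _] := dcircleP p; have [uq hq] := dcircleP q; have [ur _] := dcircleP r.
have bnd d : unit_dir d -> [/\ `|inner (val q).1 d| <= 1 & `|det2 (val q).1 d| <= 1].
  move=> ud; have := inner_det2_unit uq ud.
  have := sqr_ge0 (inner (val q).1 d); have := sqr_ge0 (det2 (val q).1 d) => h1 h2 h3.
  by split; apply: le1_of_sqr; rewrite real_normK ?num_real//; lra.
have [pa pb] := bnd _ up; have [ra rb] := bnd _ ur.
move=> /or4P[h|/and4P[/eqP pq p2 q2 rq]|/and4P[/eqP qr q2 r2 pq]|/and4P[/eqP rp r2 p2 qp]].
(* The three directions are distinct: an open condition on that of [q]. *)
- move: (h); rewrite (ccw_coord _ _ _ uq) inner_id// det2vv; set F := (_ - _) => F0.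
  have [e [e0 eF e1]] : exists e, [/\ 0 < e, e <= F / 8 & e <= 1].
    exists (Num.min 1 (F / 8)); rewrite lt_min ltr01 divr_gt0//.
    by split=> //; rewrite ge_min lexx ?orbT.
  have [v [w [pv pw H]]] := confine q e0.
  exists [:: v; w]; rewrite /= pv pw; split=> // q' /and3P[v' w' _].
  have [x0 x1 ye _ xy] := H _ v' w'; apply/or4P/Or41.
  rewrite (ccw_coord _ _ _ uq).
  move: F0 eF; rewrite {}/F; move: x0 x1 ye xy pa pb ra rb.
  set x := inner _ (val q').1; set y := det2 _ (val q').1.
  set a1 := inner _ _; set a2 := det2 _ _; set c1 := inner _ _; set c2 := det2 _ _.
  move=> x0 x1 ye xy pa pb ra rb F0 eF.
  have t1 : `|y * (c1 - a1)| <= e * 2.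
    rewrite normrM ler_pM//; apply: le_trans (ler_normB _ _) _.
    by rewrite -[2]/(1 + 1) lerD.
  have t2 : `|(1 - x) * (c2 - a2)| <= e * 2.
    rewrite normrM ler_pM//; last first.
      by apply: le_trans (ler_normB _ _) _; rewrite -[2]/(1 + 1) lerD.
    rewrite ger0_norm ?subr_ge0//; apply: le_trans xy _.
    rewrite -real_normK ?num_real// expr2; apply: le_trans (_ : e * 1 <= _); last by rewrite mulr1.
    by rewrite ler_pM// (le_trans ye).
  move: t1 t2; rewrite !ler_norml => /andP[_ t1] /andP[_ t2]; lra.
(* The point [q] is the upper copy of the direction of [p]. *)
- case: hq => [rs|q2']; last by rewrite q2' in q2.
  have [u [u1 hu du]] := dcircle_line_vector rs.
  rewrite pq in rq; have c1 := inner_lt1 uq ur rq.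
  have e0 : 0 < (1 - inner (val q).1 (val r).1) / 2 by rewrite divr_gt0// subr_gt0.
  have [v [w [pv pw H]]] := confine q e0.
  exists [:: u; v; w]; rewrite /= pv pw pos_dirLOV// du q2; split=> // q'.
  have [uq' _] := dcircleP q'.
  move=> /and4P[u' v' w' _]; have [x0 x1 ye _ xy] := H _ v' w'.
  have [y0|y0|y0] := ltgtP 0 (det2 (val q).1 (val q').1).
  + apply/or4P/Or41; rewrite (ccw_coord _ _ _ uq) pq inner_id// det2vv.
    have := second_order_bound x1 xy (lt0r_neq0 y0) ye rb.
    rewrite (gtr0_norm y0) ltr_norml => /andP[_]; lra.
  + move: u'; have -> : pos (dcircleLO q') u = false; last by [].
    have hu' : hp (val q').1 u < 0.
      by rewrite (hp_coord _ _ uq) hu mulr0 add0r nmulr_rlt0.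
    apply/negP => /pos_dirLO[|[h _]]; first by rewrite ltNge ltW.
    by rewrite h ltxx in hu'.
  + have x1' : inner (val q).1 (val q').1 = 1.
      by apply/eqP; rewrite eq_le x1 -subr_le0 (le_trans xy)// -y0 expr0n.
    have dd := inner_eq1 uq uq' x1'.
    move: u'; rewrite pos_dirLOV// ?dd// du => /eqP q2'.
    by apply/or4P/Or42; rewrite dd pq eqxx p2 -q2' rq.
(* The point [q] is the lower copy of the direction of [r]. *)
- have rs : rational_slope (val q).1.
    by rewrite qr; have [_ []] := dcircleP r => // r2'; rewrite r2' in r2.
  have [u [u1 hu du]] := dcircle_line_vector rs.
  have c1 : inner (val q).1 (val p).1 < 1 by apply: inner_lt1.
  have e0 : 0 < (1 - inner (val q).1 (val p).1) / 2 by rewrite divr_gt0// subr_gt0.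
  have [v [w [pv pw H]]] := confine q e0.
  exists [:: (u^-1)%g; v; w]; rewrite /= pv pw posV// pos_dirLOV// du.
  rewrite (negbTE q2); split=> // q'.
  have [uq' _] := dcircleP q'.
  move=> /and4P[u' v' w' _]; have [x0 x1 ye _ xy] := H _ v' w'.
  have [y0|y0|y0] := ltgtP 0 (det2 (val q).1 (val q').1).
  + move: u'; have -> : pos (dcircleLO q') u^-1%g = false; last by [].
    have hu' : 0 < hp (val q').1 u.
      by rewrite (hp_coord _ _ uq) hu mulr0 add0r mulr_gt0.
    by rewrite pos_asym//; apply/pos_dirLO; left.
  + apply/or4P/Or41; rewrite (ccw_coord _ _ _ uq) -qr inner_id// det2vv.
    have := second_order_bound x1 xy (ltr0_neq0 y0) ye pb.
    rewrite (ltr0_norm y0) ltr_norml => /andP[]; lra.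
  + have x1' : inner (val q).1 (val q').1 = 1.
      by apply/eqP; rewrite eq_le x1 -subr_le0 (le_trans xy)// -y0 expr0n.
    have dd := inner_eq1 uq uq' x1'.
    move: u'; rewrite posV// pos_dirLOV// ?dd// du => /eqP q2'.
    apply/or4P/Or43; rewrite dd -qr eqxx r2 pq andbT /=.
    by move: q2'; case: (val q').2.
(* The arc goes round the circle from the upper to the lower copy of a direction,
   and [q] is anywhere else. *)
- rewrite rp eq_sym in qp.
  have [e [e0 eP]] : exists e, 0 < e /\
      (0 < inner (val q).1 (val p).1 -> e < `|det2 (val q).1 (val p).1|).
    have [x0|x0] := leP (inner (val q).1 (val p).1) 0; first by exists 1.
    have y0 : det2 (val q).1 (val p).1 != 0.
      apply: contra qp => /eqP /(unit_collinear uq up) [->//|e].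
      have dN : inner (val q).1 (- (val q).1) = - inner (val q).1 (val q).1 by rewrite /inner !mxE; lra.
      by move: x0; rewrite e dN inner_id// oppr_gt0 ltr10.
    exists (`|det2 (val q).1 (val p).1| / 2); rewrite divr_gt0 ?normr_gt0//; split=> // _.
    have : 0 < `|det2 (val q).1 (val p).1| by rewrite normr_gt0.
    lra.
  have [v [w [pv pw H]]] := confine q e0.
  exists [:: v; w]; rewrite /= pv pw; split=> // q' /and3P[v' w' _].
  have [x0 x1 ye _ xy] := H _ v' w'; apply/or4P/Or44.
  rewrite rp eqxx r2 p2 /=; apply: contraTneq ye => q'p.
  by rewrite -ltNge q'p eP// -q'p.
Qed.

(** The half circles on which a lattice point is positive are arcs, and arcs are
    neighbourhoods of their points for the orderings, so both topologies agree. *)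
Lemma LO_Z2_dcircle : exists Phi : LO Z2 -> dcircle R,
  homeo setT setT Phi /\ forall o, extends o (line_lt (val (Phi o)).1).
Proof.
have [Phi PhiK] := choice dcircleLO_surj.
exists Phi; split; last by move=> o; rewrite -{1}(PhiK o); exact: extends_dcircleLO.
exists dcircleLO; split.
- by move=> o _; split=> //; exact: PhiK.
- by move=> q _; split=> //; apply: dcircleLO_inj; rewrite PhiK.
- apply/subspace_continuousP => o _ U /nbhs_arcs[F [Fq FU]].
  rewrite /= /within; near_simpl.
  suff : \forall o' \near o, forall pr, pr \in F -> dccw pr.1 (Phi o') pr.2.
    by apply: filterS => o' h _; exact: FU.
  elim: F Fq {FU} => [|[p r] F IH] Fq; first by apply: filterE.
  have /IH : forall pr, pr \in F -> dccw pr.1 (Phi o) pr.2.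
    by move=> pr prF; apply: Fq; rewrite inE prF orbT.
  have /arc_nbhs[s [so sq]] := Fq (p, r) (mem_head _ _).
  have : \forall o' \near o, dccw p (Phi o') r.
    apply/nbhs_LO; exists s; rewrite -{1}(PhiK o); split=> // o'.
    by rewrite -{1}(PhiK o'); exact: sq.
  apply: filterS2 => o' h1 h2 pr; rewrite inE => /orP[/eqP ->//|]; exact: h2.
- apply: within_continuous_LO => q v _ qv.
  have [p [r prE]] := half_circle_arc (pos_neq1 qv).
  have : \forall q' \near q, dccw p q' r.
    by apply: open_nbhs_nbhs; split; [exact: open_arc|rewrite /= prE].
  by apply: filterS => q' h _; rewrite -prE.
Qed.

End DCircle.

(** * Eigenforms of T *)

Section Eigen.
Variables (R : realType) (T : 'M[int]_2) (detT : \det T = 1) (trT : 2 < \tr T).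
Implicit Types (v w : Z2) (e s : bool).

Lemma sum2 (V : nmodType) (F : 'I_2 -> V) : \sum_i F i = F 0 + F 1.
Proof.
rewrite !big_ord_recl big_ord0 addr0; congr (_ + F _); exact/val_inj.
Qed.

Lemma mul2col (K : pzSemiRingType) (A : 'M[K]_2) (x : 'cV[K]_2) i :
  (A *m x) i 0 = A i 0 * x 0 0 + A i 1 * x 1 0.
Proof. by rewrite mxE sum2. Qed.

Lemma det22 (K : comPzRingType) (A : 'M[K]_2) :
  \det A = A 0 0 * A 1 1 - A 0 1 * A 1 0.
Proof.
rewrite (expand_det_row _ 0) sum2 /cofactor !det_mx11 !mxE /= expr0 mul1r expr1 mulN1r mulrN.
by congr (_ * A _ _ - _ * A _ _); exact/val_inj.
Qed.

Definition ta : R := (T 0 0)%:~R.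
Definition tb : R := (T 0 1)%:~R.
Definition tc : R := (T 1 0)%:~R.
Definition td : R := (T 1 1)%:~R.
Definition tau : R := (\tr T)%:~R.

Lemma tauE : tau = ta + td.
Proof. by rewrite /tau /mxtrace sum2 intrD. Qed.

Lemma detE : ta * td - tb * tc = 1.
Proof.
have := congr1 (fun z : int => z%:~R : R) detT.
by rewrite det22 rmorphB !rmorphM.
Qed.

Lemma tau_ge3 : 3 <= tau.
Proof. by rewrite /tau -[3]/(3%:~R) ler_int; lia. Qed.

(** The roots of [X^2 - tau X + 1]: [lam true] expands, [lam false] contracts. *)
Definition lam e : R :=
  (tau + (if e then 1 else -1) * Num.sqrt (tau ^+ 2 - 4)) / 2.

Lemma disc_gt0 : 0 < tau ^+ 2 - 4.
Proof. have := tau_ge3; nra. Qed.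

Lemma lamD e : lam e + lam (~~ e) = tau.
Proof. by rewrite /lam; case: e => /=; lra. Qed.

Lemma lamM e : lam e * lam (~~ e) = 1.
Proof.
have := sqr_sqrtr (ltW disc_gt0); rewrite /lam.
by case: e => /=; set r := Num.sqrt _ => h; lra.
Qed.

Lemma lam_root e : lam e ^+ 2 - tau * lam e + 1 = 0.
Proof. by have := lamM e; have := lamD e; rewrite addrC => <-; lra. Qed.

Lemma lam_lt : lam false < lam true.
Proof. have := disc_gt0; rewrite -sqrtr_gt0 /lam /=; lra. Qed.

Lemma lam_gt0 e : 0 < lam e.
Proof.
have l1 : 0 < lam true.
  by have := sqrtr_ge0 (tau ^+ 2 - 4); have := tau_ge3; rewrite /lam /=; lra.
case: e => //; have := lamM true => /= h.
by rewrite -(pmulr_rgt0 _ l1) h.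
Qed.

Lemma lam_neq0 e : lam e != 0. Proof. by rewrite gt_eqF ?lam_gt0. Qed.

Lemma lamV e : (lam e)^-1 = lam (~~ e).
Proof. by apply: (mulfI (lam_neq0 e)); rewrite lamM mulfV ?lam_neq0. Qed.

Lemma lam_true_gt1 : 1 < lam true.
Proof.
have := lamM true; have := lam_lt; have := lam_gt0 false; have := lam_gt0 true => /=.
by move=> h1 h2 h3 h4; rewrite ltNge; apply/negP => h5; nra.
Qed.

Lemma lam_false_lt1 : lam false < 1.
Proof.
have := lamM true; have := lam_true_gt1; have := lam_gt0 false => /=.
by move=> h2 h3 h4; rewrite ltNge; apply/negP => h5; nra.
Qed.

Lemma lam_neq e : lam (~~ e) != lam e.
Proof. by have := lam_lt; case: e => /= h; rewrite ?(lt_eqF h) ?(gt_eqF h). Qed.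

Lemma tc_neq0 : tc != 0.
Proof.
rewrite intr_eq0; apply/eqP => c0; have := detT; rewrite det22 c0 mulr0 subr0 => ad.
have : T 0 0 + T 1 1 <= 2.
  have := congr1 absz ad; rewrite abszM => /eqP; rewrite muln_eq1 => /andP[/eqP].
  by move: (T 0 0) (T 1 1) => x y h1 /eqP h2; lia.
by move=> h; move: trT; rewrite /mxtrace sum2 ltNge h.
Qed.

(** A reduced rational root [p / q] satisfies [p^2 + q^2 = tau p q], so that [p]
    divides [q^2] and [q] divides [p^2]. Both are units, and [tau] is [2] or
    [-2]. *)
Lemma lam_irrational e : irrational (lam e).
Proof.
move=> [q _ qE]; have := lam_root e; rewrite -qE => h.
have hq : q ^+ 2 - (\tr T)%:~R * q + 1 = 0.
  apply: (fmorph_inj (ratr : rat -> R)).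
  by rewrite rmorphD rmorphB rmorphXn /= rmorphM rmorph_int rmorph1 rmorph0.
have dq0 : (denq q)%:~R != 0 :> rat by rewrite intr_eq0 denq_eq0.
have {}hq : numq q ^+ 2 + denq q ^+ 2 = \tr T * (numq q * denq q).
  apply: (@intr_inj rat); rewrite intrD !intrM.
  have -> : (numq q)%:~R = q * (denq q)%:~R :> rat.
    by rewrite -{2}[q]divq_num_den mulfVK.
  have := congr1 (fun z => z * (denq q)%:~R ^+ 2) hq; rewrite mul0r; lra.
have cop := coprime_num_den q.
have d1 : (denq q %| numq q * numq q)%Z.
  have -> : numq q * numq q = (\tr T * numq q - denq q) * denq q by nia.
  exact: dvdz_mull.
have n1 : (numq q %| denq q * denq q)%Z.
  have -> : denq q * denq q = (\tr T * denq q - numq q) * numq q by nia.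
  exact: dvdz_mull.
have ed : `|denq q|%N = 1%N.
  move: d1; rewrite dvdzE abszM Gauss_dvdr; last by rewrite coprime_sym.
  by move=> d1; move: cop; rewrite /coprime => /eqP; rewrite (gcdn_idPr _).
have en : `|numq q|%N = 1%N.
  move: n1; rewrite dvdzE abszM Gauss_dvdr // => n1.
  by move: cop; rewrite /coprime => /eqP; rewrite (gcdn_idPl _).
have := trT; have := denq_gt0 q; move: hq ed en.
move: (denq q) (numq q) => x y hq ed en x0 t3.
have x1 : x = 1 by lia.
have [y1|y1] : y = 1 \/ y = -1 by lia.
  by move: hq; rewrite x1 y1; lia.
by move: hq; rewrite x1 y1; lia.
Qed.

Lemma lam_rootP l : l ^+ 2 - tau * l + 1 = 0 <-> exists e, l = lam e.
Proof.
split=> [h|[e ->]]; last exact: lam_root.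
have /eqP : (l - lam true) * (l - lam false) = 0.
  by have := lamM true; have := lamD true => /= h1 h2; rewrite -h -h1; lra.
by rewrite mulf_eq0 !subr_eq0 => /orP[] /eqP ->; [exists true|exists false].
Qed.

Lemma eigenvalue_lam l : eigenvalue (map_mx intr T : 'M[R]_2) l <->
  exists e, l = lam e.
Proof.
rewrite -lam_rootP; split=> [/eigenvalueP[v vT v0]|h].
  have e0 := congr1 (fun M : 'rV[R]_2 => M 0 0) vT.
  have e1 := congr1 (fun M : 'rV[R]_2 => M 0 1) vT.
  move: e0 e1; rewrite !mxE !sum2 !mxE -/ta -/tb -/tc -/td => e0 e1.
  have v00 : v 0 0 != 0.
    apply: contra v0 => /eqP v00; move: e0; rewrite v00 mul0r add0r mulr0 => /eqP.
    rewrite mulf_eq0 (negbTE tc_neq0) orbF => /eqP v01.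
    by apply/eqP/matrixP => i j; rewrite (ord1 i) mxE; case: (ord2P j) => ->.
  apply: (mulfI v00); rewrite mulr0 tauE -detE.
  have := congr1 (fun z => (l - td) * z) e0; have := congr1 (fun z => tc * z) e1; lra.
apply/eigenvalueP; exists (\row_j if j == 0 then tc else l - ta).
  apply/matrixP => i j; rewrite (ord1 i) !mxE !sum2 !mxE /=.
  case: (ord2P j) => -> /=; rewrite -/ta -/tb -/tc -/td; first by lra.
  by move: h; rewrite tauE -detE; lra.
apply/eqP => /(congr1 (fun M : 'rV[R]_2 => M 0 0)); rewrite !mxE /= => /eqP.
by rewrite (negbTE tc_neq0).
Qed.

Definition sgn s : R := if s then 1 else -1.

Lemma sgn_neg s : sgn (~~ s) = - sgn s.
Proof. by case: s; rewrite /sgn ?opprK. Qed.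

Lemma sgn_neq0 s : sgn s != 0.
Proof. by case: s; rewrite /sgn ?oppr_eq0 oner_eq0. Qed.

(** The direction of an eigenvector of [T] for the eigenvalue inverse to
    [lam e]: the linear form vanishing on it is an eigenvector, for [lam e], of
    the transpose of [T]. *)
Definition eigvec e s : 'cV[R]_2 := sgn s *: col2 (ta - lam e) tc.

(** The linear form, with [psi (T v) = lam psi v], whose sign is given by the
    side of the line directed by [eigvec]. The lock keeps unification from
    unfolding it into coordinates. *)
Definition psi e s v : R := locked (hp (eigvec e s) v).

Lemma psiP e s v : psi e s v = hp (eigvec e s) v.
Proof. by rewrite /psi -lock. Qed.

Lemma psiE e s v : psi e s v = sgn s * (tc * zx R v + (lam e - ta) * zy R v).
Proof. by rewrite psiP hpZ /hp col2_0 col2_1; lra. Qed.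

Lemma eigvec_neg e s : eigvec e (~~ s) = - eigvec e s.
Proof. by rewrite /eigvec sgn_neg scaleNr. Qed.

Lemma psi_neg e s v : psi e (~~ s) v = - psi e s v.
Proof. by rewrite !psiE sgn_neg mulNr. Qed.

Lemma eigvec_neq0 e s : eigvec e s != 0.
Proof.
rewrite scaler_eq0 (negbTE (sgn_neq0 s)) /=; apply/eqP => /(congr1 (fun M : 'cV[R]_2 => M 1 0)).
by rewrite col2_1 mxE; apply/eqP/tc_neq0.
Qed.

Lemma psiM e s v w : psi e s (v * w)%g = psi e s v + psi e s w.
Proof. by rewrite !psiP hpM. Qed.
Lemma psi1 e s : psi e s 1%g = 0.
Proof. by rewrite !psiP hp1. Qed.
Lemma psiV e s v : psi e s v^-1%g = - psi e s v.
Proof. by rewrite !psiP hpV. Qed.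

Lemma psiX e s v n : psi e s (v ^+ n)%g = n%:R * psi e s v.
Proof. by rewrite !psiP hpX. Qed.

Lemma zx_T v : zx R (T *m v : 'cV[int]_2) = ta * zx R v + tb * zy R v.
Proof. by rewrite /zx mul2col intrD !intrM. Qed.
Lemma zy_T v : zy R (T *m v : 'cV[int]_2) = tc * zx R v + td * zy R v.
Proof. by rewrite /zy mul2col intrD !intrM. Qed.

Lemma psi_T e s v : psi e s (T *m v : 'cV[int]_2) = lam e * psi e s v.
Proof.
rewrite !psiE zx_T zy_T mulrCA; congr (_ * _).
have := lam_root e; rewrite tauE -detE => h.
have := congr1 (fun z => z * zy R v) h; rewrite mul0r; lra.
Qed.

Lemma psi_Tz e s (n : int) v : psi e s (T ^ n *m v : 'cV[int]_2) = lam e ^ n * psi e s v.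
Proof.
have P (m : nat) w : psi e s (T ^+ m *m w : 'cV[int]_2) = lam e ^+ m * psi e s w.
  elim: m => [|m IH]; first by rewrite !expr0 mul1mx mul1r.
  by rewrite !exprS -mulmxA psi_T IH mulrA.
case: n => m; first exact: P.
rewrite NegzE -!exprz_inv; set n := m.+1.
have ln : lam e ^+ n != 0 by rewrite expf_neq0 ?lam_neq0.
apply: (mulfI ln); rewrite -!exprnP (exprVn (lam e)) mulrA mulfV// mul1r -P.
congr psi; rewrite mulmxA -[_ *m (T^-1 ^+ n)]/(T ^+ n * T^-1 ^+ n) exprVn mulrV ?mul1mx//.
by rewrite unitrX// (sol_unit detT).
Qed.

(** A nonzero lattice point on the eigenline would make its slope, and hence the
    eigenvalue, rational. *)
Lemma psi_eq0 e s v : psi e s v = 0 -> v = 1%g.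
Proof.
rewrite psiE => /eqP; rewrite mulf_eq0 (negbTE (sgn_neq0 s)) /= => /eqP h.
have y0 : zy R v = 0.
  apply/eqP; apply: contraT => y0; case: (@lam_irrational e).
  exists ((T 0 0)%:~R - (T 1 0)%:~R * ((v : 'cV[int]_2) 0 0)%:~R / ((v : 'cV[int]_2) 1 0)%:~R) => //.
  rewrite rmorphB !rmorphM fmorphV !rmorph_int -/(zx R v) -/(zy R v) -/ta -/tc.
  apply: (mulIf y0); rewrite mulrBl mulfVK//; lra.
apply: (@Z2_eq R); rewrite ?zx1 ?zy1// ; move: h; rewrite y0 mulr0 addr0 => /eqP.
by rewrite mulf_eq0 (negbTE tc_neq0) => /eqP.
Qed.

Lemma psi_inj e s v w : psi e s v = psi e s w -> v = w.
Proof.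
move=> h; apply: divg1_eq; apply: (@psi_eq0 e s).
by rewrite psiM psiV h subrr.
Qed.

Lemma eigvec_T e s : map_mx intr T *m eigvec e s = lam (~~ e) *: eigvec e s.
Proof.
rewrite /eigvec -scalemxAr scalerA (mulrC (lam _)) -scalerA; congr (_ *: _).
have <- := lamV e; have l0 := lam_neq0 e; have hr := lam_root e.
rewrite lamV; have := lamD e; rewrite tauE => hD.
have {}hD : lam (~~ e) = ta + td - lam e by lra.
rewrite tauE -detE in hr; rewrite hD.
by apply: col2_eq; rewrite mul2col !mxE /= -/ta -/tb -/tc -/td; lra.
Qed.

Lemma eigvecP l (d : 'cV[R]_2) : d != 0 -> map_mx intr T *m d = l *: d ->
  exists e s c, [/\ 0 < c, l = lam (~~ e) & d = c *: eigvec e s].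
Proof.
move=> d0 h.
have e0 := congr1 (fun M : 'cV[R]_2 => M 0 0) h.
have e1 := congr1 (fun M : 'cV[R]_2 => M 1 0) h.
move: e0 e1; rewrite !mul2col !mxE -/ta -/tb -/tc -/td => e0 e1.
have d1 : d 1 0 != 0.
  apply: contra d0 => /eqP d1; move: e1; rewrite d1 !mulr0 addr0 => /eqP.
  by rewrite mulf_eq0 (negbTE tc_neq0) => /eqP ?; apply/eqP/col2_eq; rewrite mxE.
have : l ^+ 2 - tau * l + 1 = 0.
  apply: (mulfI d1); rewrite mulr0 tauE -detE.
  have := congr1 (fun z => tc * z) e0; have := congr1 (fun z => (l - ta) * z) e1; lra.
move=> /lam_rootP[e' le]; exists (~~ e'), (0 < d 1 0 / tc).
have c0 : 0 < `|d 1 0 / tc| by rewrite normr_gt0 mulf_neq0 ?invr_eq0 ?tc_neq0.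
exists `|d 1 0 / tc|; split=> //; first by rewrite negbK.
rewrite /eigvec scalerA.
have -> : `|d 1 0 / tc| * sgn (0 < d 1 0 / tc) = d 1 0 / tc.
  have [p|n] := ltP 0 (d 1 0 / tc); first by rewrite gtr0_norm ?mulr1.
  by rewrite ler0_norm// mulrN1 opprK.
apply: col2_eq; rewrite mxE ?col2_0 ?col2_1; last by rewrite mulfVK ?tc_neq0.
apply: (mulfI tc_neq0); rewrite [RHS]mulrA [tc * (_ / _)]mulrC mulfVK ?tc_neq0//.
have hD := lamD (~~ e'); rewrite negbK -le tauE in hD.
have {}hD : lam (~~ e') = ta + td - l by lra.
by rewrite hD; lra.
Qed.

Lemma psi_pos_ex e s : exists v, 0 < psi e s v.
Proof.
pose v : Z2 := col2 1 0.
have [p|n|/esym/psi_eq0/(congr1 (zx R))] := ltgtP 0 (psi e s v); first by exists v.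
  by exists v^-1%g; rewrite psiV oppr_gt0.
by rewrite zx1 col2Z_zx => /eqP; rewrite oner_eq0.
Qed.

(** The four eigendirections are told apart by lattice points. *)
Lemma eigvec_sep e s e' s' : (e, s) != (e', s') ->
  exists v, 0 < psi e s v /\ psi e' s' v < 0.
Proof.
move=> ne; have [ee|ee] := eqVneq e e'.
  have ss : s' = ~~ s by move: ne; rewrite ee xpair_eqE eqxx /=; case: s s' => -[].
  have [v v0] := psi_pos_ex e s; exists v.
  by rewrite -ee ss psi_neg oppr_lt0.
suff [v] : exists v, 0 < hp (eigvec e s) v /\ hp (eigvec e' s') v < 0.
  by rewrite -!psiP; exists v.
apply: separating_vector.
have -> : det2 (eigvec e s) (eigvec e' s') = sgn s * sgn s' * tc * (lam e' - lam e).
  by rewrite /det2 !mxE /=; lra.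
rewrite !mulf_neq0 ?sgn_neq0 ?tc_neq0// subr_eq0.
have -> : e' = ~~ e by move: ee; clear; case: e e' => -[].
exact: lam_neq.
Qed.

End Eigen.

(** * The group SOL *)

Section SolGroup.
Variables (R : realType) (T : 'M[int]_2) (detT : \det T = 1) (trT : 2 < \tr T).
Implicit Types (v w : 'cV[int]_2) (e s : bool) (g h : SOL detT).

Local Notation psi := (@psi R T).
Local Notation lam := (@lam R T).
Local Notation iota := (sol_iota detT).
Local Notation t := (sol_t detT).

Lemma psiD e s v w : psi e s (v + w) = psi e s v + psi e s w.
Proof. exact: psiM. Qed.
Lemma psiN e s v : psi e s (- v) = - psi e s v.
Proof. exact: psiV. Qed.
Lemma psi0 e s : psi e s (0 : 'cV[int]_2) = 0.
Proof. exact: psi1. Qed.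
Lemma psiMz e s (k : int) v : psi e s (k *: v) = k%:~R * psi e s v.
Proof. by rewrite !psiE /zx /zy !mxE !intrM; lra. Qed.
(** Identities between lattice points are checked on this form, which is
    injective and turns [T] into a scalar. *)
Lemma psi_injv v w : psi true true v = psi true true w -> v = w.
Proof. exact: psi_inj. Qed.

Lemma sol1_1 : (1%g : SOL detT).1 = 0. Proof. by []. Qed.
Lemma sol1_2 : (1%g : SOL detT).2 = 0. Proof. by []. Qed.
Lemma solM_1 g h : (g * h)%g.1 = g.1 + T ^ g.2 *m h.1. Proof. by []. Qed.
Lemma solM_2 g h : (g * h)%g.2 = g.2 + h.2. Proof. by []. Qed.
Lemma solV_1 g : (g^-1)%g.1 = - (T ^ (- g.2) *m g.1). Proof. by []. Qed.
Lemma solV_2 g : (g^-1)%g.2 = - g.2. Proof. by []. Qed.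
Lemma solX_2 g n : (g ^+ n)%g.2 = g.2 * n%:Z.
Proof. by elim: n => [|n IH]; rewrite ?expg0 ?mulr0// expgS solM_2 IH; clear; lia. Qed.
Lemma sol_eq g h : g.1 = h.1 -> g.2 = h.2 -> g = h.
Proof. by case: g h => [? ?] [? ?] /= -> ->. Qed.

Lemma sol_iota_inj : injective iota.
Proof. by move=> v w /(congr1 fst). Qed.

Lemma sol_iotaM (v w : Z2) : iota (v * w)%g = (iota v * iota w)%g.
Proof. by apply: sol_eq; rewrite ?solM_1 ?solM_2 //= expr0z mul1mx. Qed.

Lemma sol_iotaV (v : Z2) : iota v^-1%g = (iota v)^-1%g.
Proof. by apply: (mulgI (iota v)); rewrite -sol_iotaM !mulgV. Qed.

Lemma sol_iotaX (v : Z2) n : iota (v ^+ n)%g = (iota v ^+ n)%g.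
Proof. by elim: n => [//|n IH]; rewrite !expgS sol_iotaM IH. Qed.

Lemma sol_HP g : sol_H detT g <-> g.2 = 0.
Proof.
split=> [[v _ <-]//|g0]; exists g.1 => //; exact: sol_eq.
Qed.

Lemma sol_H_group : group_closed [in sol_H detT].
Proof.
apply/group_closedP; split; first exact/sol_HP.
by move=> x y /sol_HP hx /sol_HP hy; apply/sol_HP; rewrite solM_2 solV_2 hx hy.
Qed.

Lemma sol_decomp g : g = (iota g.1 * (0, g.2))%g.
Proof. by apply: sol_eq; rewrite ?solM_1 ?solM_2 /= ?mulmx0 ?addr0 ?add0r. Qed.

Lemma sol_tX (n : nat) : (t ^+ n)%g = (0, n%:Z).
Proof.
elim: n => [//|n IH]; rewrite expgS IH; apply: sol_eq.
  by rewrite solM_1 /= mulmx0 addr0.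
by rewrite solM_2 /=; clear; lia.
Qed.

Lemma sol_tXN (n : nat) : (t ^- n)%g = (0, - n%:Z).
Proof.
by rewrite sol_tX; apply: sol_eq; rewrite ?solV_1 ?solV_2//= mulmx0 oppr0.
Qed.

Lemma sol_conj_t (v : Z2) : (t * iota v * t^-1)%g = iota (T *m v : 'cV[int]_2).
Proof.
apply: sol_eq; rewrite ?solM_1 ?solM_2 ?solV_1 ?solV_2 //=.
by rewrite mulmx0 oppr0 mulmx0 addr0 add0r expr1z.
Qed.

Lemma sol_conjH g (v : Z2) : (g * iota v)%g = (iota (T ^ g.2 *m v : 'cV[int]_2) * g)%g.
Proof.
apply: sol_eq; rewrite ?solM_1 ?solM_2 /=; last by rewrite addrC.
by rewrite expr0z mul1mx addrC.
Qed.

Lemma sol_H_normal g h : sol_H detT g -> sol_H detT (g ^ h)%g.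
Proof. by rewrite !sol_HP conjgE !solM_2 solV_2; clear; lia. Qed.

Definition dvec (v : Z2) : 'cV[int]_2 := T *m v - v.

Lemma psi_dvec e s (v : Z2) : psi e s (dvec v) = (lam e - 1) * psi e s v.
Proof. by rewrite psiD psiN psi_T// mulrBl mul1r. Qed.

(** The matrix [T - 1] divides [T ^ k - 1]. *)
Lemma dvec_pow (k : int) (v : Z2) : exists z : Z2, (T ^ k *m v : 'cV[int]_2) - v = dvec z.
Proof.
have P (m : nat) (w : Z2) : exists z : Z2, (T ^ m *m w : 'cV[int]_2) - w = dvec z.
  elim: m => [|m [z zE]]; first by exists 0; rewrite expr0z mul1mx subrr /dvec mulmx0 subrr.
  exists (z + (T ^ m *m w : 'cV[int]_2)); apply: psi_injv; move/(congr1 (psi true true)): zE.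
  by rewrite !psi_dvec// !psiD !psiN !psi_Tz// -!exprnP exprS => h; lra.
case: k => m; first exact: P.
have [z zE] := P m.+1 (T ^ (Negz m) *m v : 'cV[int]_2); exists (- z).
apply: psi_injv; move/(congr1 (psi true true)): zE.
rewrite !psi_dvec// !psiD !psiN !psi_Tz// mulrA -expfzDr ?lam_neq0// NegzE subrr expr0z.
by move=> h; rewrite mulrN -h; lra.
Qed.

Definition derived_emb (v : Z2) : SOL detT := iota (dvec v).

(** Commutators lie in the image of [T - 1] because all powers of [T] are congruent
    to [1] modulo [T - 1]; conversely [T v - v] is the commutator of [t^-1] and
    [- v]. *)
Lemma derived_emb_range : range derived_emb = derived_subgroup (SOL detT).
Proof.
apply/seteqP; split=> [_ [v _ <-] K [gK cK]|g].
  have -> : derived_emb v = [~ t^-1, iota (- v : 'cV[int]_2)]%g.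
    rewrite commgEl conjgE invgK; apply: sol_eq; last by [].
    apply: psi_injv; rewrite ?solM_1 ?solM_2 ?solV_1 ?solV_2 /derived_emb /dvec /=.
    rewrite !(mulmx0, oppr0, addr0, add0r, mulmxN, opprK, expr0z, mul1mx).
    rewrite !(psiD, psiN, mulmxDr, mulmxN, psi_T, psi_Tz)// ?mulmxA.
    by rewrite expr1z mulrBr exprN1 mulrA mulfV ?lam_neq0// mul1r.
  exact: cK.
apply; split.
  apply/group_closedP; split.
    by exists 0 => //; rewrite /derived_emb /dvec mulmx0 subrr; apply: sol_eq.
  move=> _ _ [v _ <-] [w _ <-]; exists (v - w : 'cV[int]_2) => //.
  rewrite /derived_emb -sol_iotaV -sol_iotaM; congr iota.
  by apply: psi_injv; rewrite psiM psiV !psi_dvec// psiD psiN; lra.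
move=> x y; rewrite commgEl conjgE.
pose k := - y.2 - x.2.
have [z1 z1E] := dvec_pow (- y.2) (T ^ (- x.2) *m x.1 : 'cV[int]_2).
have [z2 z2E] := dvec_pow (- x.2) (T ^ (- y.2) *m y.1 : 'cV[int]_2).
exists (z1 - z2 : 'cV[int]_2) => //; apply: sol_eq; last first.
  by rewrite !solM_2 !solV_2 /=; lia.
apply: psi_injv; rewrite -[(derived_emb _).1]/(dvec _) psi_dvec// psiD psiN mulrBr -!psi_dvec// -z1E -z2E.
rewrite !solM_1 !solV_2 !solV_1.
rewrite !(mulmxDr, mulmxN) !(psiD, psiN, psi_Tz)//.
have AC : lam true ^ (- x.2) * lam true ^ x.2 = 1.
  by rewrite -expfzDr ?lam_neq0// addNr expr0z.
by have /= := congr1 (fun z => z * (lam true ^ (- y.2) * psi true true y.1)) AC; lra.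
Qed.

(** By the Cayley-Hamilton theorem [(T - 1) (T + 1 - tr T) = tr T - 2]. *)
Lemma dvec_surj_mul (v : Z2) :
  dvec (T *m v + v - (\tr T *: (v : 'cV[int]_2))) = (\tr T - 2) *: (v : 'cV[int]_2).
Proof.
apply: psi_injv; rewrite psi_dvec// !(psiD, psiN) psi_T// !psiMz rmorphB /=.
have := @lam_root R T detT trT true; rewrite /tau => h.
have := congr1 (fun z => z * psi true true v) h; rewrite mul0r; lra.
Qed.

Lemma sol_derived_facts :
  [/\ exists j : Z2 -> SOL detT,
        [/\ injective j, forall v w : Z2, j (v * w)%g = (j v * j w)%g,
            range j = derived_subgroup (SOL detT) &
            forall v : Z2, (t * j v * t^-1)%g = j (T *m v : 'cV[int]_2)],
      sol_H detT
        = [set g | exists n, (0 < n)%N /\ derived_subgroup (SOL detT) (g ^+ n)%g] &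
      sol_H detT = derived_subgroup (SOL detT) <-> \tr T = 3].
Proof.
split.
- exists derived_emb; split.
  + move=> v w /sol_iota_inj /(congr1 (psi true true)); rewrite !psi_dvec//.
    by move/(mulfI _) => h; apply: psi_injv; apply: h; rewrite subr_eq0 gt_eqF// lam_true_gt1.
  + move=> v w; rewrite /derived_emb -sol_iotaM; congr iota.
    by apply: psi_injv; rewrite psiM !psi_dvec// psiM; lra.
  + exact: derived_emb_range.
  + move=> v; rewrite /derived_emb sol_conj_t; congr iota.
    by apply: psi_injv; rewrite psi_T// !psi_dvec// psi_T//; lra.
- apply/seteqP; split=> [g /sol_HP g0|g [n [n0]]].
    exists `|\tr T - 2|%N; split; first by lia.
    rewrite -derived_emb_range.
    exists (T *m g.1 + g.1 - (\tr T *: (g.1 : 'cV[int]_2))) => //.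
    rewrite /derived_emb dvec_surj_mul.
    have -> : g = iota g.1 by apply: sol_eq.
    rewrite -sol_iotaX; congr iota; apply: psi_injv.
    by rewrite psiMz psiX natr_absz ger0_norm//; lia.
  rewrite -derived_emb_range => -[z _ /(congr1 snd)] /=; rewrite solX_2 sol_HP; nia.
- split=> [e|t3].
    have ex j : exists z : Z2, dvec z = (col j (1%:M : 'M[int]_2)).
      have : sol_H detT (iota (col j (1%:M : 'M[int]_2))) by apply/sol_HP.
      by rewrite e -derived_emb_range => -[z _ /sol_iota_inj]; exists z.
    have [Z ZE] := choice ex.
    have : (T - 1%:M) *m (\matrix_(i, j) (Z j : 'cV[int]_2) i 0) = 1%:M.
      apply/matrixP => i j; have := congr1 (fun M : 'cV[int]_2 => M i 0) (ZE j).
      rewrite [RHS]mxE => <-; rewrite mulmxBl mul1mx !mxE; congr (_ - _).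
      by apply: eq_bigr => k _; rewrite mxE.
    move/(congr1 determinant); rewrite det_mulmx det1.
    move: (\det (\matrix_(i, j) _)) => x; rewrite det22 !mxE /=.
    have := detT; have := trT; rewrite det22 /mxtrace sum2.
    move: (T 0 0) (T 0 1) (T 1 0) (T 1 1) => a b c d t2 h1; rewrite !subr0 => h2.
    have h3 : (a - 1) * (d - 1) - b * c = 2 - (a + d) by lia.
    have := congr1 absz h2; rewrite h3 abszM => /eqP; rewrite muln_eq1 => /andP[/eqP].
    by move: t2; lia.
  rewrite -derived_emb_range; apply/seteqP; split=> [g /sol_HP g0|_ [z _ <-]]; last exact/sol_HP.
  exists (T *m g.1 + g.1 - (\tr T *: (g.1 : 'cV[int]_2))) => //.
  rewrite /derived_emb dvec_surj_mul t3; apply: sol_eq => //=.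
  by rewrite -[3 - 2]/(1 : int) scale1r.
Qed.

End SolGroup.

(** * Affine actions *)

Lemma additive_int (R : realType) (f : int -> R) :
  (forall m n, f (m + n) = f m + f n) -> forall n, f n = f 1 * n%:~R.
Proof.
move=> fD; have f0 : f 0 = 0 by have := fD 0 0; rewrite addr0; lra.
have fnat (n : nat) : f n%:Z = f 1 * n%:R.
  elim: n => [|n IH]; first by rewrite mulr0.
  by rewrite -addn1 PoszD fD IH natrD; lra.
case=> n; first exact: fnat.
by have := fD n.+1%:Z (- n.+1%:Z); rewrite NegzE subrr f0 rmorphN /= fnat; lra.
Qed.

Lemma additive_Z2 (R : realType) (f : Z2 -> R) :
  (forall v w, f (v * w)%g = f v + f w) ->
  forall v, f v = f (col2 1 0 : 'cV[int]_2) * zx R v + f (col2 0 1 : 'cV[int]_2) * zy R v.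
Proof.
move=> fM v; pose v0 := (v : 'cV[int]_2) 0 0; pose v1 := (v : 'cV[int]_2) 1 0.
pose z a b : Z2 := (col2 a b : 'cV[int]_2).
have {1}-> : v = (z v0 0 * z 0 v1)%g.
  by apply: (@Z2_eq R); rewrite ?zxM ?zyM !(col2Z_zx, col2Z_zy) ?addr0 ?add0r.
rewrite fM; congr (_ + _).
  rewrite -(@additive_int _ (fun k => f (z k 0)) _ v0)// => m n.
  rewrite -fM; congr f.
  by apply: (@Z2_eq R); rewrite ?zxM ?zyM !(col2Z_zx, col2Z_zy) ?addr0 ?intrD.
rewrite -(@additive_int _ (fun k => f (z 0 k)) _ v1)// => m n.
rewrite -fM; congr f.
by apply: (@Z2_eq R); rewrite ?zxM ?zyM !(col2Z_zx, col2Z_zy) ?addr0 ?intrD.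
Qed.

Section SolActions.
Variables (R : realType) (T : 'M[int]_2) (detT : \det T = 1) (trT : 2 < \tr T).
Implicit Types (v w : Z2) (e s b : bool) (g h : SOL detT).

Local Notation psi := (@psi R T).
Local Notation lam := (@lam R T).
Local Notation iota := (sol_iota detT).
Local Notation t := (sol_t detT).

Definition act e s g (x : R) : R := lam e ^ g.2 * x + psi e s g.1.

Lemma actE e s g x : act e s g x = lam e ^ g.2 * x + psi e s g.1.
Proof. by []. Qed.

Lemma act1 e s x : act e s 1%g x = x.
Proof. by rewrite /act sol1_1 sol1_2 expr0z mul1r psi0 addr0. Qed.

Lemma actM e s g h x : act e s (g * h)%g x = act e s g (act e s h x).
Proof.
rewrite /act solM_1 solM_2 expfzDr ?lam_neq0// psiD psi_Tz//; lra.
Qed.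

Lemma lamz_gt0 e (n : int) : 0 < lam e ^ n.
Proof. by rewrite exprz_gt0// lam_gt0. Qed.

Lemma act_mono e s g x y : (act e s g x < act e s g y) = (x < y).
Proof. by rewrite /act ltrD2r ltr_pM2l// lamz_gt0. Qed.

Lemma act_neg e s g x : act e (~~ s) g x = - act e s g (- x).
Proof. by rewrite /act psi_neg; lra. Qed.

Lemma act_iota e s v x : act e s (iota v) x = x + psi e s v.
Proof. by rewrite /act /= expr0z mul1r. Qed.

Lemma act_tz e s (n : int) x : act e s ((0, n) : SOL detT) x = lam e ^ n * x.
Proof. by rewrite /act /= psi0 addr0. Qed.

Lemma lamz_eq1 e (n : int) : lam e ^ n = 1 -> n = 0.
Proof.
have P (m : nat) : lam e ^+ m.+1 != 1.
  apply/eqP => /eqP; rewrite pexpr_eq1 ?ltW ?lam_gt0// => /eqP h.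
  by case: e h => h; [have := lam_true_gt1 R detT trT|have := lam_false_lt1 R detT trT]; rewrite h ltxx.
case: n => [[//|m]|m]; first by move=> h; have := P m; rewrite exprnP h eqxx.
rewrite NegzE => h; have := P m; rewrite exprnP.
have : lam e ^ m.+1 * lam e ^ (- m.+1%:Z) = 1.
  by rewrite -expfzDr ?lam_neq0// subrr expr0z.
by rewrite h mulr1 => ->; rewrite eqxx.
Qed.

Lemma lamz_neq1 e (n : int) : n != 0 -> lam e ^ n != 1.
Proof. by apply: contraNneq => /lamz_eq1 ->. Qed.

Lemma act_affine e s : affine_action (act e s) (lam e).
Proof.
split.
- by split; [exact: act1|exact: actM].
- by move=> g; exists (lam e ^ g.2), (psi e s g.1); split=> //; exact: lamz_gt0.
- move=> g h; have h0 := h 0; have h1 := h 1; move: h0 h1.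
  rewrite /act mulr0 add0r => h0; rewrite h0 addr0 mulr1 => /lamz_eq1 g2.
  by apply: sol_eq => //; apply: psi_eq0 h0.
- by apply/eigenvalue_lam => //; exists e.
- by move=> x; rewrite act_tz expr1z.
Qed.

(** The linear part [U] of an action is a homomorphism to the positive reals. It
    is trivial on the image of [T - 1], which contains a nonzero multiple of every
    lattice point, hence on H; so H acts by translations, whose lengths define an
    eigenform, and the action is one of the [act e s] up to a homothety. *)
Lemma affine_normal (a : SOL detT -> R -> R) l : affine_action a l ->
  exists e s c, [/\ 0 < c, l = lam e & forall g x, a g (c * x) = c * act e s g x].
Proof.
move=> [[a1 aM] aff faith eig at_].
have [e le] := (eigenvalue_lam detT trT l).1 eig.
have l0 : l != 0 by rewrite le lam_neq0.
pose U g := a g 1 - a g 0; pose V g := a g 0.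
have aE g x : a g x = U g * x + V g.
  by have [u [v [_ h]]] := aff g; rewrite /U /V !h; lra.
have U0 g : 0 < U g by have [u [v [u0 h]]] := aff g; rewrite /U !h; lra.
have UM g h : U (g * h)%g = U g * U h.
  by rewrite {1}/U !aM !(aE g) (aE h 1) (aE h 0); lra.
have U1 : U 1%g = 1 by rewrite /U !a1 subr0.
have UV g : U g * U g^-1%g = 1 by rewrite -UM mulgV.
have UT v : U (iota (T *m v : 'cV[int]_2)) = U (iota v).
  by rewrite -sol_conj_t !UM mulrAC UV mul1r.
have UX v n : U (iota v ^+ n)%g = U (iota v) ^+ n.
  by elim: n => [|n IH]; rewrite ?expg0 ?U1// expgS UM IH exprS.
have Udvec v : U (iota (dvec T v)) = 1.
  rewrite -[dvec T v]/((T *m (v : 'cV[int]_2) : Z2) * v^-1)%g sol_iotaM UM UT.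
  by rewrite sol_iotaV UV.
have Uiota v : U (iota v) = 1.
  have n0 : (0 < `|\tr T - 2|)%N by lia.
  apply/eqP; rewrite -(pexpr_eq1 n0) ?ltW// -UX -sol_iotaX.
  have -> : (v ^+ `|(\tr T - 2)%R|)%g = dvec T (T *m v + v - (\tr T *: (v : 'cV[int]_2))).
    rewrite (dvec_surj_mul R detT trT); apply: (@psi_inj R T detT trT true true).
    by rewrite psiMz// psiX natr_absz ger0_norm//; lia.
  by rewrite Udvec.
have aiota v x : a (iota v) x = x + V (iota v) by rewrite aE Uiota mul1r.
pose f v := V (iota v).
have fM v w : f (v * w)%g = f v + f w.
  by rewrite /f {1}/V sol_iotaM aM aiota addrC.
have atV x : a t^-1%g (l * x) = x by rewrite -at_ -aM mulVg a1.
have at0 : a t^-1%g 0 = 0 by rewrite -{1}(mulr0 l) atV.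
have fT v : f (T *m v : 'cV[int]_2) = l * f v.
  by rewrite /f -sol_conj_t {1}/V !aM at0 at_ aiota add0r.
have az (n : int) x : a ((0, n) : SOL detT) x = l ^ n * x.
  have P (m : nat) y : a (t ^+ m)%g y = l ^+ m * y.
    elim: m y => [|m IH] y; first by rewrite expg0 a1 mul1r.
    by rewrite expgS aM IH at_ exprS mulrA.
  case: n => m; first by rewrite -P sol_tX.
  rewrite NegzE -exprnN; apply: (mulfI (expf_neq0 m.+1 l0)).
  rewrite mulrA mulfV ?expf_neq0// mul1r -P.
  by rewrite -(sol_tXN detT m.+1) -[RHS]a1 -(mulgV (t ^+ m.+1)%g) aM.
have aE2 g x : a g x = l ^ g.2 * x + f g.1.
  by rewrite {1}(sol_decomp g) aM az aiota.
have fL := additive_Z2 fM.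
set p := f _ in fL; set q := f _ in fL.
pose d : 'cV[R]_2 := col2 (- q) p.
have fhp v : f v = hp d v by rewrite fL /hp col2_0 col2_1; lra.
have d0 : d != 0.
  apply/eqP => d0; have fz v : f v = 0 by rewrite fhp d0 /hp !mxE; lra.
  have : iota (col2 1 0 : 'cV[int]_2) = 1%g.
    by apply: faith => x; rewrite aiota -/(f _) fz addr0.
  move/(congr1 (fun g => zx R g.1)); rewrite col2Z_zx zx1 => /eqP.
  by rewrite oner_eq0.
have dT : map_mx intr T *m d = lam (~~ e) *: d.
  have := fT (col2 1 0 : 'cV[int]_2); have := fT (col2 0 1 : 'cV[int]_2).
  rewrite !fhp /hp !zx_T !zy_T !(col2Z_zx, col2Z_zy) /d !col2_0 !col2_1 => h1 h2.
  have hD := lamD R T e; rewrite tauE -le in hD.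
  have {}hD : lam (~~ e) = ta R T + td R T - l by lra.
  by apply: col2_eq; rewrite mul2col [RHS]mxE !col2_0 !col2_1 !mxE -/(ta R T) -/(tb R T) -/(tc R T) -/(td R T) hD; lra.
have [e' [s [c [c0 le' dE]]]] := eigvecP detT trT d0 dT.
have ee : e' = e.
  by move: le'; have := lam_lt R detT trT; case: (e) (e') => -[] //= h he; rewrite he ltxx in h.
exists e, s, c; split=> // g x.
rewrite aE2 fhp dE hpZ -psiP ee le /act; lra.
Qed.

End SolActions.

(** * Orderings for which H is convex *)

Section SolOrders.
Variables (R : realType) (T : 'M[int]_2) (detT : \det T = 1) (trT : 2 < \tr T).
Implicit Types (v w : Z2) (e s b : bool) (f g h : SOL detT) (o : LO (SOL detT)).

Local Notation psi := (@psi R T).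
Local Notation lam := (@lam R T).
Local Notation iota := (sol_iota detT).
Local Notation t := (sol_t detT).

Lemma lam_false_lt_half : lam false < 2^-1.
Proof.
have := lamD R T true; have := lam_true_gt1 R detT trT; have := lam_false_lt1 R detT trT.
have := lam_gt0 R detT trT false.
have := lamM R detT trT true; have := tau_ge3 R detT trT => /= h1 h2 h3 h4 h5 h6.
rewrite ltNge; apply/negP => h7; nra.
Qed.

Lemma lam_false_pow_small (x : R) : 0 < x -> exists n : nat, lam false ^+ n < x.
Proof.
move=> x0; pose n := (Num.truncn x^-1).+1; exists n.
have xn : x^-1 < n%:R by exact: truncnS_gt.
have l2 : lam false ^+ n <= (2^-1) ^+ n.
  rewrite lerXn2r ?nnegrE ?invr_ge0 ?ler0n// ltW ?lam_gt0//.
  exact: lam_false_lt_half.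
apply: le_lt_trans l2 _; rewrite exprVn -[x]invrK ltf_pV2 ?posrE ?invr_gt0 ?exprn_gt0//.
by apply: lt_trans xn _; rewrite -natrX ltr_nat ltn_expl.
Qed.

(** The exponent of [t] that contracts by the factor [lam false]. *)
Definition contr e : int := if e then -1 else 1.

Lemma lam_contr e : lam e ^ contr e = lam false.
Proof. by case: e => //=; rewrite exprN1 lamV. Qed.

(** Iterating the contraction produces arbitrarily small positive values of the
    form, the multiples of which are dense. *)
Lemma psi_dense e s (x y : R) : x < y -> exists v, x < psi e s v /\ psi e s v < y.
Proof.
move=> xy; have [v v0] := psi_pos_ex R detT trT e s.
have [n nP] : exists n : nat, lam false ^+ n < (y - x) / psi e s v.
  by apply: lam_false_pow_small; rewrite divr_gt0// subr_gt0.
pose w : Z2 := T ^ (contr e * n%:Z) *m (v : 'cV[int]_2).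
have wE : psi e s w = lam false ^+ n * psi e s v.
  by rewrite psi_Tz// -exprz_exp lam_contr.
have w0 : 0 < psi e s w by rewrite wE mulr_gt0 ?exprn_gt0 ?lam_gt0.
have wy : psi e s w < y - x by rewrite wE -ltr_pdivlMr.
pose j := Num.floor (x / psi e s w) + 1.
exists (j *: (w : 'cV[int]_2)); rewrite psiMz.
have /andP[h1 h2] := floor_itv (x / psi e s w).
rewrite -ltr_pdivrMr//; split=> //.
rewrite intrD1 mulrDl mul1r.
move: h1; rewrite ler_pdivlMr//; lra.
Qed.

Section Restr.
Variable o : LO (SOL detT).
Let P v : Prop := pos o (iota v).
Let P1 : ~ P 1%g. Proof. by rewrite /P (_ : iota 1%g = 1%g) ?pos1. Qed.
Let PM v w : P v -> P w -> P (v * w)%g.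
Proof. by rewrite /P sol_iotaM; exact: posM. Qed.
Let PV v : v <> 1%g -> P v \/ P v^-1%g.
Proof.
move=> v1; rewrite /P sol_iotaV posV; first by apply/orP; rewrite orbN.
by apply/eqP => h; apply: v1; apply: (@sol_iota_inj _ detT).
Qed.
Definition restr : LO Z2 := coneLO P1 PM PV.
Lemma pos_restr v : pos restr v = pos o (iota v).
Proof. by apply/idP/idP => [/(pos_cone P1 PM PV)|h]; last exact/(pos_cone P1 PM PV). Qed.
End Restr.

Lemma restricts_restr o : restricts o (restr o).
Proof.
move=> v w; rewrite !lo_leE !lo_ltE pos_restr sol_iotaM sol_iotaV.
by rewrite (inj_eq (@sol_iota_inj _ detT)).
Qed.

Lemma restrictsP o (o' : LO Z2) : restricts o o' -> o' = restr o.
Proof.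
move=> h; apply: LO_sub_eq => v; rewrite pos_restr /pos /lo_lt h.
by rewrite -(inj_eq (@sol_iota_inj _ detT)).
Qed.

Section Lex.
Variables (b : bool) (o' : LO Z2).
Let P g : Prop := (g.2 != 0 /\ (0 < g.2) = b) \/ (g.2 = 0 /\ pos o' g.1).
Let P1 : ~ P 1%g. Proof. by rewrite /P sol1_2 eqxx (pos1 o' : pos o' (1%g : SOL detT).1 = false) => -[[]|[]]. Qed.
Let PM f g : P f -> P g -> P (f * g)%g.
Proof.
rewrite /P solM_2 => -[[f0 fb]|[f0 fp]] [[g0 gb]|[g0 gp]].
- by left; split; case: (b) fb gb => h1 h2; move: f0 g0 h1 h2; clear; lia.
- by left; rewrite g0 addr0.
- by left; rewrite f0 add0r.
- right; rewrite f0 g0 addr0; split=> //.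
  rewrite solM_1 f0 expr0z mul1mx.
  exact: (posM fp gp).
Qed.
Let PV g : g <> 1%g -> P g \/ P g^-1%g.
Proof.
move=> g1; rewrite /P solV_2 oppr_eq0 oppr_gt0.
have [g0|g0] := eqVneq g.2 0.
  have v1 : (g.1 : Z2) != 1%g by apply/eqP => h; apply: g1; apply: sol_eq.
  rewrite solV_1 g0 oppr0 expr0z mul1mx -[- g.1]/((g.1 : Z2)^-1)%g posV//.
  by case: (pos o' g.1); [left|right]; right.
have [gp|gn] := ltP 0 g.2.
  case: (b); [by left; left|right; left; split=> //].
  by apply/negbTE; rewrite -leNgt ltW.
have gn' : g.2 < 0 by rewrite lt_neqAle g0.
by case: (b); [right; left|left; left].
Qed.
(** H is convex and the quotient is ordered according to the sign of [t]. *)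
Definition lexLO : LO (SOL detT) := coneLO P1 PM PV.
Lemma pos_lexLO g : pos lexLO g <->
  (g.2 != 0 /\ (0 < g.2) = b) \/ (g.2 = 0 /\ pos o' g.1).
Proof. exact: pos_cone. Qed.
End Lex.

Lemma pos_lexLO_n b (o' : LO Z2) g : g.2 != 0 -> pos (lexLO b o') g = ((0 < g.2) == b).
Proof.
move=> g0; apply/idP/eqP => [/pos_lexLO[[//]|[g0']]|h]; first by rewrite g0' eqxx in g0.
by apply/pos_lexLO; left.
Qed.

Lemma pos_lexLO_t b (o' : LO Z2) : pos (lexLO b o') t = b.
Proof. by rewrite pos_lexLO_n//= ; case: b. Qed.

Lemma pos_lexLO_iota b (o' : LO Z2) v : pos (lexLO b o') (iota v) = pos o' v.
Proof. by apply/idP/idP => [/pos_lexLO[[]|[]//]|h]; rewrite ?eqxx//; apply/pos_lexLO; right. Qed.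

Lemma restr_lexLO b (o' : LO Z2) : restr (lexLO b o') = o'.
Proof. by apply: LO_sub_eq => v; rewrite pos_restr pos_lexLO_iota. Qed.

Lemma lexLO_convex b (o' : LO Z2) : convex_subgroup (lexLO b o') (sol_H detT).
Proof.
split; first exact: sol_H_group.
move=> h1 h2 g /sol_HP h10 /sol_HP h20 h1g gh2; apply/sol_HP.
apply/eqP; apply: contraT => g0.
move: h1g gh2; rewrite !lo_leE => /orP[/eqP h|+] /orP[/eqP h'|].
- by rewrite -h h10 eqxx in g0.
- by rewrite -h h10 eqxx in g0.
- by rewrite h' h20 eqxx in g0.
rewrite !lo_ltE !pos_lexLO_n ?solM_2 ?solV_2 ?h10 ?h20 ?oppr0 ?add0r ?addr0 ?oppr_eq0//.
rewrite oppr_gt0; case: (b); move: g0; clear; lia.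
Qed.

(** If H is convex then the sign of an element outside H depends on its coset
    only, and the quotient by H is generated by [t]. *)
Lemma convex_lex o : convex_subgroup o (sol_H detT) -> o = lexLO (pos o t) (restr o).
Proof.
move=> [_ cvx]; apply: LO_sub_eq => g pg; apply/pos_lexLO.
have [g0|g0] := eqVneq g.2 0.
  right; split=> //; rewrite pos_restr.
  by rewrite (_ : iota _ = g)//; apply: sol_eq.
left; split=> //.
have key f : (0 < f.2) -> pos o f = pos o t.
  move=> f0; pose n := `|f.2|.-1; have fn : f.2 = n.+1%:Z by rewrite /n; move: f0; clear; lia.
  have fE : f = (iota f.1 * t ^+ n.+1)%g by rewrite sol_tX -fn -sol_decomp.
  have tH : ~ sol_H detT (t ^+ n.+1)%g by rewrite sol_HP sol_tX.
  have H1 : sol_H detT 1%g by exact/sol_HP.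
  have Hf : sol_H detT (iota f.1)^-1%g by exact/sol_HP.
  have f1 : f != 1%g by apply/eqP => h; move: fn; rewrite h.
  apply/idP/idP => [pf|pt].
    apply: contraT => nt; exfalso; apply: tH; apply: (cvx (iota f.1)^-1%g 1%g) => //.
      by apply: lo_ltW; rewrite lo_ltE invgK -fE.
    by rewrite lo_leNlt -/(pos _ _) posXE.
  apply: contraT => nf; exfalso; apply: tH; apply: (cvx 1%g (iota f.1)^-1%g) => //.
    by apply: lo_ltW; rewrite -/(pos _ _) posXE.
  by rewrite lo_leNlt lo_ltE invgK -fE.
have [gp|gn] := ltP 0 g.2; first by rewrite -(key g gp) pg.
have gV : 0 < (g^-1%g).2 by rewrite solV_2 oppr_gt0 lt_neqAle g0.
by rewrite -(key _ gV) pos_asym.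
Qed.

(** The inequality holds in the quotient by H unless [f] and [g] both belong to H,
    which is abelian. *)
Lemma convex_conradian o : convex_subgroup o (sol_H detT) -> conradian o.
Proof.
move=> /convex_lex ->; set o' := restr o; set b := pos o t.
move=> f g /pos_lexLO pf /pos_lexLO pg; rewrite lo_ltE; apply/pos_lexLO.
have e2 : (g^-1 * (f * g ^+ 2))%g.2 = f.2 + g.2.
  by rewrite !solM_2 solV_2; clear; lia.
rewrite e2; case: pf pg => [[f0 fb]|[f0 fp]] [[g0 gb]|[g0 gp]].
- by left; split; case: (b) fb gb => h1 h2; move: f0 g0 h1 h2; clear; lia.
- by left; rewrite g0 addr0.
- by left; rewrite f0 add0r.
- right; rewrite f0 g0 addr0; split=> //.
  have -> : (g^-1 * (f * g ^+ 2))%g.1 = ((f.1 : Z2) * g.1)%g.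
    rewrite expg2 !solM_1 solV_1 solV_2 f0 g0 oppr0 !expr0z !mul1mx.
    by rewrite addrCA addKr.
  exact: posM.
Qed.

End SolOrders.

(** * Orderings induced by affine actions *)

Section AffineOrders.
Variables (R : realType) (T : 'M[int]_2) (detT : \det T = 1) (trT : 2 < \tr T).
Implicit Types (v w : Z2) (e s b : bool) (f g h : SOL detT) (o : LO (SOL detT)).

Local Notation psi := (@psi R T).
Local Notation lam := (@lam R T).
Local Notation iota := (sol_iota detT).
Local Notation act := (@act R T detT).

Lemma act_lt_mul2l e s x h f g : act e s f x < act e s g x ->
  act e s (h * f)%g x < act e s (h * g)%g x.
Proof. by rewrite !actM// act_mono. Qed.

Lemma orbit_ltE e s x f g : orbit_lt (act e s) x f g <-> act e s f x < act e s g x.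
Proof.
rewrite /orbit_lt -(act_mono trT e s f x) -actM// mulVKg.
by [].
Qed.

Lemma orbit_lt_fun e s x :
  orbit_lt (act e s) x = (fun f g => act e s f x < act e s g x).
Proof. by apply/funext => f; apply/funext => g; apply/propext; exact: orbit_ltE. Qed.

Lemma stabE e s x : stab (act e s) x = [set g | act e s g x = act e s 1%g x].
Proof. by apply/seteqP; split=> g; rewrite /stab /= act1. Qed.

Lemma act_fix_iota e s x g : act e s g x = x -> g.2 = 0 -> g = 1%g.
Proof.
rewrite actE => + g2; rewrite g2 expr0z mul1r => h.
apply: sol_eq => //; apply: (@psi_eq0 R T detT trT e s); lra.
Qed.

Section AffLO.
Variables (e s : bool) (x : R) (b : bool).

Let sg : R := if b == e then 1 else -1.

Let qM f g : act e s f x = act e s 1%g x -> act e s g x = act e s 1%g x ->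
  sg * (f * g)%g.2%:~R = sg * f.2%:~R + sg * g.2%:~R.
Proof. by move=> _ _; rewrite solM_2 intrD mulrDr. Qed.

Let q0 g : act e s g x = act e s 1%g x -> sg * g.2%:~R = 0 -> g = 1%g.
Proof.
rewrite act1 => gx /eqP; rewrite mulf_eq0 intr_eq0 => /orP[|/eqP]; last exact: act_fix_iota gx.
by rewrite /sg; case: ifP; rewrite ?oppr_eq0 oner_eq0.
Qed.

(** The ordering induced by the point [x] followed by a point on its right if
    [b] holds, and on its left otherwise. An element fixing [x] moves the points on
    the right of [x] further to the right when it expands, which for a positive
    power of [t] means that [e] holds: hence the sign [b == e]. *)
Definition affLO : LO (SOL detT) := tieLO (@act_lt_mul2l e s x) qM q0.

Lemma pos_affLO g : pos affLO g <-> x < act e s g x \/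
  (act e s g x = x /\ 0 < (if b == e then 1 else -1) * (g.2%:~R : R)).
Proof. by have := pos_tieLO (@act_lt_mul2l e s x) qM q0 g; rewrite /= act1. Qed.

Lemma extends_affLO : extends affLO (orbit_lt (act e s) x).
Proof. by move=> f g /orbit_ltE; exact: extends_tieLO. Qed.

End AffLO.

Lemma pos_affLO_iota e s x b v : pos (affLO e s x b) (iota v) = (0 < psi e s v).
Proof.
apply/idP/idP => [/pos_affLO|h]; last by apply/pos_affLO; left; rewrite act_iota ltrDl.
rewrite act_iota ltrDl => -[//|[_]]; by rewrite mulr0 ltxx.
Qed.

Lemma pos_affLO_fix e s x b g : act e s g x = x -> g.2 != 0 ->
  pos (affLO e s x b) g = ((0 < g.2) == (b == e)).
Proof.
move=> gx g0.
have -> : pos (affLO e s x b) g = (0 < (if b == e then 1 else -1) * (g.2%:~R : R)).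
  apply/idP/idP => [/pos_affLO[|[]//]|h]; first by rewrite gx ltxx.
  by apply/pos_affLO; right.
case: (b == e); rewrite ?mul1r ?mulN1r ?oppr_gt0 ?ltr0z ?ltrz0 ?eqb_id// eqbF_neg -leNgt.
by rewrite le_eqVlt (negbTE g0).
Qed.

Lemma stab_cyclic e s x : exists g, stab (act e s) x = cyclic_subgroup g.
Proof.
rewrite stabE; apply: (@cyclic_of_int _ _ (fun g : SOL detT => g.2)).
- exact: (pseudo_stab_group (@act_lt_mul2l e s x)).
- by [].
- by move=> g; rewrite /= act1 => /act_fix_iota.
Qed.

Lemma extends_affLO_eq o e s x : extends o (orbit_lt (act e s) x) ->
  exists b, o = affLO e s x b /\ (stab (act e s) x = [set 1%g] -> b = false).
Proof.
move=> ex; have [g gE] := stab_cyclic e s x.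
have K b : pos o g = pos (affLO e s x b) g -> o = affLO e s x b.
  move=> h; apply: (@extends_cyclic_unique _ _ (fun g => act e s g x) _ _ g _ _ _ h).
  - by rewrite -orbit_lt_fun.
  - by rewrite -orbit_lt_fun; exact: extends_affLO.
  - by rewrite -stabE.
have [g1|g1] := eqVneq g 1%g.
  by exists false; split=> //; apply: K; rewrite g1 !pos1.
have gx : act e s g x = x.
  by have : stab (act e s) x g by rewrite gE; exists 1%N; left; rewrite expg1.
have g0 : g.2 != 0 by apply: contra g1 => /eqP g0; apply/eqP; exact: act_fix_iota gx g0.
exists (((0 < g.2) == pos o g) == e); split.
  by apply: K; rewrite pos_affLO_fix//; case: (pos o g) (0 < g.2) (e) => [] [] [].
by move=> h; move: g1; have : stab (act e s) x g by []; rewrite h /= => ->; rewrite eqxx.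
Qed.

(** The pull back of the form by [T] is nonnegative where the form is positive,
    hence is a multiple of it. *)
Lemma T_invariant_eigen (d : 'cV[R]_2) : d != 0 ->
  (forall v, 0 < hp d v -> 0 <= hp d (T *m v : 'cV[int]_2)) ->
  exists e s c, 0 < c /\ d = c *: eigvec R T e s.
Proof.
move=> d0 h.
pose d' : 'cV[R]_2 := col2 (d 0 0 * td R T - d 1 0 * tb R T) (d 1 0 * ta R T - d 0 0 * tc R T).
have d'E v : hp d' v = hp d (T *m v : 'cV[int]_2).
  by rewrite /hp zx_T zy_T col2_0 col2_1; lra.
have dE := detE R detT.
have d'0 : d' != 0.
  apply: contra d0 => /eqP d'0.
  have := congr1 (fun M : 'cV[R]_2 => M 0 0) d'0; have := congr1 (fun M : 'cV[R]_2 => M 1 0) d'0.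
  rewrite col2_0 col2_1 !mxE => h1 h2; apply/eqP/col2_eq; rewrite mxE -[LHS]mul1r -dE.
    have := congr1 (fun z => ta R T * z) h2; have := congr1 (fun z => tb R T * z) h1; rewrite !mulr0; lra.
  have := congr1 (fun z => tc R T * z) h2; have := congr1 (fun z => td R T * z) h1; rewrite !mulr0; lra.
have [c [c0 cE]] : exists c, 0 < c /\ d' = c *: d.
  by apply: parallel_of_halfplane => // v; rewrite d'E; exact: h.
have h0 := congr1 (fun M : 'cV[R]_2 => M 0 0) cE; have h1 := congr1 (fun M : 'cV[R]_2 => M 1 0) cE.
rewrite col2_0 mxE in h0; rewrite col2_1 mxE in h1.
have dT : map_mx intr T *m d = (tau R T - c) *: d.
  apply: col2_eq; rewrite mul2col [RHS]mxE !mxE -/(ta R T) -/(tb R T) -/(tc R T) -/(td R T) tauE; lra.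
have [e [s [k [k0 _ dk]]]] := eigvecP detT trT d0 dT.
by exists e, s, k.
Qed.

(** Two contractions [f] and [g] of ratio [mu < 1 / 2] that move [x] to the right
    can satisfy [f (g (g x)) < g x]: the translation part of [f] is chosen
    between [x - mu x], so that [x < f x], and [g x - mu (g (g x))]. *)
Lemma affLO_not_conradian e s x b : ~ conradian (affLO e s x b).
Proof.
set mu := lam false; have mu0 : 0 < mu := lam_gt0 R detT trT false.
have mu2 : mu < 2^-1 := lam_false_lt_half R detT trT.
move=> con.
have [v [v1 _]] : exists v, (1 - mu) * x < psi e s v /\ psi e s v < (1 - mu) * x + 1.
  by apply: psi_dense => //; lra.
set A := mu * x + psi e s v; set B := mu * A + psi e s v.
have AB : (1 - mu) * x < A - mu * B.
  have : 0 < (A - x) * (1 - mu - mu ^+ 2) by rewrite mulr_gt0// /A; [lra|nra].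
  rewrite /B /A; lra.
have [u [u1 u2]] := @psi_dense R T detT trT e s _ _ AB.
pose g : SOL detT := ((v : 'cV[int]_2), contr e); pose f : SOL detT := ((u : 'cV[int]_2), contr e).
have aE w y : act e s (((w : 'cV[int]_2), contr e) : SOL detT) y = mu * y + psi e s w.
  by rewrite actE /= lam_contr.
have pg : pos (affLO e s x b) g by apply/pos_affLO; left; rewrite aE; lra.
have pf : pos (affLO e s x b) f by apply/pos_affLO; left; rewrite aE; lra.
have := con f g pf pg; rewrite lo_ltE => p1.
have : pos (affLO e s x b) (g^-1 * (f * g ^+ 2))^-1%g.
  rewrite invgM invgK; apply/pos_affLO; left.
  rewrite -(act_mono trT e s (f * g ^+ 2)%g) -!actM// mulVKg expg2.
  rewrite !actM// !aE -/A -/B; lra.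
by rewrite pos_asym.
Qed.

End AffineOrders.

(** * Classification of the left-orderings of SOL *)

Section Classification.
Variables (R : realType) (T : 'M[int]_2) (detT : \det T = 1) (trT : 2 < \tr T).
Implicit Types (v w : Z2) (e s b : bool) (f g h : SOL detT) (o : LO (SOL detT)).

Local Notation psi := (@psi R T).
Local Notation lam := (@lam R T).
Local Notation iota := (sol_iota detT).
Local Notation t := (sol_t detT).
Local Notation act := (@act R T detT).
Local Notation affLO := (@affLO R T detT trT).

Definition cofinalH o := forall g, exists v w : Z2, o (iota v) g /\ o g (iota w).

Lemma lamz_true_gt1 (n : int) : (1 < lam true ^ n) = (0 < n).
Proof.
have l1 := lam_true_gt1 R detT trT.
case: n => n; last first.
  rewrite NegzE -exprz_inv lamV// -exprnP; apply/negbTE; rewrite -leNgt.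
  by rewrite exprn_ile1// ltW ?lam_gt0 ?lam_false_lt1.
by case: n => [|n]; rewrite ?expr0z ?ltxx// -exprnP exprn_egt1.
Qed.

Lemma lamz_gt1 e (n : int) : (1 < lam e ^ n) = (if e then 0 < n else n < 0).
Proof.
case: e; first exact: lamz_true_gt1.
by rewrite -[n]opprK -exprz_inv lamV// lamz_true_gt1 opprK oppr_gt0.
Qed.

Lemma lamz_lt1 e (n : int) : (lam e ^ n < 1) = (if e then n < 0 else 0 < n).
Proof.
have := lamz_gt1 e (- n); rewrite oppr_gt0 oppr_lt0 => <-.
by rewrite -invr_expz invf_gt1 ?lamz_gt0.
Qed.

Definition twist g v : Z2 := T ^ g.2 *m (v : 'cV[int]_2).

Lemma twistE g v : (g * iota v)%g = (iota (twist g v) * g)%g.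
Proof. exact: sol_conjH. Qed.

(** The convex hull of H is a subgroup. If it contains H strictly, then it
    contains a nonzero power of [t], hence [t] by convexity, hence everything. *)
Lemma nonconvex_cofinal o : ~ convex_subgroup o (sol_H detT) -> cofinalH o.
Proof.
move=> ncvx; pose C g := exists v w : Z2, o (iota v) g /\ o g (iota w).
have CM f g : C f -> C g -> C (f * g)%g.
  move=> [v [w [vf fw]]] [v' [w' [vg gw]]].
  exists (twist f v' * v)%g, (twist f w' * w)%g; rewrite !sol_iotaM; split.
    apply: (@lo_trans _ _ _ (f * iota v')%g); last by rewrite lo_mul2l.
    by rewrite (twistE f) lo_mul2l.
  apply: (@lo_trans _ _ _ (f * iota w')%g); first by rewrite lo_mul2l.
  by rewrite (twistE f) lo_mul2l.
have CV g : C g -> C g^-1%g.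
  have inv z x : (iota (twist x z))^-1%g = (x * iota z^-1 * x^-1)%g.
    by rewrite sol_iotaV; apply: invg_inj; rewrite invgK !invgM !invgK mulgA twistE mulgK.
  move=> [v [w [vg gw]]].
  exists (twist g^-1%g w)^-1%g, (twist g^-1%g v)^-1%g; rewrite !sol_iotaV !inv invgK; split.
    rewrite -[X in o _ X]mulg1 -mulgA lo_mul2l -(mulVg (iota w)) sol_iotaV lo_mul2l.
    by [].
  rewrite -[X in o X _]mulg1 -mulgA lo_mul2l -(mulVg (iota v)) sol_iotaV lo_mul2l.
  by [].
have C1 v : C (iota v) by exists v, v; rewrite !lo_refl.
have CX g n : C g -> C (g ^+ n)%g.
  move=> Cg; elim: n => [|n IH]; first exact: (C1 1%g).
  by rewrite expgS; exact: CM.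
have Ccvx f g h : C f -> C h -> o f g -> o g h -> C g.
  move=> [v [w [vf _]]] [v' [w' [_ hw]]] fg gh; exists v, w'; split.
    exact: lo_trans fg.
  exact: lo_trans hw.
have [g [Cg g0]] : exists g, C g /\ g.2 != 0.
  apply: contrapT => nex; apply: ncvx; split; first exact: sol_H_group.
  move=> h1 h2 g /sol_HP h10 /sol_HP h20 h1g gh2; apply/sol_HP; apply/eqP.
  apply: contraT => g0; exfalso; apply: nex; exists g; split=> //.
  exists h1.1, h2.1.
  have -> : iota h1.1 = h1 by apply: sol_eq.
  by have -> : iota h2.1 = h2 by apply: sol_eq.
have Ct : C t.
  have Ctn : C (t ^+ `|g.2|)%g.
    have Cn f : C f -> C (((0 : 'cV[int]_2), f.2) : SOL detT).
      move=> Cf; have -> : (((0 : 'cV[int]_2), f.2) : SOL detT) = ((iota f.1)^-1 * f)%g.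
        by rewrite {3}(sol_decomp f) mulKg.
      by apply: CM => //; exact/CV/C1.
    rewrite sol_tX; have [gp|gn] := leP 0 g.2; first by rewrite gez0_abs//; exact: Cn.
    by rewrite ltz0_abs//; exact: (Cn _ (CV _ Cg)).
  move: Ctn; case E : `|g.2|%N => [|n]; first by move/eqP: E; rewrite absz_eq0 (negbTE g0).
  move=> Ctn; have t1 : t != 1%g by apply/eqP => /(congr1 snd).
  have [pt|nt] := boolP (pos o t).
    apply: (Ccvx 1%g t _ (C1 1%g) Ctn); first exact: lo_ltW.
    case: n {E Ctn} => [|n]; first by rewrite expg1 lo_refl.
    rewrite expgS -[X in o X _]mulg1 lo_mul2l.
    by apply: lo_ltW; exact: posX.
  apply: (Ccvx _ t 1%g Ctn (C1 1%g)).
    case: n {E Ctn} => [|n]; first by rewrite expg1 lo_refl.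
    rewrite expgS -[X in o _ X]mulg1 lo_mul2l.
    by rewrite lo_leNlt -/(pos _ _) posXE.
  by rewrite lo_leNlt.
move=> g'; rewrite (sol_decomp g'); apply: CM; first exact: C1.
case: g'.2 => n; first by rewrite -sol_tX; exact: CX.
by rewrite NegzE -sol_tXN; exact/CV/CX.
Qed.

(** An element of H on the right of the direction of the ordering of H moves every
    [g] forwards: otherwise all its powers would move [g] backwards, and they are
    unbounded in H. Comparing the points [g] and [t^-1], the direction is
    preserved by [T], and so the order of H is given by an eigenform. *)
Lemma cofinal_eigenform o : cofinalH o ->
  exists e s, forall v g, 0 < psi e s v -> lo_lt o g (iota v * g)%g.
Proof.
move=> cof; have [d [ud ed]] := order_direction R (restr o).
have moves v g : 0 < hp d v -> lo_lt o g (iota v * g)%g.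
  move=> hv; rewrite lo_ltNle; apply/negP => vg.
  have vX n : o (iota (v ^+ n) * g)%g g.
    elim: n => [|n IH]; first by rewrite expg0 mul1g lo_refl.
    apply: lo_trans vg; rewrite expgS sol_iotaM -mulgA lo_mul2l.
    exact: IH.
  have [v1 [w1 [v1g gw1]]] := cof g.
  have bnd n : n%:R * hp d v <= hp d w1 - hp d v1.
    have h1 : o (iota (v ^+ n * v1)%g) (iota w1).
      apply: lo_trans gw1; apply: lo_trans (vX n).
      by rewrite sol_iotaM lo_mul2l.
    rewrite leNgt; apply/negP => h2; move: h1; rewrite lo_leNlt lo_ltE -sol_iotaV -sol_iotaM -pos_restr.
    apply/negP; rewrite negbK.
    have /ed : line_lt d w1 (v ^+ n * v1)%g.
      by apply/line_ltE; rewrite hpM hpX; lra.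
    by rewrite lo_ltE.
  have := bnd (Num.truncn ((hp d w1 - hp d v1) / hp d v)).+1.
  rewrite leNgt => /negP; apply; rewrite -ltr_pdivrMr//; exact: truncnS_gt.
have [e [s [c [c0 dE]]]] : exists e s c, 0 < c /\ d = c *: eigvec R T e s.
  apply: (T_invariant_eigen detT trT (unit_neq0 ud)) => v hv.
  rewrite leNgt; apply/negP => hn.
  have := moves v t^-1%g hv; rewrite lo_ltE invgK mulgA sol_conj_t -pos_restr.
  have /ed : line_lt d (T *m v : 'cV[int]_2) 1%g by apply/line_ltE; rewrite hp1.
  by rewrite lo_ltE mulg1 => /pos_asym; rewrite invgK => ->.
exists e, s => v g; rewrite psiP => hv; apply: moves.
by rewrite dE hpZ mulr_gt0.
Qed.

Section Cut.
Variables (o : LO (SOL detT)) (e s : bool).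
Hypothesis cof : cofinalH o.
Hypothesis eigenform : forall v g, 0 < psi e s v -> lo_lt o g (iota v * g)%g.

Let iota_le v w : o (iota v) (iota w) = (psi e s v <= psi e s w).
Proof.
have lt x y : psi e s x < psi e s y -> lo_lt o (iota x) (iota y).
  move=> xy; have := @eigenform (y * x^-1)%g (iota x).
  by rewrite -sol_iotaM mulgVK psiM psiV subr_gt0 => /(_ xy).
apply/idP/idP => [vw|].
  by rewrite leNgt; apply/negP => /lt; rewrite lo_ltNle vw.
rewrite le_eqVlt => /orP[/eqP/(psi_inj detT trT) ->|/lt]; first by rewrite lo_refl.
exact: lo_ltW.
Qed.

(** The position of [g] with respect to H, whose values are dense in the line. *)
Definition cut g : R := sup [set psi e s v | v in [set v | o (iota v) g]].

Let cut_has_sup g : has_sup [set psi e s v | v in [set v | o (iota v) g]].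
Proof.
have [v [w [vg gw]]] := cof g; split; first by exists (psi e s v), v.
exists (psi e s w) => _ [z zg <-]; rewrite -iota_le; exact: lo_trans gw.
Qed.

Lemma cut_lt v g : psi e s v < cut g -> o (iota v) g.
Proof.
move=> vg; have [_ [w wg <-] vw] := sup_adherent (eps := cut g - psi e s v) ltac:(by rewrite subr_gt0) (cut_has_sup g).
apply: (lo_trans _ wg); rewrite iota_le; apply: ltW; move: vw; rewrite -/(cut g); lra.
Qed.

Lemma cut_le v g : o (iota v) g -> psi e s v <= cut g.
Proof. by move=> vg; apply: ub_le_sup; [case: (cut_has_sup g)|exists v]. Qed.

Lemma cut_gt v g : cut g < psi e s v -> o g (iota v).
Proof.
move=> gv; rewrite lo_leNlt; apply/negP => /lo_ltW /cut_le.
by rewrite leNgt gv.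
Qed.

Lemma cut_ge v g : o g (iota v) -> cut g <= psi e s v.
Proof.
move=> gv; apply: ge_sup; first by case: (cut_has_sup g).
by move=> _ [w wg <-]; rewrite -iota_le; exact: lo_trans gv.
Qed.

Lemma cut_iota v : cut (iota v) = psi e s v.
Proof. by apply/eqP; rewrite eq_le cut_ge ?cut_le ?lo_refl. Qed.

(** The products of elements of H squeezing [f] and [g] squeeze [f * g], and their
    values can be taken arbitrarily close to the two cuts. *)
Lemma cutM f g : cut (f * g)%g = lam e ^ f.2 * cut g + cut f.
Proof.
have l0 : 0 < lam e ^ f.2 := lamz_gt0 R detT trT e f.2.
have twistM v : psi e s (twist f v) = lam e ^ f.2 * psi e s v by rewrite psi_Tz.
apply/eqP; rewrite eq_le; apply/andP; split; rewrite leNgt; apply/negP => lt.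
  pose r := (cut (f * g)%g - (lam e ^ f.2 * cut g + cut f)) / 2.
  have r0 : 0 < r by rewrite divr_gt0// subr_gt0.
  have [v [v1 v2]] : exists v, cut g < psi e s v /\ psi e s v < cut g + r / lam e ^ f.2.
    by apply: psi_dense => //; rewrite ltrDl divr_gt0.
  have [u [u1 u2]] : exists u, cut f < psi e s u /\ psi e s u < cut f + r.
    by apply: psi_dense => //; rewrite ltrDl.
  have : cut (f * g)%g <= psi e s (twist f v * u)%g.
    apply: cut_ge; apply: (@lo_trans _ _ _ (f * iota v)%g).
      by rewrite lo_mul2l cut_gt.
    by rewrite twistE sol_iotaM lo_mul2l cut_gt.
  rewrite psiM twistM; move: v2; rewrite -ltrBlDl ltr_pdivlMr// mulrBl => v2.
  by rewrite leNgt => /negP; apply; move: lt u2 v2; rewrite /r; lra.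
pose r := ((lam e ^ f.2 * cut g + cut f) - cut (f * g)%g) / 2.
have r0 : 0 < r by rewrite divr_gt0// subr_gt0.
have [v [v1 v2]] : exists v, cut g - r / lam e ^ f.2 < psi e s v /\ psi e s v < cut g.
  by apply: psi_dense => //; rewrite ltrBlDr ltrDl divr_gt0.
have [u [u1 u2]] : exists u, cut f - r < psi e s u /\ psi e s u < cut f.
  by apply: psi_dense => //; rewrite ltrBlDr ltrDl.
have : psi e s (twist f v * u)%g <= cut (f * g)%g.
  apply: cut_le; apply: (@lo_trans _ _ _ (f * iota v)%g); last first.
    by rewrite lo_mul2l cut_lt.
  by rewrite twistE sol_iotaM lo_mul2l cut_lt.
rewrite psiM twistM; move: v1; rewrite ltrBlDr -ltrBlDl ltr_pdivlMr// mulrBl => v1.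
by rewrite leNgt => /negP; apply; move: lt u1 v1; rewrite /r; lra.
Qed.

(** The cut is a cocycle for the action, and agrees on H with that of the orbit of
    any point [x]; the choice of [x] makes them agree on [t] as well. *)
Lemma cut_orbit : exists x, forall g, cut g = act e s g x - x.
Proof.
pose x := cut t / (lam e - 1).
have le1 : lam e - 1 != 0.
  rewrite subr_eq0; apply/eqP => le.
  by have := @lamz_eq1 R T detT trT e 1; rewrite expr1z => /(_ le).
have tx : cut t = act e s t x - x.
  by rewrite act_tz expr1z /x -[X in _ - X]mul1r -mulrBl mulrC mulfVK.
pose D g := cut g - (act e s g x - x).
have DM f g : D (f * g)%g = lam e ^ f.2 * D g + D f.
  rewrite /D cutM actM// !actE; lra.
have D1 : D 1%g = 0 by have := DM 1%g 1%g; rewrite mulg1 sol1_2 expr0z; lra.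
have Dt : D t = 0 by rewrite /D tx subrr.
have DX n : D (t ^+ n)%g = 0.
  by elim: n => [//|n IH]; rewrite expgS DM IH mulr0 Dt addr0.
have DXN n : D (t ^- n)%g = 0.
  have := DM (t ^- n)%g (t ^+ n)%g; rewrite mulVg D1 DX mulr0 add0r.
  by move=> <-.
exists x => g; apply/eqP; rewrite -subr_eq0 -/(D g); apply/eqP.
rewrite (sol_decomp g) DM.
have -> : D (iota g.1) = 0 by rewrite /D cut_iota act_iota; lra.
have -> : D (((0 : 'cV[int]_2), g.2) : SOL detT) = 0.
  by case: g.2 => n; [rewrite -sol_tX DX|rewrite NegzE -sol_tXN DXN].
by rewrite mulr0 addr0.
Qed.

Lemma cut_affLO : exists x b, o = affLO e s x b.
Proof.
have [x cutE] := cut_orbit; exists x.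
have [b [oE _]] : exists b, o = affLO e s x b /\ (stab (act e s) x = [set 1%g] -> b = false).
  apply: extends_affLO_eq => f g.
  rewrite lo_ltE /orbit_lt -subr_gt0 -cutE => fg.
  have [v [v0 vfg]] := psi_dense detT trT e s fg.
  apply: lo_lt_le_trans (cut_lt vfg).
  by have := eigenform 1%g v0; rewrite mulg1.
by exists b.
Qed.

End Cut.

Lemma nonconvex_affLO o : ~ convex_subgroup o (sol_H detT) ->
  exists e s x b, o = affLO e s x b.
Proof.
move=> /nonconvex_cofinal cof; have [e [s h]] := cofinal_eigenform cof.
by have [x [b oE]] := cut_affLO cof h; exists e, s, x, b.
Qed.

Lemma conradian_convex o : conradian o <-> convex_subgroup o (sol_H detT).
Proof.
split; last exact: convex_conradian.
by move=> con; apply: contrapT => /nonconvex_affLO[e [s [x [b oE]]]];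
   move: con; rewrite oE; exact: affLO_not_conradian.
Qed.

Lemma affine_orderingP o : affine_ordering R o <-> exists e s x b, o = affLO e s x b.
Proof.
split=> [[a [l [x [aff dx ind]]]]|[e [s [x [b ->]]]]].
  have [e [s [c [c0 _ aE]]]] := affine_normal trT aff.
  exists e, s, (x 0%N / c).
  have [b [oE _]] : exists b, o = affLO e s (x 0%N / c) b /\
      (stab (act e s) (x 0%N / c) = [set 1%g] -> b = false).
    apply: extends_affLO_eq => f g; rewrite /orbit_lt lo_ltE => h.
    apply/ind; exists 0%N; split=> //.
    have := aE (f^-1 * g)%g (x 0%N / c); rewrite mulrCA mulfV ?gt_eqF// mulr1 => ->.
    by rewrite -ltr_pdivrMl// mulrC.
  by exists b.
(* The first two points determine the ordering; the rational ones only serve to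
   make the sequence dense. *)
pose y (n : nat) : R := if n is k.+1 then
  if k is j.+1 then (if choice.unpickle j is Some q then ratr q else 0)
  else x + (if b then 1 else -1) else x.
exists (act e s), (lam e), y; split; first exact: act_affine.
- move=> U [z Uz] oU; have [q qU] := @dense_rat R U (ex_intro _ z Uz) oU.
  case: qU => Uq [r _ rq]; exists q; split=> //; exists (choice.pickle r).+2 => //.
  by rewrite /y choice.pickleK.
- move=> g; rewrite -/(pos _ _) pos_affLO.
  have E y0 : act e s g x = x -> act e s g (x + y0) = x + y0 + (lam e ^ g.2 - 1) * y0.
    by rewrite !actE => h; lra.
  have step : act e s g x = x -> (x + (if b then 1 else -1) < act e s g (x + (if b then 1 else -1)))
      = (0 < (if b == e then 1 else -1) * (g.2%:~R : R)).
    move=> gx; rewrite E// ltrDl.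
    have -> : (0 < (if b == e then 1 else -1) * (g.2%:~R : R)) =
        (if b == e then 0 < g.2 else g.2 < 0).
      by case: (b == e); rewrite ?mul1r ?mulN1r ?oppr_gt0 ?ltr0z ?ltrz0.
    case: (b); rewrite ?mulr1 ?mulrN1 ?oppr_gt0 ?subr_gt0 ?subr_lt0 ?lamz_gt1// ?lamz_lt1//.
    by case: (e).
  split=> [[h|[gx h]]|[i [iP h]]].
  + by exists 0%N.
  + by exists 1%N; split; [case|rewrite /= step].
  + case: i iP h => [|[|i]] iP h; first by left.
      have gx : act e s g x = x by exact: (iP 0%N).
      by right; split=> //; rewrite -step.
    have gx : act e s g x = x by exact: (iP 0%N).
    have g1 : act e s g (x + (if b then 1 else -1)) = x + (if b then 1 else -1) by exact: (iP 1%N).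
    move: (g1); rewrite E// => /eqP; rewrite -subr_eq0 addrAC subrr add0r mulf_eq0.
    have -> : ((if b then 1 else -1) == 0 :> R) = false.
      by case: (b); rewrite ?oppr_eq0 oner_eq0.
    rewrite orbF subr_eq0 => /eqP/(@lamz_eq1 R T detT trT e) g2.
    by move: h; rewrite (act_fix_iota trT gx g2) act1 ltxx.
Qed.

End Classification.

(** * Stabilizers of points *)

Lemma intr_Zp_eq0 (k : nat) (z : int) : (z%:~R : 'I_k.+2) = 0 ->
  exists q, z = q * k.+2%:Z.
Proof.
have P (n : nat) : (n%:R : 'I_k.+2) = 0 -> exists q : nat, n = (q * k.+2)%N.
  by rewrite Zp_nat => /(congr1 val) /= /eqP/dvdnP.
case: z => n; first by move=> /P[q ->]; exists q%:Z; rewrite PoszM.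
rewrite NegzE rmorphN /= => /eqP; rewrite oppr_eq0 => /eqP /P[q ->].
by exists (- q%:Z); rewrite PoszM mulNr.
Qed.

(** The powers of [T] with coefficients in the finite ring Z/m repeat, and [T] is
    invertible there. *)
Lemma matrix_order_mod (T : 'M[int]_2) (detT : \det T = 1) (m : nat) : (0 < m)%N ->
  exists n : nat, (0 < n)%N /\ forall v : 'cV[int]_2,
    exists z : 'cV[int]_2, v - T ^+ n *m v = m%:Z *: z.
Proof.
(* Modulo [1] there is nothing to prove; for [m > 1] the ring is ['I_k.+2]. *)
case: m => [//|[_|k _]].
  by exists 1%N; split=> // v; exists (v - T *m v); rewrite scale1r expr1.
pose Tk : 'M['I_k.+2]_2 := map_mx intr T.
have uT : Tk \is a GRing.unit.
  by rewrite -[_ \is a _]/(Tk \in unitmx) unitmxE /Tk det_map_mx detT unitr1.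
have [n [n0 Tn]] : exists n, (0 < n)%N /\ Tk ^+ n = 1.
  pose F (i : 'I_#|{: 'M['I_k.+2]_2}|.+1) := Tk ^+ i.
  have period (i j : 'I_#|{: 'M['I_k.+2]_2}|.+1) : (i < j)%N -> F i = F j ->
      exists n, (0 < n)%N /\ Tk ^+ n = 1.
    move=> ij Fij; exists (j - i)%N; rewrite subn_gt0; split=> //.
    apply: (mulrI (unitrX i uT)); rewrite -exprD subnKC ?mulr1; last exact: ltnW.
    exact: esym Fij.
  have /injectivePn[i [j ij Fij]] : ~~ injectiveb F.
    by apply/negP => /injectiveP /leq_card; rewrite card_ord ltnn.
  have [lt_ij|lt_ji|eq_ij] := ltngtP i j; first exact: period lt_ij Fij.
    exact: period lt_ji (esym Fij).
  by rewrite (val_inj eq_ij) eqxx in ij.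
have {}Tn : map_mx intr (T ^+ n) = 1 :> 'M['I_k.+2]_2 by rewrite rmorphXn.
exists n; split=> //.
move=> v.
have ex i : exists q, (v - T ^+ n *m v) i 0 = q * k.+2%:Z.
  apply: intr_Zp_eq0.
  have : map_mx intr (v - T ^+ n *m v) = 0 :> 'cV['I_k.+2]_2.
    by rewrite map_mxB map_mxM Tn mul1mx subrr.
  by move/(congr1 (fun M : 'cV['I_k.+2]_2 => M i 0)); rewrite !mxE.
have [q qE] := choice ex.
exists (\col_i q i); apply/matrixP => i j; rewrite (ord1 j) qE !mxE mulrC.
by [].
Qed.

Section AffineLine.
Variables (R : realType) (T : 'M[int]_2) (detT : \det T = 1) (trT : 2 < \tr T).
Implicit Types (v w : Z2) (e s b : bool) (f g h : SOL detT) (o : LO (SOL detT)).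

Local Notation psi := (@psi R T).
Local Notation lam := (@lam R T).
Local Notation act := (@act R T detT).
Local Notation affLO := (@affLO R T detT trT).

(** The rational multiples of the lengths of the translations by elements of H;
    [divsetP] shows that they do not depend on the action. *)
Definition divset : set R :=
  [set x | exists (n : nat) v, (0 < n)%N /\ n%:R * x = psi true true v].

(** The integer matrix with rows [(c, d - a)] and [(0, - c)] exchanges the two
    eigenforms, up to the factor [c]. *)
Lemma psi_conjugate e s v : exists w, psi e s w = (absz (T 1 0))%:R * psi (~~ e) s v.
Proof.
pose c := T 1 0; pose X := c * (v : 'cV[int]_2) 0 0 + (T 1 1 - T 0 0) * (v : 'cV[int]_2) 1 0.
pose Y := - c * (v : 'cV[int]_2) 1 0.
pose w : Z2 := (col2 X Y : 'cV[int]_2).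
have wE : psi e s w = tc R T * psi (~~ e) s v.
  rewrite !psiE col2Z_zx col2Z_zy /X /Y intrD !intrM intrB rmorphN /=.
  have := lamD R T e; rewrite tauE => h.
  have -> : lam (~~ e) = ta R T + td R T - lam e by lra.
  rewrite -/(zx R v) -/(zy R v) -/(tc R T) -/(ta R T) -/(td R T); lra.
rewrite natr_absz intr_norm -/(tc R T).
have [c0|c0] := leP 0 (tc R T); first by exists w; rewrite wE ger0_norm.
by exists w^-1%g; rewrite psiV wE ltr0_norm// mulNr.
Qed.

Lemma divsetP e s x : divset x <->
  exists (n : nat) v, (0 < n)%N /\ n%:R * x = psi e s v.
Proof.
have sgnP e' s' s'' : (exists (n : nat) v, (0 < n)%N /\ n%:R * x = psi e' s' v) ->
    exists (n : nat) v, (0 < n)%N /\ n%:R * x = psi e' s'' v.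
  move=> [n [v [n0 nv]]]; have [<-|ss] := eqVneq s' s''; first by exists n, v.
  exists n, v^-1%g; split=> //; rewrite psiV nv -psi_neg.
  by congr psi; move: ss; clear; case: s' s'' => -[].
have conjP e' s' : (exists (n : nat) v, (0 < n)%N /\ n%:R * x = psi (~~ e') s' v) ->
    exists (n : nat) v, (0 < n)%N /\ n%:R * x = psi e' s' v.
  move=> [n [v [n0 nv]]]; have [w wE] := psi_conjugate e' s' v.
  exists (absz (T 1%R 0%R) * n)%N, w; rewrite wE natrM -mulrA nv; split=> //.
  rewrite muln_gt0 n0 andbT absz_gt0; apply/eqP => c0.
  by have := tc_neq0 R detT trT; rewrite /tc c0 eqxx.
split.
  case: e => [|h]; first exact: sgnP.
  exact/(sgnP _ true)/conjP.
case: e => [|h]; first exact: sgnP.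
exact/conjP/(sgnP _ s).
Qed.

Lemma divset_countable : countable divset.
Proof.
have sub : divset `<=` (fun p : nat * 'cV[int]_2 => psi true true p.2 / p.1%:R) @` setT.
  move=> x [n [v [n0 nv]]]; exists (n, v) => //=.
  by rewrite -nv mulrC mulKf// pnatr_eq0 -lt0n.
apply: sub_countable (subset_card_le sub) _.
by apply: sub_countable (card_image_le _ _) _; exact: countableP.
Qed.

Lemma divset_dense : dense divset.
Proof.
move=> O [x Ox] oO.
have /nbhs_ballP[r /= r0 rO] : nbhs x O by exact: open_nbhs_nbhs.
have [v [v1 v2]] : exists v, x - r < psi true true v /\ psi true true v < x + r.
  by apply: psi_dense => //; lra.
exists (psi true true v); split; last by exists 1%N, v; rewrite mul1r.
by apply: rO; rewrite /ball /= ltr_distlC; apply/andP; split; lra.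
Qed.

(** The sum is the trace of the [n]-th power of [T]. *)
Lemma lam_trace_int e (n : int) : exists k : int, lam e ^ n + lam e ^ (- n) = k%:~R.
Proof.
have P (m : nat) : exists k l : int, lam e ^+ m + lam (~~ e) ^+ m = k%:~R /\
    lam e ^+ m.+1 + lam (~~ e) ^+ m.+1 = l%:~R.
  elim: m => [|m [k [l [kE lE]]]].
    by exists 2, (\tr T); rewrite !expr0 !expr1 lamD.
  exists l, (\tr T * l - k); split=> //.
  rewrite rmorphB rmorphM /= -kE -lE -/(tau R T).
  have h1 := lam_root R detT trT e; have h2 := lam_root R detT trT (~~ e).
  have := congr1 (fun z => z * lam e ^+ m) h1; have := congr1 (fun z => z * lam (~~ e) ^+ m) h2.
  rewrite !exprS !mul0r; lra.
have V (z : int) : lam e ^ (- z) = lam (~~ e) ^ z by rewrite -exprz_inv lamV.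
case: n => m; have [k [l [kE lE]]] := P m; first by exists k; rewrite V.
by exists l; rewrite NegzE opprK V addrC.
Qed.

(** If [g] with exponent [n] fixes [x], then [(1 - lam^n) x] is a value of the
    form; multiplying by [1 - lam^-n] gives the value [(2 - k) x], where [k] is the
    trace of [T^n]. Conversely if [m x] is a value of the form and [T^n] is the
    identity modulo [m], then [(1 - lam^n) x] is a value of the form. *)
Lemma stab_nontrivial e s x : stab (act e s) x <> [set 1%g] <-> divset x.
Proof.
rewrite (divsetP e s); split=> [st|[m [v [m0 mv]]]].
  have [g [gx g0]] : exists g, act e s g x = x /\ g.2 != 0.
    apply: contrapT => nex; apply: st; apply/seteqP; split=> [g gx|g ->]; last exact: act1.
    apply: (act_fix_iota trT gx); apply/eqP; apply: contraT => g0.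
    by exfalso; apply: nex; exists g.
  have [k kE] := lam_trace_int e g.2.
  have l0 := lamz_gt0 R detT trT e g.2.
  have l1 : lam e ^ g.2 * lam e ^ (- g.2) = 1 by rewrite -expfzDr ?lam_neq0// subrr.
  have ln1 : lam e ^ g.2 != 1 := lamz_neq1 R detT trT e g0.
  have gE : psi e s g.1 = (1 - lam e ^ g.2) * x by move: gx; rewrite actE; lra.
  have k2 : (2 : R) < k%:~R.
    rewrite -kE -(ltr_pM2l l0) [X in _ < X]mulrDr l1.
    have : 0 < (lam e ^ g.2 - 1) ^+ 2 by rewrite lt_neqAle sqr_ge0 andbT eq_sym sqrf_eq0 subr_eq0.
    lra.
  have {}k2 : 2 < k by rewrite -(@ltr_int R).
  pose u : Z2 := (T ^ (- g.2) *m g.1 - g.1).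
  have uE : psi e s u = (k - 2)%:~R * x.
    rewrite psiD psiN psi_Tz// gE rmorphB /= -kE.
    have := congr1 (fun z => z * x) l1; lra.
  exists `|k - 2|%N, u; split; first by move: k2; clear; lia.
  by rewrite uE natr_absz ger0_norm//; move: k2; clear; lia.
have [n [n0 nP]] := matrix_order_mod detT m0.
have [z zE] := nP v.
pose g : SOL detT := (z, n%:Z).
have gx : act e s g x = x.
  have mR : (m%:R : R) != 0 by rewrite pnatr_eq0 -lt0n.
  apply: (mulfI mR); rewrite actE /= mulrDr mulrCA mv.
  have := congr1 (psi e s) zE; rewrite psiMz => <-.
  by rewrite psiD psiN -[T ^+ n]/(T ^ n%:Z) psi_Tz//; lra.
move=> st; have : stab (act e s) x g by [].
by rewrite st /= => /(congr1 snd) /= /eqP; rewrite eqz_nat eqn0Ngt n0.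
Qed.

Lemma stab_trivialP e s x : stab (act e s) x = [set 1%g] <-> ~ divset x.
Proof.
rewrite -(stab_nontrivial e s); by split=> [h|h]; [apply|exact: contrapT h].
Qed.

(** An expansion moves away from its fixed point [z]: it is positive if and only if
    the base point lies on the right of [z] in the doubled line. *)
Lemma pos_affLO_expand e s y c g z : act e s g z = z -> 1 < lam e ^ g.2 ->
  pos (affLO e s y c) g = (z < y) || ((y == z) && c).
Proof.
move=> gz l1; have E : act e s g y - y = (lam e ^ g.2 - 1) * (y - z).
  by move: gz; rewrite !actE; lra.
have g0 : g.2 != 0 by apply/eqP => g0; rewrite g0 expr0z ltxx in l1.
have lp : 0 < lam e ^ g.2 - 1 by lra.
have [zy|yz|] := ltgtP z y.
- by apply/pos_affLO; left; rewrite -subr_gt0 E mulr_gt0// subr_gt0.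
- apply/negP => /pos_affLO[|[h _]].
    by rewrite -subr_gt0 E pmulr_rgt0// subr_gt0 ltNge ltW.
  move: E; rewrite h subrr => /esym/eqP; rewrite mulf_eq0 gt_eqF//= subr_eq0.
  by rewrite (lt_eqF yz).
move=> zy; rewrite -zy pos_affLO_fix//; move: l1; rewrite lamz_gt1//=.
by case: (e) (c) g0 => -[]; lia.
Qed.

End AffineLine.

(** * The doubled line *)

Lemma dline_ltE (R : realType) (D : set R) (p q : dline D) :
  (p < q)%O = ((val p).1 < (val q).1) ||
              [&& (val p).1 == (val q).1, ~~ (val p).2 & (val q).2].
Proof.
rewrite -lt_val; case: (val p) (val q) => [x b] [y c] /=.
rewrite Order.ProdLexiOrder.ltEprodlexi /=.
by case: (ltgtP x y) => //= _; case: b; case: c.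
Qed.

Section DoubledLine.
Variables (R : realType) (T : 'M[int]_2) (detT : \det T = 1) (trT : 2 < \tr T).
Implicit Types (v w : Z2) (e s b : bool) (f g h : SOL detT) (o : LO (SOL detT)).

Local Notation psi := (@psi R T).
Local Notation lam := (@lam R T).
Local Notation iota := (sol_iota detT).
Local Notation act := (@act R T detT).
Local Notation affLO := (@affLO R T detT trT).
Local Notation D := (@divset R T).
Local Notation line := (order_topology (dline D)).

Lemma inv_expands e s g z : act e s g z = z -> lam e ^ g.2 < 1 ->
  act e s g^-1%g z = z /\ 1 < lam e ^ (g^-1%g).2.
Proof.
move=> gz lg; rewrite -{1}gz -actM// mulVg act1; split=> //.
by rewrite solV_2 -invr_expz invf_gt1 ?lamz_gt0.
Qed.

Lemma pos_affLO_contract e s y c g z : act e s g z = z -> lam e ^ g.2 < 1 ->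
  pos (affLO e s y c) g = (y < z) || ((y == z) && ~~ c).
Proof.
move=> gz l1.
have g1 : g != 1%g by apply/eqP => g1; rewrite g1 sol1_2 expr0z ltxx in l1.
have [gVz lV] := inv_expands gz l1.
rewrite -[LHS]negbK -posV// (pos_affLO_expand _ _ _ gVz lV).
by case: (ltgtP z y) => //= _; case: c.
Qed.

Lemma fixed_point e s g : g.2 != 0 -> exists z, act e s g z = z.
Proof.
move=> g0; have l1 : 1 - lam e ^ g.2 != 0.
  by rewrite subr_eq0 eq_sym lamz_neq1.
exists (psi e s g.1 / (1 - lam e ^ g.2)); rewrite actE.
apply: (mulIf l1); rewrite mulrDl -mulrA mulfVK//; lra.
Qed.

Lemma fixed_divset e s g z : g.2 != 0 -> act e s g z = z -> D z.
Proof.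
move=> g0 gz; apply/(stab_nontrivial detT trT e s) => st.
have : stab (act e s) z g by [].
by rewrite st /= => g1; rewrite g1 eqxx in g0.
Qed.

Lemma divset_fixed e s z : D z -> exists g, act e s g z = z /\ g.2 != 0.
Proof.
move=> /(stab_nontrivial detT trT e s) st; apply: contrapT => nex; apply: st.
apply/seteqP; split=> [g gx|g ->]; last exact: act1.
apply: (act_fix_iota trT gx); apply/eqP; apply: contraT => g0.
by exfalso; apply: nex; exists g.
Qed.

(** The fixed points of the contractions of ratio [lam false] are the multiples,
    by a constant, of the translation lengths. *)
Lemma contraction_between e s x y : x < y ->
  exists g z, [/\ x < z, z < y, act e s g z = z & lam e ^ g.2 < 1].
Proof.
move=> xy; have l1 : 0 < 1 - lam false by have := lam_false_lt1 R detT trT; lra.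
have [v [v1 v2]] : exists v, (1 - lam false) * x < psi e s v /\ psi e s v < (1 - lam false) * y.
  by apply: psi_dense; rewrite // ltr_pM2l.
exists (((v : 'cV[int]_2), contr e) : SOL detT), (psi e s v / (1 - lam false)); split.
- by rewrite ltr_pdivlMr// mulrC.
- by rewrite ltr_pdivrMr// mulrC.
- rewrite actE /= lam_contr//; have l1' : 1 - lam false != 0 by rewrite gt_eqF.
  apply: (mulIf l1').
  by rewrite mulrDl -mulrA mulfVK ?gt_eqF//; lra.
- by rewrite /= lam_contr// lam_false_lt1.
Qed.

Lemma inv_contracts e s g z : act e s g z = z -> 1 < lam e ^ g.2 ->
  act e s g^-1%g z = z /\ lam e ^ (g^-1%g).2 < 1.
Proof.
move=> gz lg; rewrite -{1}gz -actM// mulVg act1; split=> //.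
by rewrite solV_2 -invr_expz invf_lt1 ?lamz_gt0.
Qed.

Lemma expansion_fixing e s z : D z ->
  exists g, act e s g z = z /\ 1 < lam e ^ g.2.
Proof.
move=> /(divset_fixed e s)[g [gz /(lamz_neq1 R detT trT e)]].
rewrite neq_lt => /orP[lg|lg]; last by exists g.
by exists g^-1%g; exact: inv_expands.
Qed.

Lemma contraction_fixing e s z : D z ->
  exists g, act e s g z = z /\ lam e ^ g.2 < 1.
Proof.
by move=> /(expansion_fixing e s)[g [gz lg]]; exists g^-1%g; exact: inv_contracts.
Qed.

Lemma expansion_between e s x y : x < y ->
  exists g z, [/\ x < z, z < y, act e s g z = z & 1 < lam e ^ g.2].
Proof.
move=> /(contraction_between e s)[g [z [xz zy gz lg]]].
by have [? ?] := inv_expands gz lg; exists g^-1%g, z.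
Qed.

(** The translations that move a point to the right determine the action, and the
    fixed point of a contraction lying between two points tells them apart. *)
Lemma orbit_inj e s x e' s' x' :
  (forall g, x < act e s g x <-> x' < act e' s' g x') -> [/\ e = e', s = s' & x = x'].
Proof.
move=> h; have es : (e, s) = (e', s').
  apply/eqP; apply: contraT => /(eigvec_sep R detT trT)[v [v1 v2]].
  have := h (iota v); rewrite !act_iota !ltrDl => -[/(_ v1)] v3 _.
  by have := lt_trans v2 v3; rewrite ltxx.
case: es h => <- <- h; split=> //.
have key y y' : (forall g, y < act e s g y <-> y' < act e s g y') -> ~ y < y'.
  move=> H /(contraction_between e s)[g [z [yz zy gz lg]]].
  have E u : act e s g u - u = (1 - lam e ^ g.2) * (z - u).
    by move: gz; rewrite !actE; lra.
  have l0 : 0 < 1 - lam e ^ g.2 by rewrite subr_gt0.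
  have /H : y < act e s g y by rewrite -subr_gt0 E mulr_gt0// subr_gt0.
  by rewrite -subr_gt0 E pmulr_rgt0// subr_gt0 ltNge ltW.
have [/key//|/key xx|//] := ltgtP x x'.
by exfalso; apply: xx => g; rewrite h.
Qed.

Lemma dlineP (p : dline D) : D (val p).1 \/ (val p).2 = false.
Proof.
have := valP p; rewrite /dline_pred => /orP[/set_mem|/negbTE]; first by left.
by right.
Qed.

Lemma mk_dlineP x b : D x \/ b = false -> dline_pred D (x, b).
Proof.
by rewrite /dline_pred /=; case=> [Dx|->]; rewrite ?orbT// (mem_set Dx).
Qed.

Definition mk_dline x b (h : D x \/ b = false) : dline D := exist _ (x, b) (mk_dlineP h).

Definition dlineLO e s (p : line) : LO (SOL detT) := affLO e s (val p).1 (val p).2.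

Lemma extends_dlineLO e s p : extends (dlineLO e s p) (orbit_lt (act e s) (val p).1).
Proof. exact: extends_affLO. Qed.

Lemma affLO_dline e s x b : exists p, affLO e s x b = dlineLO e s p.
Proof.
have [c [-> h]] := extends_affLO_eq trT (@extends_affLO R T detT trT e s x b).
have hc : D x \/ c = false.
  have [Dx|nD] := pselect (D x); first by left.
  by right; apply: h; exact/(stab_trivialP detT trT).
by exists (mk_dline hc).
Qed.

Lemma affLO_inj e s x b e' s' x' b' : affLO e s x b = affLO e' s' x' b' ->
  [/\ e = e', s = s' & x = x'].
Proof.
move=> oo; have es : (e, s) = (e', s').
  apply/eqP; apply: contraT => /(eigvec_sep R detT trT)[v [v1 v2]].
  have := congr1 (fun o => pos o (iota v)) oo; rewrite /= !pos_affLO_iota// v1.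
  by rewrite ltNge (ltW v2).
case: es oo => <- <- oo; split=> //.
have key y y' c c' : affLO e s y c = affLO e s y' c' -> ~ y < y'.
  move=> yy' /(contraction_between e s)[g [z [yz zy gz lg]]].
  have := congr1 (fun o => pos o g) yy'; rewrite /= !(pos_affLO_contract _ _ gz lg).
  by rewrite yz ltNge (ltW zy) /= (gt_eqF zy).
have [/(key _ _ _ _ oo)//|/(key _ _ _ _ (esym oo))//|//] := ltgtP x x'.
Qed.

Lemma dlineLO_inj e s : injective (dlineLO e s).
Proof.
move=> p q pq; have [_ _ x] := affLO_inj pq.
have [Dx|nD] := pselect (D (val p).1); last first.
  have [//|bp] := dlineP p; have [|bq] := dlineP q; first by rewrite -x.
  by apply: val_inj; move: x bp bq; case: (val p) (val q) => [? ?] [? ?] /= -> -> ->.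
have [g [gx g0]] := divset_fixed e s Dx.
have := congr1 (fun o => pos o g) pq; rewrite /dlineLO /= !pos_affLO_fix// -?x// => bb.
have b2 : (val p).2 = (val q).2.
  by move: bb; case: (0 < g.2) (sval p).2 (sval q).2 (e) => [] [] [] [].
by apply: val_inj; move: x b2; case: (val p) (val q) => [? ?] [? ?] /= -> ->.
Qed.

(** An element outside H has a fixed point [z], and it is positive exactly on an
    open ray that starts at one of the two copies of [z]; the sign of an element
    of H is constant. *)
Lemma dlineLO_continuous e s : {within setT, continuous (dlineLO e s)}.
Proof.
apply: within_continuous_LO => p g _ pg.
suff : \forall q \near p, pos (dlineLO e s q) g by apply: filterS => q h _.
have [g0|g0] := eqVneq g.2 0.
  have gE : g = iota g.1 by apply: sol_eq.
  apply: filterE => q; move: pg; rewrite gE /dlineLO !pos_affLO_iota//.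
have [z gz] := fixed_point e s g0; have Dz := fixed_divset g0 gz.
have l1 : lam e ^ g.2 != 1 by rewrite lamz_neq1.
have [lg|lg|lg] := ltgtP (lam e ^ g.2) 1; last by rewrite lg eqxx in l1.
- pose r : line := mk_dline (or_introl Dz : D z \/ true = false).
  have E (q : line) : pos (dlineLO e s q) g = (q < r)%O.
    by rewrite /dlineLO (pos_affLO_contract _ _ gz lg) dline_ltE /= andbT.
  have : (p < r)%O by rewrite -E.
  move=> pr; apply: filterS (open_nbhs_nbhs (conj (@lray_open _ line r) _)).
    by move=> q /=; rewrite in_itv /= E.
  by rewrite /= in_itv.
- pose r : line := mk_dline (or_intror erefl : D z \/ false = false).
  have E (q : line) : pos (dlineLO e s q) g = (r < q)%O.
    by rewrite /dlineLO (pos_affLO_expand _ _ _ gz lg) dline_ltE /= eq_sym.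
  have : (r < p)%O by rewrite -E.
  move=> pr; apply: filterS (open_nbhs_nbhs (conj (@rray_open _ line r) _)).
    by move=> q /=; rewrite in_itv /= andbT E.
  by rewrite /= in_itv /= andbT.
Qed.

(** Rays are neighbourhoods for the orderings: the required element expands from a
    point between [l] and [p], or from their common position if [l] and [p] are
    the two copies of a point. *)
Lemma dlineLO_right e s (p l : line) : (l < p)%O -> exists g, pos (dlineLO e s p) g /\
  forall q, pos (dlineLO e s q) g -> (l < q)%O.
Proof.
rewrite dline_ltE => /orP[lp|/and3P[/eqP lp l2 p2]].
  have [g [z [lz zp gz lg]]] := expansion_between e s lp.
  exists g; rewrite /dlineLO (pos_affLO_expand _ _ _ gz lg) zp; split=> // q.
  rewrite (pos_affLO_expand _ _ _ gz lg) dline_ltE => /orP[zq|/andP[/eqP zq _]].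
    by rewrite (lt_trans lz zq).
  by rewrite zq lz.
have Dp : D (val p).1 by have [//|h] := dlineP p; rewrite h in p2.
have [g [gz lg]] := expansion_fixing e s Dp.
exists g; rewrite /dlineLO (pos_affLO_expand _ _ _ gz lg) eqxx p2 orbT; split=> // q.
rewrite (pos_affLO_expand _ _ _ gz lg) dline_ltE lp l2 eq_sym.
by case/orP => [->//|/andP[-> ->]]; rewrite orbT.
Qed.

Lemma dlineLO_left e s (p r : line) : (p < r)%O -> exists g, pos (dlineLO e s p) g /\
  forall q, pos (dlineLO e s q) g -> (q < r)%O.
Proof.
rewrite dline_ltE => /orP[pr|/and3P[/eqP pr p2 r2]].
  have [g [z [pz zr gz lg]]] := contraction_between e s pr.
  exists g; rewrite /dlineLO (pos_affLO_contract _ _ gz lg) pz; split=> // q.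
  rewrite (pos_affLO_contract _ _ gz lg) dline_ltE => /orP[zq|/andP[/eqP zq _]].
    by rewrite (lt_trans zq zr).
  by rewrite zq zr.
have Dp : D (val p).1 by rewrite pr; have [//|h] := dlineP r; rewrite h in r2.
have [g [gz lg]] := contraction_fixing e s Dp.
exists g; rewrite /dlineLO (pos_affLO_contract _ _ gz lg) eqxx p2 orbT; split=> // q.
rewrite (pos_affLO_contract _ _ gz lg) dline_ltE -pr r2 andbT.
by case/orP => [->//|/andP[-> ->]]; rewrite orbT.
Qed.

Definition affSet e s : set (LO (SOL detT)) := range (dlineLO e s).

Lemma dlineLO_homeo e s : homeo setT (affSet e s) (dlineLO e s).
Proof.
pose p0 : line := mk_dline (or_intror erefl : D 0 \/ false = false).
have [inv invK] : exists inv : LO (SOL detT) -> line, forall p, inv (dlineLO e s p) = p.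
  exists (fun o => xget p0 [set p | dlineLO e s p = o]) => p.
  by case: xgetP => [q _ /dlineLO_inj //|/(_ p) h]; case: h.
exists inv; split.
- by move=> p _; split; [exists p|exact: invK].
- by move=> _ [p _ <-]; split=> //; rewrite invK.
- exact: dlineLO_continuous.
- apply/subspace_continuousP => _ [p _ <-]; rewrite /from_subspace invK => U.
  rewrite order_nbhs_itv => -[i [io pi] iU].
  rewrite /= /within; near_simpl.
  suff : \forall o \near dlineLO e s p, affSet e s o -> inv o \in i.
    by apply: filterS => o h ao; apply: iU; exact: h.
  case: i io pi {iU} => bl br io; rewrite in_itv => /andP[hl hr].
  have nl : \forall o \near dlineLO e s p, affSet e s o ->
      (match bl with BSide b x => x < inv o ?<= if b | BInfty b => b end)%O.
    case: bl io hl => [[] x|[]] io hl.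
    - by have := itv_open_ends_lside io.
    - have [g [pg gP]] := dlineLO_right e s hl.
      apply: filterS (nbhs_pos pg) => o oq [q _ qo]; rewrite -qo invK.
      by apply: gP; rewrite qo.
    - exact: filterE.
    - by have := itv_open_ends_linfty io.
  have nr : \forall o \near dlineLO e s p, affSet e s o ->
      (match br with BSide b x => inv o < x ?<= if ~~ b | BInfty b => ~~ b end)%O.
    case: br io hr {nl} => [[] x|[]] io hr.
    - have [g [pg gP]] := dlineLO_left e s hr.
      apply: filterS (nbhs_pos pg) => o oq [q _ qo]; rewrite -qo invK.
      by apply: gP; rewrite qo.
    - by have := itv_open_ends_rside io.
    - by have := itv_open_ends_rinfty io.
    - exact: filterE.
  apply: filterS2 nl nr => o h1 h2 ao; rewrite in_itv.
  by apply/andP; split; [exact: h1|exact: h2].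
Qed.

End DoubledLine.

(** * Bi-orderings and isolated orderings *)

Section EndPoints.
Variables (R : realType) (T : 'M[int]_2) (detT : \det T = 1) (trT : 2 < \tr T).
Implicit Types (v w : Z2) (e s b : bool) (f g h : SOL detT) (o : LO (SOL detT)).

Local Notation psi := (@psi R T).
Local Notation lam := (@lam R T).
Local Notation iota := (sol_iota detT).
Local Notation t := (sol_t detT).
Local Notation act := (@act R T detT).
Local Notation affLO := (@affLO R T detT trT).

(** The ordering of H by the sign of [psi e s], obtained by restriction from any of
    the affine orderings. *)
Definition eigLO e s : LO Z2 := restr (affLO e s 0 false).

Lemma pos_eigLO e s v : pos (eigLO e s) v = (0 < psi e s v).
Proof. by rewrite pos_restr pos_affLO_iota. Qed.

Lemma restr_affLO e s x b : restr (affLO e s x b) = eigLO e s.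
Proof. by apply: LO_sub_eq => v; rewrite pos_restr pos_eigLO pos_affLO_iota. Qed.

Lemma eigLO_inj e s e' s' : eigLO e s = eigLO e' s' -> (e, s) = (e', s').
Proof.
move=> es; apply/eqP; apply: contraT => /(eigvec_sep R detT trT)[v [v1 v2]].
have := congr1 (fun k : LO Z2 => pos k v) es; rewrite /= !pos_eigLO v1.
by rewrite ltNge (ltW v2).
Qed.

(** The limit of the affine orderings when the point goes to [+oo] if [b] holds,
    and to [-oo] otherwise: far to the right an element outside H moves points to
    the right if and only if it expands. *)
Definition endpt e s b : LO (SOL detT) := lexLO detT (b == e) (eigLO e s).

Lemma endptE e s b : endpt e s b = lexLO detT (b == e) (eigLO e s).
Proof. by []. Qed.

Lemma endpt_inj e s b e' s' b' : endpt e s b = endpt e' s' b' ->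
  [/\ e = e', s = s' & b = b'].
Proof.
move=> h; have := congr1 (@restr T detT) h; rewrite !restr_lexLO => /eigLO_inj[ee ss].
have := congr1 (fun o => pos o t) h; rewrite /= !pos_lexLO_t -ee.
by case: (b) (b') (e) => [] [] [].
Qed.

Lemma extends_eigvec_LO (o : LO Z2) (d : 'cV[R]_2) e s c : 0 < c -> d = c *: eigvec R T e s ->
  extends o (line_lt d) -> o = eigLO e s.
Proof.
move=> c0 dE ex; apply/esym/LO_sub_eq => v; rewrite pos_eigLO psiP => hv.
by apply: ex; apply/line_lt1E; rewrite dE hpZ mulr_gt0.
Qed.

Lemma t_invariantP (o : LO Z2) :
  t_invariant detT o <-> forall v, pos o v -> pos o (T *m v : 'cV[int]_2).
Proof.
split=> h v.
  by apply: h; rewrite sol_conj_t.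
by move=> w; rewrite sol_conj_t => /sol_iota_inj <-; exact: h.
Qed.

Lemma eigLO_t_invariant e s : t_invariant detT (eigLO e s).
Proof.
apply/t_invariantP => v; rewrite !pos_eigLO psi_T// => h.
by rewrite mulr_gt0// lam_gt0.
Qed.

Lemma t_invariant_direction (o : LO Z2) (d : 'cV[R]_2) : unit_dir d -> extends o (line_lt d) ->
  t_invariant detT o -> exists e s c, 0 < c /\ d = c *: eigvec R T e s.
Proof.
move=> ud ed /t_invariantP inv; apply: (T_invariant_eigen detT trT (unit_neq0 ud)) => v hv.
rewrite leNgt; apply/negP => hn.
have /inv : pos o v by apply: ed; apply/line_lt1E.
have /ed : line_lt d (T *m v : 'cV[int]_2) 1%g by apply/line_ltE; rewrite hp1.
by rewrite lo_ltE mulg1 => /pos_asym; rewrite invgK => ->.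
Qed.

Lemma t_invariant_eigLO (o : LO Z2) : t_invariant detT o -> exists e s, o = eigLO e s.
Proof.
move=> inv; have [d [ud ed]] := order_direction R o.
have [e [s [c [c0 dE]]]] := t_invariant_direction ud ed inv.
by exists e, s; exact: extends_eigvec_LO c0 dE ed.
Qed.

Lemma eigendirection_eigvec (d : 'cV[R]_2) : eigendirection T d ->
  exists e s c, 0 < c /\ d = c *: eigvec R T e s.
Proof.
move=> [ud [l h]]; have [e [s [c [c0 _ dE]]]] := eigvecP detT trT (unit_neq0 ud) h.
by exists e, s, c.
Qed.

Lemma t_invariant_eigendirection (o : LO Z2) (d : 'cV[R]_2) : unit_dir d ->
  extends o (line_lt d) -> (t_invariant detT o <-> eigendirection T d).
Proof.
move=> ud ed; split=> [/(t_invariant_direction ud ed)[e [s [c [c0 dE]]]]|].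
  split=> //; exists (lam (~~ e)).
  by rewrite dE -scalemxAr eigvec_T// !scalerA (mulrC c).
move=> /eigendirection_eigvec[e [s [c [c0 dE]]]].
rewrite (extends_eigvec_LO c0 dE ed); exact: eigLO_t_invariant.
Qed.

Lemma bi_ordering_conradian o : bi_ordering o -> conradian o.
Proof.
move=> bi f g pf pg; rewrite lo_ltE.
have -> : (g^-1 * (f * g ^+ 2))%g = (f ^ g * g)%g.
  by rewrite conjgE expg2 !mulgA.
by apply: posM => //; exact: bi.
Qed.

Lemma conj_iota v g : (iota v ^ g)%g = iota (T ^ (- g.2) *m v : 'cV[int]_2).
Proof.
apply: (mulgI g); rewrite -conjgC sol_conjH; congr (iota _ * _)%g.
by rewrite mulmxA -[_ *m T ^ _]/(T ^ g.2 * T ^ (- g.2)) -exprzDr ?(sol_unit detT)// subrr expr0z mul1mx.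
Qed.

(** A bi-ordering is Conradian, hence lexicographic, and the order of H is
    invariant under [t], hence given by an eigenform. Conversely conjugation
    preserves the exponent of [t] and multiplies the eigenform by a positive
    number. *)
Lemma bi_orderingP o : bi_ordering o <-> exists e s b, o = endpt e s b.
Proof.
split=> [bi|[e [s [b ->]]]].
  have cvx := (conradian_convex R trT o).1 (bi_ordering_conradian bi).
  have inv : t_invariant detT (restr o).
    apply/t_invariantP => v; rewrite !pos_restr => pv.
    by rewrite -sol_conj_t; have := bi _ t^-1%g pv; rewrite conjgE invgK mulgA.
  have [e [s rE]] := t_invariant_eigLO inv.
  exists e, s, (pos o t == e).
  rewrite {1}(convex_lex cvx) rE /endpt; congr lexLO.
  by case: (pos o t) (e) => -[].
move=> f g /pos_lexLO pf; apply/pos_lexLO.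
have -> : (f ^ g)%g.2 = f.2 by rewrite conjgE !solM_2 solV_2; clear; lia.
case: pf => [|[f0 pf]]; [by left|right; split=> //].
have fE : f = iota f.1 by apply: sol_eq.
rewrite fE conj_iota /= pos_eigLO psi_Tz// mulr_gt0 ?lamz_gt0//.
by rewrite -pos_eigLO.
Qed.

Lemma endpt_convex e s b : convex_subgroup (endpt e s b) (sol_H detT).
Proof. exact: lexLO_convex. Qed.

Lemma affLO_step e s x b g y : act e s g x = x -> 0 < (if b == e then 1 else -1) * (g.2%:~R : R) ->
  0 < (if b then 1 else -1) * (y - x) -> y < act e s g y.
Proof.
move=> gx; have -> : (0 < (if b == e then 1 else -1) * (g.2%:~R : R)) =
    (if b == e then 0 < g.2 else g.2 < 0).
  by case: (b == e); rewrite ?mul1r ?mulN1r ?oppr_gt0 ?ltr0z ?ltrz0.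
have E : act e s g y - y = (lam e ^ g.2 - 1) * (y - x) by move: gx; rewrite !actE; lra.
move=> gs yx; rewrite -subr_gt0 E; move: gs yx.
case: (b) => /=; rewrite ?mul1r ?mulN1r ?oppr_gt0 => gs yx.
  by rewrite mulr_gt0// subr_gt0 lamz_gt1//; case: (e) gs.
by rewrite nmulr_rgt0// subr_lt0 lamz_lt1//; case: (e) gs.
Qed.

Lemma near_all_pos (s : seq (SOL detT)) (F : R -> LO (SOL detT) -> Prop) :
  (forall g, g \in s -> exists r, 0 < r /\ forall eta o, 0 < eta -> eta < r -> F eta o -> pos o g) ->
  exists r, 0 < r /\ forall eta o, 0 < eta -> eta < r -> F eta o -> all (pos o) s.
Proof.
elim: s => [|g s IH] h; first by exists 1.
have [r1 [r10 h1]] := h g (mem_head _ _).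
have [|r2 [r20 h2]] := IH; first by move=> k ks; apply: h; rewrite inE ks orbT.
exists (Num.min r1 r2); rewrite lt_min r10; split=> // eta o e0.
rewrite lt_min => /andP[e1 e2] Fo /=; rewrite (h1 eta)//; exact: (h2 eta).
Qed.

(** Moving the point [x] slightly to the side given by [b] preserves the sign of
    finitely many elements. *)
Lemma affLO_not_isolated e s x b (U : set (LO (SOL detT))) : nbhs (affLO e s x b) U ->
  exists y, y <> x /\ U (affLO e s y false).
Proof.
move=> /nbhs_LO[l [lo lU]]; pose sg : R := if b then 1 else -1.
have sg2 : sg * sg = 1 by rewrite /sg; case: (b); rewrite ?mulr1// mulrNN mulr1.
have [r [r0 rP]] : exists r, 0 < r /\ forall eta o, 0 < eta -> eta < r ->
    o = affLO e s (x + sg * eta) false -> all (pos o) l.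
  apply: (@near_all_pos l (fun eta o => o = affLO e s (x + sg * eta) false)) => g gl.
  have /pos_affLO[gx|[gx gs]] := allP lo _ gl; last first.
    exists 1; split=> // eta _ e0 _ ->; apply/pos_affLO; left.
    by apply: (affLO_step gx gs); rewrite -/sg addrAC subrr add0r mulrA sg2 mul1r.
  have E y : act e s g y - y = (act e s g x - x) + (lam e ^ g.2 - 1) * (y - x).
    by rewrite !actE; lra.
  have k0 : 0 < `|lam e ^ g.2 - 1| + 1 by rewrite ltr_wpDl.
  exists ((act e s g x - x) / (`|lam e ^ g.2 - 1| + 1)); split.
    by rewrite divr_gt0// subr_gt0.
  move=> eta _ e0 + ->; rewrite ltr_pdivlMr// => er; apply/pos_affLO; left.
  rewrite -subr_gt0 E (addrC x) addrK.
  have : `|(lam e ^ g.2 - 1) * (sg * eta)| <= eta * `|lam e ^ g.2 - 1|.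
    rewrite !normrM (ger0_norm (ltW e0)).
    have -> : `|sg| = 1 by rewrite /sg; case: (b); rewrite ?normrN normr1.
    by rewrite mul1r mulrC.
  by rewrite ler_norml => /andP[h _]; lra.
exists (x + sg * (r / 2)); split.
  move=> /eqP; rewrite -subr_eq0 addrAC subrr add0r mulf_eq0 /sg.
  have -> : ((if b then 1 else -1) == 0 :> R) = false by case: (b); rewrite ?oppr_eq0 oner_eq0.
  by rewrite mulf_eq0 (gt_eqF r0) invr_eq0 pnatr_eq0.
by apply: lU; apply: (rP (r / 2)) => //; lra.
Qed.

(** An affine ordering is approached by those of nearby points, a lexicographic one
    by changing the order of H. *)
Lemma SOL_not_isolated o U : nbhs o U -> exists o', o' <> o /\ U o'.
Proof.
have [cvx|/(nonconvex_affLO R trT)[e [s [x [b ->]]]]] := pselect (convex_subgroup o (sol_H detT)); last first.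
  move=> /affLO_not_isolated[y [yx Uy]]; exists (affLO e s y false); split=> //.
  by move=> /affLO_inj[].
move=> /nbhs_LO[l [lo lU]].
pose l' : seq Z2 := [seq (g.1 : Z2) | g : SOL detT <- l & g.2 == 0].
have [k [ko Uk]] : exists k, k <> restr o /\ all (pos k) l'.
  apply: (@dirLO_perfect R (restr o) [set o' | all (pos o') l']).
  apply/nbhs_LO; exists l'; split=> //.
  apply/allP => z /mapP[g + ->]; rewrite mem_filter => /andP[/eqP g0 gl].
  rewrite pos_restr (_ : iota _ = g); first exact: (allP lo).
  exact: sol_eq.
exists (lexLO detT (pos o t) k); split.
  by move=> h; apply: ko; rewrite -h restr_lexLO.
apply: lU; apply/allP => g gl; apply/pos_lexLO.
have := allP lo _ gl; rewrite {1}(convex_lex cvx) => /pos_lexLO[h|[g0 _]]; first by left.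
right; split=> //; apply: (allP Uk); apply: map_f.
by rewrite mem_filter g0 eqxx.
Qed.

End EndPoints.

(** * Closures and limit points *)

Section Topology.
Variables (R : realType) (T : 'M[int]_2) (detT : \det T = 1) (trT : 2 < \tr T).
Implicit Types (v w : Z2) (e s b : bool) (f g h : SOL detT) (o : LO (SOL detT)).

Local Notation lam := (@lam R T).
Local Notation iota := (sol_iota detT).
Local Notation t := (sol_t detT).
Local Notation affLO := (@affLO R T detT trT).
Local Notation affSet := (@affSet R T detT trT).
Local Notation endpt := (@endpt R T detT trT).
Local Notation eigLO := (@eigLO R T detT trT).

Lemma closed_forall (X : topologicalType) (I : Type) (P : I -> X -> Prop) :
  (forall i, closed [set x | P i x]) -> closed [set x | forall i, P i x].
Proof.
move=> h; rewrite (_ : [set x | _] = \bigcap_(i in setT) [set x | P i x]); last first.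
  by apply/seteqP; split=> x /=; [move=> H i _; exact: H|move=> H i; exact: H].
exact: closed_bigI.
Qed.

Lemma closed_pos_imp (G : groupType) (g k : G) :
  closed [set o : LO G | pos o g -> pos o k].
Proof.
rewrite (_ : [set o | _] = [set o : LO G | ~~ pos o g] `|` [set o | pos o k]).
  apply: closedU; [exact: closed_posN|exact: closed_pos].
apply/seteqP; split=> o /=; first by case: (pos o g) => h; [right; exact: h|left].
by case=> [/negbTE ->|].
Qed.

(** For each pair [f], [g] the condition involves the sign of three elements. *)
Lemma closed_conradian : closed [set o : LO (SOL detT) | conradian o].
Proof.
rewrite (_ : [set o | _] = [set o : LO (SOL detT) | forall fg : SOL detT * SOL detT,
    ~~ pos o fg.1 \/ (pos o fg.2 -> pos o (fg.2^-1 * (fg.1 * fg.2 ^+ 2))%g)]).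
  apply: closed_forall => fg.
  rewrite (_ : [set x | _] = [set o : LO (SOL detT) | ~~ pos o fg.1] `|`
    [set o | pos o fg.2 -> pos o (fg.2^-1 * (fg.1 * fg.2 ^+ 2))%g])//.
  by apply: closedU; [exact: closed_posN|exact: closed_pos_imp].
apply/seteqP; split=> o h.
  move=> [f g] /=; case E : (pos o f); [right=> pg|by left].
  by rewrite -lo_ltE; apply: h.
move=> f g pf pg; rewrite lo_ltE.
by have [/negP|] := h (f, g); [|apply].
Qed.

Lemma conradian_restr_homeo b :
  closed [set o : LO (SOL detT) | conradian o /\ lo_lt o 1%g t = b] /\
  exists F : LO (SOL detT) -> LO Z2,
    homeo [set o : LO (SOL detT) | conradian o /\ lo_lt o 1%g t = b] setT F /\
    forall o, conradian o -> lo_lt o 1%g t = b -> restricts o (F o).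
Proof.
split.
  apply: closedI; first exact: closed_conradian.
  case: b; first exact: closed_pos.
  rewrite [X in closed X](_ : _ = [set o : LO (SOL detT) | ~~ pos o t]); first exact: closed_posN.
  by apply/seteqP; split=> o /=; rewrite -/(pos o t); case: (pos o t).
exists (@restr T detT); split; last by move=> o _ _; exact: restricts_restr.
exists (lexLO detT b); split.
- move=> o [con ot]; split=> //; rewrite [RHS](convex_lex ((conradian_convex R trT o).1 con)).
  by rewrite -ot.
- move=> k _; split; last exact: restr_lexLO.
  split; last exact: pos_lexLO_t.
  by apply: convex_conradian; exact: lexLO_convex.
- apply: within_continuous_LO => o v _; rewrite pos_restr => ov.
  by apply: filterS (nbhs_pos ov) => o' h _; rewrite pos_restr.
- apply: within_continuous_LO => k g _ /pos_lexLO[h|[g0 kg]].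
    by apply: filterE => k' _; apply/pos_lexLO; left.
  by apply: filterS (nbhs_pos kg) => k' h _; apply/pos_lexLO; right.
Qed.

(** Far enough the sign of an element no longer depends on the point: it is decided
    by its ratio or, if it belongs to H, by its translation length. *)
Lemma endpt_near e s b (U : set (LO (SOL detT))) : nbhs (endpt e s b) U ->
  exists M : R, forall y c, M < (if b then y else - y) -> U (affLO e s y c).
Proof.
move=> /nbhs_LO[l [lo lU]].
suff [M MP] : exists M : R, forall y c, M < (if b then y else - y) -> all (pos (affLO e s y c)) l.
  by exists M => y c h; apply: lU; exact: MP.
elim: l lo {lU} => [_|g l IH /= /andP[pg pl]]; first by exists 0.
have [M1 M1P] := IH pl.
have [M2 M2P] : exists M : R, forall y c, M < (if b then y else - y) -> pos (affLO e s y c) g.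
  move: pg => /pos_lexLO[[g0 gb]|[g0 pg]]; last first.
    have -> : g = iota g.1 by apply: sol_eq.
    by exists 0 => y c _; rewrite pos_affLO_iota -pos_eigLO.
  have [z gz] := fixed_point R trT e s g0.
  exists (if b then z else - z) => y c; move: gb; case: (b) => gb yz.
    have lg : 1 < lam e ^ g.2 by rewrite lamz_gt1//; move: gb g0; clear; case: e => /=; lia.
    by rewrite (pos_affLO_expand _ _ _ gz lg) yz.
  have lg : lam e ^ g.2 < 1 by rewrite lamz_lt1//; move: gb g0; clear; case: e => /=; lia.
  by rewrite (pos_affLO_contract trT _ _ gz lg) -ltrN2 yz.
exists (Num.max M1 M2) => y c; rewrite gt_max => /andP[h1 h2].
by rewrite M1P// M2P.
Qed.

Lemma affSetP e s o : affSet e s o <-> exists x b, o = affLO e s x b.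
Proof.
split=> [[p _ <-]|[x [b ->]]]; first by exists (val p).1, (val p).2.
by have [p ->] := affLO_dline detT trT e s x b; exists p.
Qed.

Lemma affine_orderingE : [set o : LO (SOL detT) | affine_ordering R o]
  = \bigcup_(p in [set: bool * bool]) affSet p.1 p.2.
Proof.
apply/seteqP; split=> o.
  move=> /(affine_orderingP R trT)[e [s [x [b ->]]]]; exists (e, s) => //.
  by apply/affSetP; exists x, b.
move=> [[e s] _ /affSetP[x [b oE]]]; apply/(affine_orderingP R trT).
by exists e, s, x, b.
Qed.

Lemma affine_conradian o : affine_ordering R o <-> ~ conradian o.
Proof.
split=> [/(affine_orderingP R trT)[e [s [x [b ->]]]]|ncon]; first exact: affLO_not_conradian.
apply/(affine_orderingP R trT)/(nonconvex_affLO R trT) => cvx; apply: ncon.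
exact: convex_conradian.
Qed.

Lemma open_affine : open [set o : LO (SOL detT) | affine_ordering R o].
Proof.
rewrite (_ : [set o | _] = ~` [set o : LO (SOL detT) | conradian o]).
  by apply: closed_openC; exact: closed_conradian.
by apply/seteqP; split=> o /affine_conradian.
Qed.

Lemma affSet_disjoint e s e' s' : affSet e s `&` affSet e' s' !=set0 -> e = e' /\ s = s'.
Proof.
move=> [ o [/affSetP[x [b ->]] /affSetP[x' [b' h]]]].
by have [-> -> _] := affLO_inj h.
Qed.

Lemma affSet_sub e s o : affSet e s o -> affine_ordering R o.
Proof. by move=> ao; have : (\bigcup_(p in [set: bool * bool]) affSet p.1 p.2) o by [exists (e, s)]; rewrite -affine_orderingE. Qed.

(** The four families are told apart, among affine orderings, by the sign of one
    element of H. *)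
Lemma open_affSet e s : open (affSet e s).
Proof.
rewrite openE => o aso.
have nA : nbhs o [set o | affine_ordering R o].
  by apply: open_nbhs_nbhs; split; [exact: open_affine|exact: affSet_sub aso].
have sep e' s' : (e, s) != (e', s') -> \forall k \near o, ~ affSet e' s' k.
  move=> /(eigvec_sep R detT trT)[v [v1 v2]].
  move: aso => /affSetP[x [b oE]].
  have ov : pos o (iota v) by rewrite oE pos_affLO_iota.
  apply: filterS (nbhs_pos ov) => k kv /affSetP[x' [b' kE]].
  by move: kv; rewrite /= kE pos_affLO_iota ltNge ltW.
have sep2 p : \forall k \near o, affSet p.1 p.2 k -> p = (e, s).
  have [->|ne] := eqVneq p (e, s); first by apply: filterE.
  case: p ne => e' s' ne; rewrite eq_sym in ne.
  by apply: filterS (sep _ _ ne) => k h /h.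
have S1 := sep2 (true, true); have S2 := sep2 (true, false).
have S3 := sep2 (false, true); have S4 := sep2 (false, false).
rewrite /interior /=; near=> k.
have : [set o | affine_ordering R o] k by near: k.
rewrite affine_orderingE => -[[e' s'] _ /= ak].
suff [-> ->] : (e, s) = (e', s') by [].
apply/esym; case: e' s' ak => -[] ak.
- by move: ak; near: k.
- by move: ak; near: k.
- by move: ak; near: k.
- by move: ak; near: k.
Unshelve. all: by end_near. Qed.

Lemma endpt_conradian e s b : conradian (endpt e s b).
Proof. by apply: convex_conradian; exact: endpt_convex. Qed.

Lemma affSet_restr e s o : affSet e s o -> restr o = eigLO e s.
Proof. by move=> /affSetP[x [b ->]]; exact: restr_affLO. Qed.

Lemma closed_restr (k : LO Z2) : closed [set o : LO (SOL detT) | restr o = k].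
Proof.
rewrite (_ : [set o | _] = [set o : LO (SOL detT) | forall v, (pos o (iota v) : Prop) = pos k v]).
  apply: closed_forall => v; case: (pos k v).
    rewrite (_ : [set x | _] = [set o : LO (SOL detT) | pos o (iota v)]); first exact: closed_pos.
    by apply/seteqP; split=> o /= ->.
  rewrite (_ : [set x | _] = [set o : LO (SOL detT) | ~~ pos o (iota v)]); first exact: closed_posN.
  apply/seteqP; split=> o /=; case: (pos o (iota v)) => //= h.
  by have : true by []; rewrite {1}h.
apply/seteqP; split=> o /=; first by move=> <- v; rewrite pos_restr.
by move=> h; apply: LO_sub_eq => v; rewrite pos_restr h.
Qed.

(** A limit of orderings of the family induces the same ordering on H; if it is not
    affine then H is convex and only the sign of [t] remains. *)
Lemma closure_affSet e s :
  closure (affSet e s) = affSet e s `|` [set endpt e s false; endpt e s true].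
Proof.
apply/seteqP; split=> [ o clo|o].
  have ro : restr o = eigLO e s.
    have cl : closed [set k : LO (SOL detT) | restr k = eigLO e s] := @closed_restr (eigLO e s).
    by apply: (cl o); apply: closureS clo => k; exact: affSet_restr.
  have [cvx|/(nonconvex_affLO R trT)[e' [s' [x [b oE]]]]] := pselect (convex_subgroup o (sol_H detT)).
    right; rewrite (convex_lex cvx) ro; rewrite /= !endptE.
    by case: (pos o t) (e) => -[]; [right|left|left|right].
  left; move: ro; rewrite oE restr_affLO => /eigLO_inj[-> ->].
  by apply/affSetP; exists x, b.
have cl b : closure (affSet e s) (endpt e s b).
  move=> U /endpt_near[M MP].
  exists (affLO e s (if b then M + 1 else - (M + 1)) false); split.
    by apply/affSetP; exists (if b then M + 1 else - (M + 1)), false.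
  by apply: MP; case: (b); rewrite ?opprK ltrDl.
by case=> [|[->|->]]; [exact: subset_closure|exact: cl|exact: cl].
Qed.

(** Affine orderings are invariant under [t] on H, which is a closed condition: a
    Conradian limit of affine orderings is a bi-ordering. The converse is
    [endpt_near]. *)
Lemma limit_affine : limit_point [set o : LO (SOL detT) | affine_ordering R o]
    `\` [set o : LO (SOL detT) | affine_ordering R o]
  = [set o : LO (SOL detT) | bi_ordering o].
Proof.
apply/seteqP; split=> [ o [lo no]|o].
  have con : conradian o by apply: contrapT => /affine_conradian.
  have cvx := (conradian_convex R trT o).1 con.
  apply/(bi_orderingP R trT).
  have inv : t_invariant detT (restr o).
    apply/t_invariantP => v; rewrite !pos_restr.
    have cl : closed [set o : LO (SOL detT) | pos o (iota v) -> pos o (iota (T *m v : 'cV[int]_2))].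
      exact: closed_pos_imp.
    apply: (cl o).
    apply: (closureS _ (subset_limit_point lo)) => k /(affine_orderingP R trT)[e [s [x [b ->]]]] /=.
    by rewrite !pos_affLO_iota psi_T// => h; rewrite mulr_gt0// lam_gt0.
  have [e [s rE]] := t_invariant_eigLO R trT inv.
  exists e, s, (pos o t == e); rewrite {1}(convex_lex cvx) rE endptE; congr lexLO.
  by case: (pos o t) (e) => -[].
move=> /(bi_orderingP R trT)[e [s [b ->]]]; split; last first.
  by move/affine_conradian; apply; exact: endpt_conradian.
move=> U /endpt_near[M MP].
exists (affLO e s (if b then M + 1 else - (M + 1)) false); split.
- apply/eqP => h; have := @affLO_not_conradian R T detT trT e s (if b then M + 1 else - (M + 1)) false.
  by rewrite h; apply; exact: endpt_conradian.
- by apply/(affine_orderingP R trT); exists e, s, (if b then M + 1 else - (M + 1)), false.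
- by apply: MP; case: (b); rewrite ?opprK ltrDl.
Qed.

Lemma clopen_SOL_cantor (U : set (LO (SOL detT))) : clopen U -> U !=set0 -> is_cantor U.
Proof.
move=> [oU cU] U0.
pose enum (n : nat) : SOL detT := if @choice.unpickle ('cV[int]_2 * int)%type n is Some g then g else (0, 0).
apply: (@is_cantor_LO R _ enum) => //.
  by move=> g; exists (@choice.pickle ('cV[int]_2 * int)%type g); rewrite /enum choice.pickleK.
move=> o V Uo oV; have nU : nbhs o (U `&` V).
  by apply: filterI => //; apply: open_nbhs_nbhs.
by have [k [ko [Uk Vk]]] := SOL_not_isolated R trT nU; exists k.
Qed.

Lemma affine_local_cantor o : affine_ordering R o ->
  exists U, [/\ nbhs o U, U `<=` [set o | affine_ordering R o] & is_cantor U].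
Proof.
move=> ao; have : nbhs o [set o | affine_ordering R o].
  by apply: open_nbhs_nbhs; split=> //; exact: open_affine.
move=> /nbhs_LO[l [lo lA]]; exists [set o | all (pos o) l]; split=> //.
  by apply/nbhs_LO; exists l.
by apply: clopen_SOL_cantor; [exact: clopen_all_pos|exists o].
Qed.

Lemma SOL_cantor : is_cantor [set: LO (SOL detT)].
Proof.
apply: clopen_SOL_cantor; first by split; [exact: openT|exact: closedT].
by exists (affLO true true 0 false).
Qed.

Lemma SOL_isolated : isolated [set: LO (SOL detT)] = set0.
Proof.
apply/seteqP; split=> // o [_ [V oV Vo]].
have [k [ko Vk]] := SOL_not_isolated R trT oV; apply: ko.
by have : (V `&` setT) k by []; rewrite Vo.
Qed.

End Topology.

(** * Counting and parametrizing *)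

Lemma card_bij_finType (I : finType) (U : Type) (S : set U) (f : I -> U) :
  set_bij setT S f -> (S #= `I_#|I|)%card.
Proof.
move=> [fS finj fsurj].
have /choice[k kP] : forall y, exists n, S y -> exists x, f x = y /\ n = enum_rank x :> nat.
  move=> y; have [/fsurj[x _ xy]|nS] := pselect (S y); last by exists 0%N.
  by exists (enum_rank x) => _; exists x.
apply/card_set_bijP; exists k; split.
- by move=> y /kP[x [_ ->]] /=.
- move=> y y' /set_mem Sy /set_mem Sy'; have [x [xy ->]] := kP y Sy.
  have [x' [xy' ->]] := kP y' Sy' => /val_inj/enum_rank_inj xx.
  by rewrite -xy -xy' xx.
- move=> n /= nI; exists (f (enum_val (Ordinal nI))); first exact: fS.
  have [x [/finj xx ->]] := kP _ (fS (enum_val (Ordinal nI)) Logic.I).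
  by rewrite xx ?inE// enum_valK.
Qed.

Lemma line_facts (R : realType) (d : 'cV[R]_2) : unit_dir d ->
  [/\ pseudo_ordering (line_lt d) (line_pts d),
      (exists v, line_pts d = cyclic_subgroup v) /\
        pseudo_convex (line_lt d) (line_pts d) (line_pts d),
      line_pts d = [set 1%g] <-> ~ rational_slope d,
      is_ordering (line_lt d) <-> ~ rational_slope d &
      rational_slope d ->
        forall v, line_pts d = cyclic_subgroup v ->
        forall b : bool, exists! o : LO Z2,
          extends o (line_lt d) /\ lo_lt o 1%g v = b].
Proof.
move=> ud; have pM := @hp_lt_mul2l R d; split.
- by rewrite line_lt_fun line_ptsE; exact: pseudo_ordering_real.
- split; first exact: line_pts_cyclic.
  by rewrite line_lt_fun line_ptsE; exact: pseudo_convex_stab.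
- exact: line_pts_trivial.
- by rewrite -(line_pts_trivial ud) line_lt_fun line_ptsE; exact: is_ordering_real.
- move=> rd v vE b; rewrite line_lt_fun.
  apply: (exists_unique_extension pM (q := dot d)).
  + by move=> h k _ _; exact: dotM.
  + by move=> h; rewrite /= hp1; exact: dot_hp_eq0.
  + by rewrite -line_ptsE.
  + move=> v1; apply: (line_pts_trivial ud).1 rd.
    rewrite vE v1; apply/seteqP; split=> [h [n]|h ->].
      by rewrite expg1n invg1 => -[].
    by exists 0%N; left; rewrite expg0.
Qed.

Section Pieces.
Variables (R : realType) (T : 'M[int]_2) (detT : \det T = 1) (trT : 2 < \tr T).
Implicit Types (v w : Z2) (e s b : bool) (f g h : SOL detT) (o : LO (SOL detT)).

Local Notation psi := (@psi R T).
Local Notation lam := (@lam R T).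
Local Notation iota := (sol_iota detT).
Local Notation t := (sol_t detT).
Local Notation act := (@act R T detT).
Local Notation endpt := (@endpt R T detT trT).
Local Notation D := (@divset R T).

Lemma eigenvalue_facts : exists l1 l2 : R,
  [/\ l1 <> l2, irrational l1, irrational l2 &
      forall l, eigenvalue (map_mx intr T : 'M[R]_2) l <-> l = l1 \/ l = l2].
Proof.
exists (lam true), (lam false); split; try exact: lam_irrational.
  by apply/eqP; rewrite gt_eqF// lam_lt.
move=> l; rewrite (eigenvalue_lam detT trT); split=> [[[] ->]|[->|->]]; [by left|by right| |].
  by exists true.
by exists false.
Qed.

(** The factor that makes [eigvec e s] a unit vector. *)
Definition eignorm e : R := projT1 (cid (normalize_dir (@eigvec_neq0 R T detT trT e true))).

Lemma eignormP e : 0 < eignorm e /\ unit_dir (eignorm e *: eigvec R T e true).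
Proof. exact: projT2 (cid (normalize_dir (@eigvec_neq0 R T detT trT e true))). Qed.

Definition eigdir e s : 'cV[R]_2 := eignorm e *: eigvec R T e s.

Lemma eigdir_neg e s : eigdir e (~~ s) = - eigdir e s.
Proof. by rewrite /eigdir eigvec_neg scalerN. Qed.

Lemma eigdir_unit e s : unit_dir (eigdir e s).
Proof.
case: s; first by case: (eignormP e).
have -> : eigdir e false = - eigdir e true by rewrite -eigdir_neg.
by have [_] := eignormP e; rewrite /unit_dir !mxE !sqrrN.
Qed.

Lemma eigdir_T e s : map_mx intr T *m eigdir e s = lam (~~ e) *: eigdir e s.
Proof. by rewrite /eigdir -scalemxAr eigvec_T// !scalerA (mulrC (eignorm e)). Qed.

Lemma hp_eigdir e s v : (0 < hp (eigdir e s) v) = (0 < psi e s v).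
Proof. by rewrite /eigdir hpZ -psiP pmulr_rgt0//; case: (eignormP e). Qed.

Lemma line_lt_eigdir e s v : line_lt (eigdir e s) 1%g v <-> 0 < psi e s v.
Proof. by rewrite line_lt1E hp_eigdir. Qed.

Lemma eigdir_eigendirection e s : eigendirection T (eigdir e s).
Proof. by split; [exact: eigdir_unit|exists (lam (~~ e)); exact: eigdir_T]. Qed.

Lemma eigendirectionP d : eigendirection T d -> exists e s, d = eigdir e s.
Proof.
move=> ed; have [e [s [c [c0 dE]]]] := eigendirection_eigvec detT trT ed.
exists e, s; have [n0 _] := eignormP e; case: ed => ud _.
apply: (unit_parallel (eigdir_unit e s) ud (c := c / eignorm e)).
  by rewrite divr_gt0.
by rewrite dE /eigdir [RHS]scalerA mulfVK// gt_eqF.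
Qed.

Lemma eigdir_inj e s e' s' : eigdir e s = eigdir e' s' -> (e, s) = (e', s').
Proof.
move=> h; apply/eqP; apply: contraT => /(eigvec_sep R detT trT)[v [v1 v2]].
have := hp_eigdir e s v; rewrite h hp_eigdir v1.
by rewrite ltNge (ltW v2).
Qed.

Lemma eigendirection_card : ([set d : 'cV[R]_2 | eigendirection T d] #= `I_4)%card.
Proof.
have -> : 4%N = #|{: bool * bool}| by rewrite card_prod card_bool.
apply: (@card_bij_finType _ _ _ (fun p : bool * bool => eigdir p.1 p.2)); split.
- by move=> p _; exact: eigdir_eigendirection.
- by move=> [e s] [e' s'] _ _ /eigdir_inj.
- by move=> d /eigendirectionP[e [s ->]]; exists (e, s).
Qed.

Lemma endpt_bij : set_bij setT [set o : LO (SOL detT) | bi_ordering o]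
  (fun i : bool * bool * bool => endpt i.1.1 i.1.2 i.2).
Proof.
split.
- by move=> [[e s] b] _; apply/(bi_orderingP R trT); exists e, s, b.
- by move=> [[e s] b] [[e' s'] b'] _ _ /= /endpt_inj[-> -> ->].
- by move=> o /(bi_orderingP R trT)[e [s [b ->]]]; exists (e, s, b).
Qed.

Lemma bi_ordering_card : ([set o : LO (SOL detT) | bi_ordering o] #= `I_8)%card.
Proof.
have -> : 8%N = #|{: bool * bool * bool}| by rewrite !card_prod card_bool.
exact: card_bij_finType endpt_bij.
Qed.

Lemma pos_endpt_t e s b : lo_lt (endpt e s b) 1%g t = (b == e).
Proof. exact: pos_lexLO_t. Qed.

Lemma pos_endpt_iota e s b v : lo_lt (endpt e s b) 1%g (iota v) = (0 < psi e s v).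
Proof. by rewrite -/(pos _ _) pos_lexLO_iota pos_eigLO. Qed.

Lemma bi_ordering_unique (d : 'cV[R]_2) (b : bool) : eigendirection T d ->
  exists! o : LO (SOL detT),
    [/\ bi_ordering o, lo_lt o 1%g t = b &
        forall v, line_lt d 1%g v -> lo_lt o 1%g (iota v)].
Proof.
move=> /eigendirectionP[e [s ->]].
exists (endpt e s (b == e)); split.
  split; first by apply/(bi_orderingP R trT); exists e, s, (b == e).
    by rewrite pos_endpt_t; case: (b) (e) => -[].
  by move=> v /line_lt_eigdir h; rewrite pos_endpt_iota.
move=> o [/(bi_orderingP R trT)[e' [s' [b' ->]]] ot oH].
have es : (e, s) = (e', s').
  apply/eqP; apply: contraT => /(eigvec_sep R detT trT)[v [v1 v2]].
  have := oH v ((line_lt_eigdir _ _ _).2 v1); rewrite pos_endpt_iota.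
  by rewrite ltNge (ltW v2).
case: es ot => <- <-; rewrite pos_endpt_t => <-.
by case: (b') (e) => -[].
Qed.

Lemma bi_ordering_facts o : bi_ordering o <->
  conradian o /\
  exists (o' : LO Z2) (d : 'cV[R]_2),
    [/\ restricts o o', eigendirection T d & extends o' (line_lt d)].
Proof.
split=> [/(bi_orderingP R trT)[e [s [b ->]]]|[con [k [d [/restrictsP -> ed ex]]]]].
  split; first exact: endpt_conradian.
  exists (restr (endpt e s b)), (eigdir e s); split.
  - exact: restricts_restr.
  - exact: eigdir_eigendirection.
  - rewrite restr_lexLO => v w /line_ltE vw; rewrite lo_ltE pos_eigLO.
    by rewrite -hp_eigdir hpM hpV addrC subr_gt0.
apply/(bi_orderingP R trT).
have [e [s [c [c0 dE]]]] := eigendirection_eigvec detT trT ed.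
exists e, s, (pos o t == e); rewrite endptE -(extends_eigvec_LO detT trT c0 dE ex).
rewrite {1}(convex_lex ((conradian_convex R trT o).1 con)); congr lexLO.
by case: (pos o t) (e) => -[].
Qed.

(** A homothety turns the action into one of the four normal forms, where the point
    is determined by [orbit_inj]. *)
Lemma affine_parameter (a : SOL detT -> R -> R) (l y : R) : affine_action a l ->
  exists! p : bool * bool * R, forall f g : SOL detT,
    orbit_lt a y f g <-> orbit_lt (act p.1.1 p.1.2) p.2 f g.
Proof.
move=> aff; have [e [s [c [c0 _ aE]]]] := affine_normal trT aff.
have E g : (y < a g y) = (y / c < act e s g (y / c)).
  have := aE g (y / c); rewrite mulrCA mulfV ?gt_eqF// mulr1 => ->.
  by rewrite -ltr_pdivrMl// mulrC.
exists (e, s, y / c); split=> [f g|[[e' s'] x'] h] /=; first by rewrite /orbit_lt E.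
have H g : y / c < act e s g (y / c) <-> x' < act e' s' g x'.
  by have := h 1%g g; rewrite /orbit_lt /= invg1 mul1g E.
by have [-> -> ->] := orbit_inj trT H.
Qed.

Lemma divset_orbit e s : D = [set x | exists (n : nat) (h : SOL detT),
  [/\ (0 < n)%N, sol_H detT h & n%:R * x = act e s h 0]].
Proof.
apply/seteqP; split=> [x /(divsetP detT trT e s)[n [v [n0 nv]]]|x [n [h [n0 /sol_HP h0 nx]]]].
  exists n, (iota v); split=> //; first exact/sol_HP.
  by rewrite act_iota add0r.
apply/(divsetP detT trT e s); exists n, h.1; split=> //.
by rewrite nx actE mulr0 add0r.
Qed.

Lemma orbit_facts e s x :
  [/\ pseudo_ordering (orbit_lt (act e s) x) (stab (act e s) x),
      is_ordering (orbit_lt (act e s) x) <-> stab (act e s) x = [set 1%g] &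
      stab (act e s) x = [set 1%g] <-> ~ D x].
Proof.
have pM := @act_lt_mul2l R T detT trT e s x.
split; last exact: stab_trivialP.
- by rewrite (orbit_lt_fun detT trT) stabE; exact: (pseudo_ordering_real pM).
- by rewrite (orbit_lt_fun detT trT) stabE; exact: (is_ordering_real pM).
Qed.

Lemma orbit_stab_facts e s x : D x ->
  [/\ exists g, stab (act e s) x = cyclic_subgroup g,
      pseudo_convex (orbit_lt (act e s) x) (stab (act e s) x) (stab (act e s) x),
      forall g, stab (act e s) x g -> exists mu, 0 < mu /\
        forall y, act e s g y = x + mu * (y - x) &
      forall g, stab (act e s) x = cyclic_subgroup g ->
      forall b : bool, exists! o : LO (SOL detT),
        extends o (orbit_lt (act e s) x) /\ lo_lt o 1%g g = b].
Proof.
have pM := @act_lt_mul2l R T detT trT e s x.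
move=> Dx; split; first exact: stab_cyclic.
- by rewrite (orbit_lt_fun detT trT) stabE; exact: (pseudo_convex_stab pM).
- move=> g gx; exists (lam e ^ g.2); split=> [|y]; first exact: lamz_gt0.
  by move: gx; rewrite /stab /= !actE => gx; lra.
- move=> g gE b; rewrite (orbit_lt_fun detT trT).
  apply: (exists_unique_extension pM (q := fun g : SOL detT => g.2%:~R)).
  + by move=> h k _ _; rewrite solM_2 intrD.
  + move=> h; rewrite /= act1 => hx /eqP; rewrite intr_eq0 => /eqP h0.
    exact: (act_fix_iota trT hx h0).
  + by rewrite -stabE.
  + move=> g1; apply: (stab_trivialP detT trT e s x).1 Dx.
    rewrite gE g1; apply/seteqP; split=> [h [n]|h ->].
      by rewrite expg1n invg1 => -[].
    by exists 0%N; left; rewrite expg0.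
Qed.

Lemma endpt_limit e s b U : nbhs (endpt e s b) U ->
  \forall x \near (if b then pinfty_nbhs R else ninfty_nbhs R),
    forall p, (val p).1 = x -> U (@dlineLO R T detT trT e s p).
Proof.
move=> /endpt_near[M MP]; case: b MP => MP.
  exists M; split; first exact: num_real.
  by move=> x Mx p px; apply: MP; rewrite px.
exists (- M); split; first exact: num_real.
by move=> x Mx p px; apply: MP; rewrite px; lra.
Qed.

Lemma dilation_limit (a : SOL detT -> R -> R) (l : R) : affine_action a l -> 1 < l ->
  exists o : LO (SOL detT),
    [/\ bi_ordering o, convex_subgroup o (translations a) &
        forall g, \forall x \near +oo, orbit_lt a x 1%g g <-> lo_lt o 1%g g].
Proof.
move=> aff l1; have [e [s [c [c0 le aE]]]] := affine_normal trT aff.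
have aE' g x : a g x = c * act e s g (x / c).
  by rewrite -aE mulrCA mulfV ?gt_eqF// mulr1.
exists (endpt e s true); split.
- by apply/(bi_orderingP R trT); exists e, s, true.
- rewrite (_ : translations a = sol_H detT); first exact: lexLO_convex.
  apply/seteqP; split=> [g [k gk]|g /sol_HP g0].
    apply/sol_HP; apply: (@lamz_eq1 R T detT trT e).
    have h0 := gk 0; have h1 := gk c; move: h0 h1.
    rewrite !aE' !actE mul0r mulfV ?gt_eqF// => h0 h1.
    have : c * (lam e ^ g.2 - 1) = 0 by lra.
    by move/eqP; rewrite mulf_eq0 gt_eqF//= subr_eq0 => /eqP.
  exists (c * psi e s g.1) => x.
  by rewrite aE' actE g0 expr0z mul1r mulrDr mulrCA mulfV ?gt_eqF// mulr1.
- have key g : pos (endpt e s true) g -> \forall x \near +oo, x < a g x.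
    move=> pg; have [M MP] := endpt_near (nbhs_pos pg).
    exists (c * Num.max M 0); split; first exact: num_real.
    move=> x; rewrite -ltr_pdivlMl// mulrC gt_max => /andP[Mx x0].
    have := MP (x / c) false Mx => /pos_affLO [h|[hx gs]].
      by rewrite aE' -ltr_pdivrMl// mulrC.
    have := MP (x / c) true Mx => /pos_affLO [h|[_ gs']].
      by rewrite aE' -ltr_pdivrMl// mulrC.
    (* [g] cannot fix a point so far away: the two orderings defined by that point
       would give it opposite signs. *)
    exfalso; move: gs gs'; case: (e); rewrite /= !mul1r mulN1r; lra.
  move=> g; have [->|g1] := eqVneq g 1%g.
    apply: filterE => x; rewrite /orbit_lt invg1 mulg1 -/(pos _ _) pos1.
    by have [[-> _] _] := aff; rewrite ltxx.
  have [pg|ng] := boolP (pos (endpt e s true) g).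
    apply: filterS (key g pg) => x h; rewrite -/(pos _ _) pg /orbit_lt invg1 mul1g.
    by rewrite h.
  apply: filterS (key g^-1%g _); last by rewrite posV.
  move=> x h; rewrite -/(pos _ _) (negbTE ng) /orbit_lt invg1 mul1g; split=> // h2.
  move: h h2; rewrite !aE' -!ltr_pdivrMl// !(mulrC c^-1).
  rewrite -(act_mono trT e s g (x / c)) -actM// mulgV act1 => h1 h2.
  by have := lt_trans h1 h2; rewrite ltxx.
Qed.

End Pieces.

(** * The left-orderings of SOL *)

Theorem mainTheorem4 (R : realType) (T : 'M[int]_2) (detT : \det T = 1)
    (trT : 2 < \tr T) :
  (* eigenvalues of T; the derived subgroup, the subgroup H and the element t *)
  [/\ exists l1 l2 : R, [/\ l1 <> l2, irrational l1, irrational l2 &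
        forall l, eigenvalue (map_mx intr T : 'M[R]_2) l <-> l = l1 \/ l = l2],
      exists j : Z2 -> SOL detT,
        [/\ injective j, forall v w : Z2, j (v * w)%g = (j v * j w)%g,
            range j = derived_subgroup (SOL detT) &
            forall v : Z2,
              (sol_t detT * j v * (sol_t detT)^-1)%g = j (T *m v : 'cV[int]_2)],
      [/\ injective (sol_iota detT),
          forall v w : Z2, sol_iota detT (v * w)%g
                           = (sol_iota detT v * sol_iota detT w)%g,
          forall g h, sol_H detT g -> sol_H detT (g ^ h)%g &
          forall v : Z2, (sol_t detT * sol_iota detT v * (sol_t detT)^-1)%g
                         = sol_iota detT (T *m v : 'cV[int]_2)],
      sol_H detT
        = [set g | exists n, (0 < n)%N /\
                             derived_subgroup (SOL detT) (g ^+ n)%g] &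
      sol_H detT = derived_subgroup (SOL detT) <-> \tr T = 3]
  /\
  (* Conradian or affine *)
  (forall o : LO (SOL detT), affine_ordering R o <-> ~ conradian o)
  /\
  (* the Conradian orderings; the space LO(Z^2) *)
  [/\ closed [set o : LO (SOL detT) | conradian o],
      forall o : LO (SOL detT), conradian o <-> convex_subgroup o (sol_H detT),
      forall b : bool,
        closed [set o | conradian o /\ lo_lt o 1%g (sol_t detT) = b] /\
        exists F : LO (SOL detT) -> LO Z2,
          homeo [set o | conradian o /\ lo_lt o 1%g (sol_t detT) = b] setT F /\
          forall o, conradian o -> lo_lt o 1%g (sol_t detT) = b ->
            restricts o (F o),
      forall d : 'cV[R]_2, unit_dir d ->
        [/\ pseudo_ordering (line_lt d) (line_pts d),
            (exists v, line_pts d = cyclic_subgroup v) /\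
              pseudo_convex (line_lt d) (line_pts d) (line_pts d),
            line_pts d = [set 1%g] <-> ~ rational_slope d,
            is_ordering (line_lt d) <-> ~ rational_slope d &
            rational_slope d ->
              forall v, line_pts d = cyclic_subgroup v ->
              forall b : bool, exists! o : LO Z2,
                extends o (line_lt d) /\ lo_lt o 1%g v = b] &
      is_cantor [set: LO Z2] /\
      exists Phi : LO Z2 -> dcircle R,
        homeo setT setT Phi /\
        forall o, extends o (line_lt (val (Phi o)).1)]
  /\
  (* the bi-orderings *)
  [/\ forall (o : LO Z2) (d : 'cV[R]_2), unit_dir d -> extends o (line_lt d) ->
        (t_invariant detT o <-> eigendirection T d),
      forall o : LO (SOL detT), bi_ordering o <->
        conradian o /\
        exists (o' : LO Z2) (d : 'cV[R]_2),
          [/\ restricts o o', eigendirection T d & extends o' (line_lt d)],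
      ([set d : 'cV[R]_2 | eigendirection T d] #= `I_4)%card,
      forall (d : 'cV[R]_2) (b : bool), eigendirection T d ->
        exists! o : LO (SOL detT),
          [/\ bi_ordering o, lo_lt o 1%g (sol_t detT) = b &
              forall v : Z2, line_lt d 1%g v -> lo_lt o 1%g (sol_iota detT v)] &
      ([set o : LO (SOL detT) | bi_ordering o] #= `I_8)%card]
  /\
  (* the affine orderings *)
  let Aff := [set o : LO (SOL detT) | affine_ordering R o] in
  let Bi := [set o : LO (SOL detT) | bi_ordering o] in
  [/\ open Aff /\ limit_point Aff `\` Aff = Bi,
      forall o, Aff o -> exists U, [/\ nbhs o U, U `<=` Aff & is_cantor U],
      (* [e] selects the eigenvalue, [s] the orientation of the line *)
      exists (lam : bool -> R) (rho : bool -> bool -> SOL detT -> R -> R)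
             (D : set R),
        [/\ [/\ lam false < 1, 1 < lam true,
                forall e s, affine_action (rho e s) (lam e),
                forall e s g x, rho e (~~ s) g x = - rho e s g (- x) &
                forall (a : SOL detT -> R -> R) (l y : R), affine_action a l ->
                  exists! p : bool * bool * R, forall f g : SOL detT,
                    orbit_lt a y f g <-> orbit_lt (rho p.1.1 p.1.2) p.2 f g],
            [/\ countable D, dense D &
                forall e s, D = [set x | exists (n : nat) (h : SOL detT),
                  [/\ (0 < n)%N, sol_H detT h & n%:R * x = rho e s h 0]]],
            forall e s x,
              [/\ pseudo_ordering (orbit_lt (rho e s) x) (stab (rho e s) x),
                  is_ordering (orbit_lt (rho e s) x) <->
                    stab (rho e s) x = [set 1%g] &
                  stab (rho e s) x = [set 1%g] <-> ~ D x],
            forall e s x, D x ->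
              [/\ exists g, stab (rho e s) x = cyclic_subgroup g,
                  pseudo_convex (orbit_lt (rho e s) x)
                    (stab (rho e s) x) (stab (rho e s) x),
                  forall g, stab (rho e s) x g ->
                    exists mu, 0 < mu /\
                      forall y, rho e s g y = x + mu * (y - x) &
                  forall g, stab (rho e s) x = cyclic_subgroup g ->
                  forall b : bool, exists! o : LO (SOL detT),
                    extends o (orbit_lt (rho e s) x) /\ lo_lt o 1%g g = b] &
            (* the four copies of the doubled line and their end points *)
            exists (A : bool -> bool -> set (LO (SOL detT)))
                   (Psi : bool -> bool -> order_topology (dline D) ->
                          LO (SOL detT))
                   (endpt : bool -> bool -> bool -> LO (SOL detT))
                   (d : bool -> bool -> 'cV[R]_2),
              [/\ [/\ forall e s, open (A e s),
                      Aff = \bigcup_(p in [set: bool * bool]) A p.1 p.2 &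
                      forall e s e' s', A e s `&` A e' s' !=set0 ->
                        e = e' /\ s = s'],
                  forall e s, homeo setT (A e s) (Psi e s) /\
                    forall p, extends (Psi e s p)
                                (orbit_lt (rho e s) (val p).1),
                  [/\ set_bij setT Bi (fun i => endpt i.1.1 i.1.2 i.2),
                      forall e s, closure (A e s)
                        = A e s `|` [set endpt e s false; endpt e s true] &
                      forall e s b U, nbhs (endpt e s b) U ->
                        \forall x \near (if b then pinfty_nbhs R
                                         else ninfty_nbhs R),
                          forall p, (val p).1 = x -> U (Psi e s p)] &
                  forall e s,
                    [/\ unit_dir (d e s), d e (~~ s) = - d e s,
                        map_mx intr T *m d e s = lam (~~ e) *: d e s,
                        forall b (v : Z2), line_lt (d e s) 1%g v ->
                          lo_lt (endpt e s b) 1%g (sol_iota detT v) &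
                        forall b, lo_lt (endpt e s b) 1%g (sol_t detT)
                                  = (b == e)]]] &
      forall (a : SOL detT -> R -> R) (l : R), affine_action a l -> 1 < l ->
        exists o : LO (SOL detT),
          [/\ bi_ordering o, convex_subgroup o (translations a) &
              forall g, \forall x \near +oo,
                orbit_lt a x 1%g g <-> lo_lt o 1%g g]]
  /\
  (isolated [set: LO (SOL detT)] = set0 /\ is_cantor [set: LO (SOL detT)]).
Proof.
split.
  have [h1 h2 h3] := sol_derived_facts R detT trT.
  split=> //; first exact: eigenvalue_facts.
  split; [exact: sol_iota_inj|exact: sol_iotaM|exact: sol_H_normal|exact: sol_conj_t].
split; first by move=> o; exact: affine_conradian.
split.
  split.
  - exact: closed_conradian.
  - by move=> o; exact: (conradian_convex R).
  - exact: (conradian_restr_homeo R).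
  - exact: line_facts.
  - split; [exact: (LO_Z2_cantor R)|exact: LO_Z2_dcircle].
split.
  split.
  - by move=> o d; exact: t_invariant_eigendirection.
  - by move=> o; exact: bi_ordering_facts.
  - exact: eigendirection_card.
  - by move=> d b; exact: bi_ordering_unique.
  - exact: (bi_ordering_card R).
split; last by split; [exact: (SOL_isolated R)|exact: (SOL_cantor R)].
split.
- by split; [exact: open_affine|exact: limit_affine].
- by move=> o; exact: affine_local_cantor.
- exists (lam R T), (@act R T detT), (@divset R T); split.
  + split; [exact: lam_false_lt1|exact: lam_true_gt1|exact: act_affine| |].
      by move=> e s g x; exact: act_neg.
    by move=> a l y; exact: affine_parameter.
  + split; [exact: divset_countable|exact: divset_dense|exact: divset_orbit].
  + exact: orbit_facts.
  + exact: orbit_stab_facts.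
  + exists (@affSet R T detT trT), (@dlineLO R T detT trT), (@endpt R T detT trT), (@eigdir R T detT trT).
    split.
    * split; [exact: open_affSet|exact: affine_orderingE|exact: affSet_disjoint].
    * move=> e s; split; [exact: dlineLO_homeo|exact: extends_dlineLO].
    * split; [exact: endpt_bij|exact: closure_affSet|exact: endpt_limit].
    * move=> e s; split.
      - exact: eigdir_unit.
      - exact: eigdir_neg.
      - exact: eigdir_T.
      - by move=> b v /line_lt_eigdir h; rewrite pos_endpt_iota.
      - by move=> b; exact: pos_endpt_t.
- by move=> a l; exact: dilation_limit.
Qed.
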